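(* Let $(\phi_t)_{t\ge 0}$ be a non-elliptic semigroup of holomorphic functions in the unit disk $\mathbb{D}$ and let $\Delta$ be a petal of $(\phi_t)$. Then $$\lim_{t\to-\infty}\lambda_{\mathbb{D}}(\phi_t(z))=\lambda_\Delta(z),\quad z\in\Delta,$$ uniformly on compact subsets of $\Delta$. Moreover, $$\lim_{t\to-\infty}d_{\mathbb{D}}(\phi_t(z),\phi_t(w))=d_\Delta(z,w)\quad\text{for all } z,w\in\Delta.$$
   Context: $\mathbb{D}$ is the open unit disk. A (one-parameter) semigroup of holomorphic functions in $\mathbb{D}$ is a family $(\phi_t)_{t\ge0}$ of holomorphic maps $\phi_t:\mathbb{D}\to\mathbb{D}$ such that $\phi_0$ is the identity, $\phi_{t+s}=\phi_t\circ\phi_s$ for all $s,t\ge0$, and $\phi_t(z)\to z$ as $t\to0^+$ uniformly on compact subsets of $\mathbb{D}$. It is called non-elliptic if there is a point $\tau\in\partial\mathbb{D}$ (the Denjoy–Wolff point) with $\lim_{t\to+\infty}\phi_t(z)=\tau$ for every $z\in\mathbb{D}$. A non-elliptic semigroup is called parabolic if the angular derivatives satisfy $\phi_t'(\tau)=1$. The hyperbolic density of $\mathbb{D}$ is $\lambda_{\mathbb{D}}(z)=\frac{1}{1-|z|^2}$. For a simply connected domain $U\subsetneq\mathbb{C}$, $\lambda_U(z)=\lambda_{\mathbb{D}}(f(z))|f'(z)|$ for any conformal map $f$ of $U$ onto $\mathbb{D}$, and $d_U(a,b)=\inf_\gamma\int_\gamma\lambda_U(z)|dz|$, the infimum over rectifiable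 curves $\gamma\subset U$ joining $a$ and $b$; in particular $d_{\mathbb{D}}(z,w)=\operatorname{arctanh}\left|\frac{z-w}{1-\bar z w}\right|$. A backward orbit of $(\phi_t)$ starting at a point $z\in\mathbb{D}$ is a continuous curve $\gamma:[0,+\infty)\to\mathbb{D}$ with $\gamma(0)=z$ and $\phi_s(\gamma(t))=\gamma(t-s)$ for all $t\ge0$, $s\in[0,t]$; it is regular if $\limsup_{t\to+\infty}d_{\mathbb{D}}(\gamma(t),\gamma(t+1))<+\infty$. The backward invariant set is $\mathcal{W}=\bigcap_{t\ge0}\phi_t(\mathbb{D})$. A petal $\Delta$ of $(\phi_t)$ is a non-empty simply connected component of the interior of $\mathcal{W}$ such that: (i) $\phi_t(\Delta)=\Delta$ for all $t\ge0$ and $(\phi_t|_{\Delta})$ is a group of automorphisms of $\Delta$; (ii) $\tau\in\partial\Delta$; (iii) there is a point $\sigma\in\partial\mathbb{D}\cap\partial\Delta$ (possibly $\sigma=\tau$) such that for every $z\in\Delta$ the curve $[0,+\infty)\ni t\mapsto(\phi_t|_\Delta)^{-1}(z)$ is a regular backward orbit for $(\phi_t)$ converging to $\sigma$; moreover $\sigma$ is a boundary regular fixed point (a boundary fixed point at which each $\phi_t$ has finite angular derivative), and if $\sigma=\tau$ then the semigroup is parabolic. For $t>0$ and $z\in\Delta$ one writes $\phi_{-t}(z):=(\phi_t|_\Delta)^{-1}(z)$, so $\phi_t$ is defined on $\Delta$ for all $t\in\mathbb{R}$.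
   Formalization: The first limit is false as displayed, since φ_t(z) tends to the unit circle and λ_D(φ_t(z)) tends to infinity; the formal version proves lim λ_D(φ_t(z))|φ_t'(z)| = λ_Δ(z), uniformly on compact subsets of Δ. *)

(* Defs.v *)
From HB Require Import structures.
From mathcomp Require Import all_boot all_order all_algebra.
From mathcomp Require Import all_classical all_reals all_analysis.
From mathcomp Require Import complex.

Set Implicit Arguments.
Unset Strict Implicit.
Unset Printing Implicit Defensive.

Import Order.TTheory GRing.Theory Num.Theory.
Import numFieldNormedType.Exports.

Local Open Scope classical_set_scope.
Local Open Scope ring_scope.
Local Open Scope complex_scope.

Set Warnings "-redundant-canonical-projection".
HB.instance Definition _ (R : rcfType) := NormedModule.copy R[i] R[i]^o.
Set Warnings "redundant-canonical-projection".

(* On [R[i]] the library norm [`|z|] is itself an element of [R[i]]; [cabs z]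
   is the same modulus seen as a real number. *)
Definition cabs (R : realType) (z : R[i]) : R := complex.Re `|z|.

Definition disk (R : realType) : set R[i] := [set z | cabs z < 1].

Definition frontier (T : topologicalType) (A : set T) : set T :=
  closure A `\` interior A.

(* [derivable] and [derive1] are taken over the scalar field [R[i]], i.e. they are
   complex differentiability and the complex derivative. *)
Definition holomorphic_on (R : realType) (U : set R[i]) (f : R[i] -> R[i]) :=
  forall z, U z -> derivable f z 1.

Definition conformal_onto (R : realType) (U V : set R[i]) (f : R[i] -> R[i]) :=
  holomorphic_on U f /\ set_bij U V f.

Definition unit_itv (R : realType) : set R := [set` `[0, 1]%R].

Definition curve_in (R : realType) (U : set R[i]) (a b : R[i])
    (g : R -> R[i]) :=
  [/\ {within @unit_itv R, continuous g}, set_fun (@unit_itv R) U g,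
      g 0 = a & g 1 = b].

Definition simply_connected (R : realType) (U : set R[i]) :=
  (forall a b, U a -> U b -> exists g, curve_in U a b g) /\
  (forall a g, curve_in U a a g ->
     exists H : R * R -> R[i],
       [/\ {within @unit_itv R `*` @unit_itv R, continuous H},
           set_fun (@unit_itv R `*` @unit_itv R) U H,
           forall t, unit_itv t -> H (0, t) = g t,
           forall t, unit_itv t -> H (1, t) = a &
           forall s, unit_itv s -> H (s, 0) = a /\ H (s, 1) = a]).

(* In these two sums [s = [:: x_1; ...; x_n]] with [itv_partition 0 1 s], that
   is [0 < x_1 < ... < x_n = 1], and [nth 0 (0 :: s) k] is the left endpoint of
   the [k]-th subinterval. *)
Definition polygon_length (R : realType) (g : R -> R[i]) (s : seq R) : R :=
  \sum_(0 <= k < size s) cabs (g (nth 0 s k) - g (nth 0 (0 :: s) k)).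

Definition arc_riemann_sum (R : realType) (rho : R[i] -> R) (g : R -> R[i])
    (s : seq R) (xi : nat -> R) : R :=
  \sum_(0 <= k < size s)
    rho (g (xi k)) * cabs (g (nth 0 s k) - g (nth 0 (0 :: s) k)).

Definition rectifiable (R : realType) (g : R -> R[i]) :=
  exists M : R, forall s, itv_partition 0 1 s -> polygon_length g s <= M.

(* [I] is the integral of [rho |dz|] along [g], as the limit of the tagged sums
   when the mesh of the partition tends to 0. *)
Definition is_arc_integral (R : realType) (rho : R[i] -> R) (g : R -> R[i])
    (I : R) :=
  forall e : R, 0 < e -> exists2 d : R, 0 < d &
    forall (s : seq R) (xi : nat -> R), itv_partition 0 1 s ->
      (forall k, (k < size s)%N ->
         nth 0 s k - nth 0 (0 :: s) k < d /\
         nth 0 (0 :: s) k <= xi k <= nth 0 s k) ->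
      `|arc_riemann_sum rho g s xi - I| < e.

Definition density_dist (R : realType) (U : set R[i]) (rho : R[i] -> R)
    (a b : R[i]) : R :=
  inf [set I | exists g, [/\ curve_in U a b g, rectifiable g &
                             is_arc_integral rho g I]].

Definition lambda_disk (R : realType) (z : R[i]) : R := (1 - cabs z ^+ 2)^-1.

(* The value does not depend on which conformal map is picked, by the
   Schwarz-Pick lemma. The default [id] is only reached when [U] has no
   conformal map onto the disk. *)
Definition hyp_density (R : realType) (U : set R[i]) (z : R[i]) : R :=
  let f := xget (id : R[i] -> R[i]) [set f | conformal_onto U (@disk R) f] in
  lambda_disk (f z) * cabs (derive1 f z).

Definition hyp_dist (R : realType) (U : set R[i]) : R[i] -> R[i] -> R :=
  density_dist U (hyp_density U).

Definition hyp_dist_disk (R : realType) : R[i] -> R[i] -> R :=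
  density_dist (@disk R) (@lambda_disk R).

Definition stolz (R : realType) (sigma : R[i]) (M : R) : set R[i] :=
  [set z | disk z /\ cabs (sigma - z) < M * (1 - cabs z)].

Definition angular_limit (R : realType) (f : R[i] -> R[i]) (sigma l : R[i]) :=
  forall M : R, 1 < M -> f z @[z --> within (stolz sigma M) (nbhs sigma)] --> l.

Definition angular_derivative (R : realType) (f : R[i] -> R[i])
    (sigma a : R[i]) :=
  exists2 p, angular_limit f sigma p &
    angular_limit (fun z => (f z - p) / (z - sigma)) sigma a.

(* Only the values [phi t z] with [0 <= t] and [z] in the disk matter. *)
Record semigroup (R : realType) (phi : R -> R[i] -> R[i]) : Prop := {
  semigroup_maps : forall t, 0 <= t -> set_fun (@disk R) (@disk R) (phi t);
  semigroup_holo : forall t, 0 <= t -> holomorphic_on (@disk R) (phi t);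
  semigroup_id : forall z, disk z -> phi 0 z = z;
  semigroup_add : forall t s z, 0 <= t -> 0 <= s -> disk z ->
    phi (t + s) z = phi t (phi s z);
  semigroup_cont : forall K : set R[i], compact K -> K `<=` @disk R ->
    {uniform K, phi t @[t --> 0^'+] --> (id : R[i] -> R[i])}
}.

Definition denjoy_wolff_point (R : realType) (phi : R -> R[i] -> R[i])
    (tau : R[i]) :=
  cabs tau = 1 /\ forall z, disk z -> phi t z @[t --> +oo] --> tau.

Definition nonelliptic (R : realType) (phi : R -> R[i] -> R[i]) :=
  semigroup phi /\ exists tau, denjoy_wolff_point phi tau.

Definition parabolic (R : realType) (phi : R -> R[i] -> R[i]) :=
  semigroup phi /\ exists2 tau, denjoy_wolff_point phi tau &
    forall t, 0 <= t -> angular_derivative (phi t) tau 1.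

Definition boundary_regular_fixed_point (R : realType)
    (phi : R -> R[i] -> R[i]) (sigma : R[i]) :=
  cabs sigma = 1 /\
  forall t, 0 <= t -> angular_limit (phi t) sigma sigma /\
                      exists a, angular_derivative (phi t) sigma a.

Definition backward_orbit (R : realType) (phi : R -> R[i] -> R[i]) (z : R[i])
    (g : R -> R[i]) :=
  [/\ {within [set` `[0, +oo[%R], continuous g},
      forall t, 0 <= t -> disk (g t),
      g 0 = z &
      forall t s, 0 <= s <= t -> phi s (g t) = g (t - s)].

Definition regular_orbit (R : realType) (g : R -> R[i]) :=
  (limf_esup (fun t => (hyp_dist_disk (g t) (g (t + 1)))%:E) +oo%R
   < +oo)%E.

Definition backward_invariant_set (R : realType) (phi : R -> R[i] -> R[i]) :
    set R[i] :=
  \bigcap_(t in [set t : R | 0 <= t]) (phi t @` @disk R).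

(* [phi_t] on [Delta] for all real [t]: for [t < 0] it is the inverse of the
   restriction of [phi_(-t)] to [Delta]. *)
Definition petal_flow (R : realType) (phi : R -> R[i] -> R[i])
    (Delta : set R[i]) (t : R) : R[i] -> R[i] :=
  if 0 <= t then phi t else pinv Delta (phi (- t)).

Record petal (R : realType) (phi : R -> R[i] -> R[i]) (Delta : set R[i]) :
    Prop := {
  petal_component : exists2 z0, interior (backward_invariant_set phi) z0 &
    Delta = connected_component (interior (backward_invariant_set phi)) z0;
  petal_simply_connected : simply_connected Delta;
  petal_invariant : forall t, 0 <= t -> phi t @` Delta = Delta;
  petal_automorphism : forall t,
    conformal_onto Delta Delta (petal_flow phi Delta t);
  petal_group : forall t s z, Delta z ->
    petal_flow phi Delta (t + s) z =
    petal_flow phi Delta t (petal_flow phi Delta s z);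
  petal_denjoy_wolff : forall tau, denjoy_wolff_point phi tau ->
    frontier Delta tau;
  petal_backward : exists sigma,
    [/\ cabs sigma = 1, frontier Delta sigma,
        forall z, Delta z ->
          [/\ backward_orbit phi z (fun t => petal_flow phi Delta (- t) z),
              regular_orbit (fun t => petal_flow phi Delta (- t) z) &
              petal_flow phi Delta (- t) z @[t --> +oo] --> sigma],
        boundary_regular_fixed_point phi sigma &
        denjoy_wolff_point phi sigma -> parabolic phi]
}.

(* Main.v *)
Require Import Defs.
From HB Require Import structures.
From mathcomp Require Import all_boot all_order all_algebra.
From mathcomp Require Import all_classical all_reals all_analysis.
From mathcomp Require Import complex ring lra.

(** Write [backflow t] for the inverse of [phi t] on the petal [Delta], [D] for
    the unit disk, and [mob a] for the automorphism of [D] that moves [a] to [0].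
    Since [backflow s = phi (t - s) \o backflow t], the Schwarz-Pick lemma shows
    that the density [lambda (backflow t z) * |(backflow t)' z|] and the
    pseudo-hyperbolic distance of [backflow t z] and [backflow t w] increase with
    [t]. It remains to identify their limits.

    Fix [z0] in [Delta] and let [b t = backflow t z0]. The maps
    [F_t = mob (b t) \o backflow t] from [Delta] to [D] send [z0] to [0]; the
    modulus of [F_t'] at [z0] is the density above, and [|F_t w|] is the distance
    above. The self-maps [G_t = phi t \o mob (- b t)] of [D] send [0] to [z0] and
    satisfy [G_t \o F_t = id]. Both families are bounded, so they converge
    pointwise along an ultrafilter, to holomorphic maps [F] and [G]. For every
    [s] one may write [G = phi s \o H] where [H] is a limit of self-maps of [D];
    hence [G] takes its values in the backward invariant set. It is not constant,
    hence open, and so it maps [D] into the interior of this set, and into its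
    component [Delta]. Now [G \o F = id], and [F \o G] is a self-map of [D] with
    fixed point [0] and derivative [1] there, thus the identity. So [F] is a
    conformal map of [Delta] onto [D] which sends [z0] to [0]: the limit of the
    densities is [|F' z0|], the hyperbolic density of [Delta] at [z0], and the
    limit of the distances is [|F w|], whose [artanh] is the hyperbolic distance
    of [z0] and [w]. This is [petal_uniformization]. Convergence is uniform on
    compact sets by Dini's argument, the limit density being continuous.

    The function theory rests on complex differentiability alone. Goursat's
    theorem for rectangles, in logarithmic coordinates, says that the mean over a
    circle does not depend on the radius; hence the mean value property
    [mean_value], the removable singularity [removable0], the maximum principle
    and the Schwarz lemma. Applied to difference quotients, the latter bounds the
    remainder of the Taylor expansion uniformly over all self-maps of the disk
    ([taylor_disk]); this is why pointwise limits are holomorphic and why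
    derivatives are continuous. Dividing out zeros gives openness. A bijective
    self-map of [D] is a hyperbolic isometry ([disk_auto_isometry]), so that any
    conformal map computes the density. Finally, strict differentiability carries
    integrals along curves from one domain to another
    ([density_dist_transfer]), which reduces distances to [hyp_dist_disk0]. *)

Import Order.TTheory GRing.Theory Num.Theory.
Import numFieldNormedType.Exports.

Local Open Scope classical_set_scope.
Local Open Scope ring_scope.
Local Open Scope complex_scope.

Set Implicit Arguments.
Unset Strict Implicit.
Unset Printing Implicit Defensive.

(** * The modulus and the topology of [R[i]] *)

Section Modulus.
Variable R : realType.
Implicit Types (z w : R[i]) (x y : R).

Lemma normc_cabs z : `|z| = (cabs z)%:C.
Proof. by rewrite /cabs normc_def. Qed.

Lemma cabsE z : cabs z = Num.sqrt (complex.Re z ^+ 2 + complex.Im z ^+ 2).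
Proof. by rewrite /cabs normc_def. Qed.

Lemma cabs_ge0 z : 0 <= cabs z.
Proof. by rewrite cabsE sqrtr_ge0. Qed.

Lemma sqr_cabs z : cabs z ^+ 2 = complex.Re z ^+ 2 + complex.Im z ^+ 2.
Proof. by rewrite cabsE sqr_sqrtr// addr_ge0// sqr_ge0. Qed.

Lemma rC_inj x y : x%:C = y%:C -> x = y.
Proof. by case. Qed.

Lemma cabsM z w : cabs (z * w) = cabs z * cabs w.
Proof. by apply: rC_inj; rewrite -normc_cabs normrM !normc_cabs -rmorphM. Qed.

Lemma cabs0 : cabs (0 : R[i]) = 0.
Proof. by apply: rC_inj; rewrite -normc_cabs normr0. Qed.

Lemma cabs1 : cabs (1 : R[i]) = 1.
Proof. by apply: rC_inj; rewrite -normc_cabs normr1. Qed.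

Lemma cabsN z : cabs (- z) = cabs z.
Proof. by apply: rC_inj; rewrite -!normc_cabs normrN. Qed.

Lemma cabsB z w : cabs (z - w) = cabs (w - z).
Proof. by rewrite -cabsN opprB. Qed.

Lemma cabs_eq0 z : (cabs z == 0) = (z == 0).
Proof. by rewrite -(@normr_eq0 _ _ z) normc_cabs -(inj_eq (@rC_inj)). Qed.

Lemma cabs_gt0 z : (0 < cabs z) = (z != 0).
Proof. by rewrite lt_def cabs_ge0 andbT cabs_eq0. Qed.

Lemma cabsD z w : cabs (z + w) <= cabs z + cabs w.
Proof. by rewrite -lecR rmorphD /= -!normc_cabs ler_normD. Qed.

Lemma cabsV z : cabs z^-1 = (cabs z)^-1.
Proof. by apply: rC_inj; rewrite -normc_cabs normfV normc_cabs -fmorphV. Qed.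

Lemma cabsX z n : cabs (z ^+ n) = cabs z ^+ n.
Proof. by apply: rC_inj; rewrite -normc_cabs normrX normc_cabs -rmorphXn. Qed.

Lemma cabs_rC x : cabs x%:C = `|x|.
Proof. by rewrite cabsE /= expr0n addr0 sqrtr_sqr. Qed.

Lemma cabs_conj z : cabs z^*%C = cabs z.
Proof. by case: z => a b; rewrite !cabsE /= sqrrN. Qed.

Lemma abs_Re_le z : `|complex.Re z| <= cabs z.
Proof. by rewrite -lecR -normc_cabs normc_ge_Re. Qed.

Lemma abs_Im_le z : `|complex.Im z| <= cabs z.
Proof.
rewrite -(@ler_pXn2r _ 2) ?nnegrE ?cabs_ge0// sqr_cabs -normrX ger0_norm ?sqr_ge0//.
by rewrite lerDr sqr_ge0.
Qed.

Lemma cabs_Re_Im z : cabs z <= `|complex.Re z| + `|complex.Im z|.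
Proof.
rewrite -(@ler_pXn2r _ 2) ?nnegrE ?cabs_ge0 ?addr_ge0// sqr_cabs sqrrD.
by rewrite !real_normK ?num_real// lerD2r lerDl mulrn_wge0// mulr_ge0.
Qed.

Lemma cabs_sub z w : cabs z - cabs w <= cabs (z - w).
Proof. by rewrite lerBlDr (le_trans _ (cabsD _ _))// subrK. Qed.

Lemma cabs_subl z w : `|cabs z - cabs w| <= cabs (z - w).
Proof.
by rewrite ler_norml cabs_sub andbT lerNl opprB cabsB cabs_sub.
Qed.

Lemma cabs_tri z w v : cabs (z - v) <= cabs (z - w) + cabs (w - v).
Proof. by apply: le_trans (cabsD _ _); rewrite addrA subrK. Qed.

Lemma cabs_sum n (F : nat -> R[i]) :
  cabs (\sum_(0 <= k < n) F k) <= \sum_(0 <= k < n) cabs (F k).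
Proof.
apply: (big_ind2 (fun a b => cabs a <= b)) => //; first by rewrite cabs0.
by move=> a b c d h1 h2; apply: le_trans (cabsD _ _) (lerD h1 h2).
Qed.

Lemma mulcJ z : z * z^*%C = (cabs z ^+ 2)%:C.
Proof. by rewrite -sqr_normc normc_cabs -rmorphXn. Qed.

(** The order of [R[i]] makes the radii of its balls complex numbers; here and
    below neighbourhoods and limits are expressed with real radii. *)
Lemma nbhs_cabsP z (A : set R[i]) :
  nbhs z A <-> exists2 d : R, 0 < d & forall w, cabs (w - z) < d -> A w.
Proof.
split.
- move=> /nbhs_normP [e /= e0 he].
  have eR : e = (complex.Re e)%:C.
    by move: e0; rewrite ltcE /= => /andP[/eqP h _]; case: (e) h => a b /= ->.
  exists (complex.Re e); first by rewrite -ltcR -eR.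
  move=> w hw; apply: he => /=.
  by rewrite distrC normc_cabs eR ltcR.
- move=> [d d0 h]; apply/nbhs_normP; exists d%:C => /=; first by rewrite ltcR.
  by move=> w /=; rewrite distrC normc_cabs ltcR; apply: h.
Qed.

Lemma cvg_cabsP T (F : set_system T) (FF : Filter F) (f : T -> R[i]) (l : R[i]) :
  f @ F --> l <-> forall e : R, 0 < e -> \forall x \near F, cabs (f x - l) < e.
Proof.
split.
- move=> h e e0; apply: (h [set w | cabs (w - l) < e]).
  by apply/nbhs_cabsP; exists e.
- move=> h A /nbhs_cabsP [d d0 hd]; apply: filterS (h d d0) => x; exact: hd.
Qed.

Lemma cont_cabsP (f : R[i] -> R[i]) z :
  {for z, continuous f} <-> forall e : R, 0 < e ->
    exists2 d : R, 0 < d & forall w, cabs (w - z) < d -> cabs (f w - f z) < e.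
Proof.
split=> [/cvg_cabsP h e e0|h].
- by apply/nbhs_cabsP; exact: (h e e0).
- by apply: (proj2 (cvg_cabsP (nbhs_filter z) _ _)) => e e0; apply/nbhs_cabsP; exact: h.
Qed.

Lemma nbhs_realP x (A : set R) :
  nbhs x A <-> exists2 d : R, 0 < d & forall y, `|y - x| < d -> A y.
Proof.
split=> [/nbhs_normP [e /= e0 he]|[d d0 h]].
  by exists e => // y hy; apply: he; rewrite /= distrC.
by apply/nbhs_normP; exists d => //= y /=; rewrite distrC; apply: h.
Qed.

Lemma cont_cabs z : {for z, continuous (@cabs R)}.
Proof.
apply/(@cvgrPdist_lt _ _ _ (nbhs z) (nbhs_filter z)) => e e0; apply/nbhs_cabsP; exists e => // w hw.
by rewrite (le_lt_trans (cabs_subl _ _))// cabsB.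
Qed.

Lemma cont_rC x : {for x, continuous (fun y : R => y%:C)}.
Proof.
apply/cvg_cabsP => e e0; apply/nbhs_realP; exists e => // w hw.
by rewrite -raddfB cabs_rC.
Qed.

Lemma cont_Re z : {for z, continuous (@complex.Re R)}.
Proof.
apply/(@cvgrPdist_lt _ _ _ (nbhs z) (nbhs_filter z)) => e e0; apply/nbhs_cabsP; exists e => // w hw.
by rewrite -raddfB (le_lt_trans (abs_Re_le _))// cabsB.
Qed.

Lemma cont_Im z : {for z, continuous (@complex.Im R)}.
Proof.
apply/(@cvgrPdist_lt _ _ _ (nbhs z) (nbhs_filter z)) => e e0; apply/nbhs_cabsP; exists e => // w hw.
by rewrite -raddfB (le_lt_trans (abs_Im_le _))// cabsB.
Qed.

Lemma ReImE z : z = (complex.Re z)%:C + 'i * (complex.Im z)%:C.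
Proof. by case: z => a b; apply/eqP; rewrite eq_complex /=; apply/andP; split; apply/eqP; ring. Qed.

Lemma compact_closed_disk (M : R) : compact [set z : R[i] | cabs z <= M].
Proof.
pose f (p : R * R) : R[i] := p.1%:C + 'i * p.2%:C.
have cf : continuous f.
  move=> p; apply: cvgD.
    by apply: (continuous_comp cvg_fst); exact: cont_rC.
  apply: cvgM; first exact: cvg_cst.
  by apply: (continuous_comp cvg_snd); exact: cont_rC.
have h : compact (f @` (`[-M, M] `*` `[-M, M])).
  apply: continuous_compact; first exact: continuous_subspaceT.
  by apply: compact_setX; exact: segment_compact.
apply: (@subclosed_compact _ _ _ _ h).
  rewrite (_ : [set z | _] = @cabs R @^-1` [set x | x <= M])//.
  apply: preimage_closed; last exact: closed_le.
  by move=> z _; exact: cont_cabs.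
move=> z /= hz; exists (complex.Re z, complex.Im z) => /=; last by rewrite /f /= -ReImE.
by rewrite !in_itv /= -!ler_norml; split; apply: le_trans hz; rewrite ?abs_Re_le ?abs_Im_le.
Qed.

End Modulus.

Section ContinuityRules.
Variables (R : realType) (T : topologicalType).
Implicit Types (f g : T -> R[i]) (x : T).

Lemma contD f g x : {for x, continuous f} -> {for x, continuous g} ->
  {for x, continuous (fun y => f y + g y)}.
Proof. exact: (@cvgD _ _ _ _ (nbhs_filter x)). Qed.

Lemma contB f g x : {for x, continuous f} -> {for x, continuous g} ->
  {for x, continuous (fun y => f y - g y)}.
Proof. exact: (@cvgB _ _ _ _ (nbhs_filter x)). Qed.

Lemma contM f g x : {for x, continuous f} -> {for x, continuous g} ->
  {for x, continuous (fun y => f y * g y)}.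
Proof. exact: (@cvgM _ _ _ (nbhs_filter x)). Qed.

Lemma contV f x : f x != 0 -> {for x, continuous f} ->
  {for x, continuous (fun y => (f y)^-1)}.
Proof. exact: (@cvgV _ _ _ (nbhs_filter x)). Qed.

Lemma cont_cst (c : R[i]) x : {for x, continuous (fun _ : T => c)}.
Proof. exact: (@cvg_cst _ _ _ _ (nbhs_filter x)). Qed.

Lemma contcomp (U : topologicalType) (f : T -> R[i]) (g : R[i] -> U) x :
  {for x, continuous f} -> {for f x, continuous g} -> {for x, continuous (fun y => g (f y))}.
Proof. by move=> hf hg A hA; apply: (hf (g @^-1` A)); exact: hg. Qed.

End ContinuityRules.

Lemma cont_idC (R : realType) (z : R[i]) : {for z, continuous (fun w : R[i] => w)}.
Proof. by []. Qed.

(** * Complex derivatives *)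

Section ComplexDerivative.
Variable R : realType.
Implicit Types (z w L : R[i]) (f g q : R[i] -> R[i]).

(** Real radii allow for estimates that are uniform in [f]; [cdiffP] relates
    this to [derivable] and [derive1]. *)
Definition cdiff f z L := forall e : R, 0 < e -> exists2 d : R, 0 < d &
  forall w, cabs (w - z) < d -> cabs (f w - f z - L * (w - z)) <= e * cabs (w - z).

Lemma cdiffP f z L : cdiff f z L <-> (derivable f z 1 /\ derive1 f z = L).
Proof.
have key : (h^-1 *: (f (h + z) - f z) @[h --> 0^'] --> L) <-> cdiff f z L.
  split.
  - move=> /cvg_cabsP h e e0; have /nbhs_cabsP[d d0 hd] := h _ e0.
    exists d => // w hw; have [->|wz] := eqVneq w z.
      by rewrite !subrr mulr0 subr0 cabs0 mulr0.
    have wz0 : w - z != 0 by rewrite subr_eq0.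
    have {hd} := hd (w - z); rewrite subr0 subrK => /(_ hw wz0) hd.
    rewrite (_ : f w - f z - L * (w - z) =
      ((w - z)^-1 *: (f w - f z) - L) * (w - z)); last first.
      by rewrite mulrBl -[_ *: _]/(_ * _) mulrAC mulVf// mul1r.
    by rewrite cabsM ler_wpM2r ?cabs_ge0 ?ltW.
  - move=> h; apply/cvg_cabsP => e e0.
    have e20 : 0 < e / 2 by rewrite divr_gt0.
    have [d d0 hd] := h _ e20.
    apply/nbhs_cabsP; exists d => // k; rewrite subr0 => kd k0.
    have {hd} := hd (k + z); rewrite addrK => /(_ kd) hd.
    rewrite (_ : _ - L = (f (k + z) - f z - L * k) * k^-1); last first.
      by rewrite mulrBl mulfK// -[_ *: _]/(_ * _) mulrC.
    rewrite cabsM cabsV ltr_pdivrMr ?cabs_gt0//.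
    by rewrite (le_lt_trans hd)// ltr_pM2r ?cabs_gt0//; lra.
have shE : (fun h : R[i] => h^-1 *: ((f \o shift z) (h *: (1 : R[i])) - f z)) =
           (fun h => h^-1 *: (f (h + z) - f z)).
  by apply/funext => h /=; rewrite -[h *: 1]/(h * 1) mulr1.
split.
- move=> /key h; split.
    by apply/cvg_ex; exists L; rewrite shE.
  by apply/cvg_lim.
- move=> [h hL]; move: h; rewrite /derivable shE => h; apply/(proj1 key); rewrite -hL /derive1; exact: h.
Qed.

Lemma cdiff_derivable f z L : cdiff f z L -> derivable f z 1.
Proof. by case/cdiffP. Qed.

Lemma cdiff_derive1 f z L : cdiff f z L -> derive1 f z = L.
Proof. by case/cdiffP. Qed.

Lemma derivable_cdiff f z : derivable f z 1 -> cdiff f z (derive1 f z).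
Proof. by move=> h; apply/cdiffP. Qed.

Lemma cdiff_uniq f z L L' : cdiff f z L -> cdiff f z L' -> L = L'.
Proof. by move=> /cdiff_derive1 <- /cdiff_derive1. Qed.

Definition quot f z L w := if w == z then L else (f w - f z) / (w - z).

Lemma quotE f z L w : f w - f z = quot f z L w * (w - z).
Proof.
rewrite /quot; case: eqVneq => [->|wz]; first by rewrite !subrr mulr0.
by rewrite mulfVK// subr_eq0.
Qed.

Lemma quot_diag f z L : quot f z L z = L.
Proof. by rewrite /quot eqxx. Qed.

Lemma cdiff_quot f z L : cdiff f z L <-> {for z, continuous (quot f z L)}.
Proof.
split=> h.
- apply/cont_cabsP => e e0; have e20 : 0 < e / 2 by rewrite divr_gt0.
  have [d d0 hd] := h _ e20; exists d => // w hw; rewrite quot_diag.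
  have [->|wz] := eqVneq w z; first by rewrite quot_diag subrr cabs0.
  have wz0 : 0 < cabs (w - z) by rewrite cabs_gt0 subr_eq0.
  have := hd w hw; rewrite (quotE f z L) -mulrBl cabsM ler_pM2r// => h1.
  by rewrite (le_lt_trans h1)//; lra.
- move=> e e0; have [d d0 hd] := (cont_cabsP _ _).1 h _ e0; exists d => // w hw.
  rewrite (quotE f z L) -mulrBl cabsM ler_wpM2r ?cabs_ge0// ltW//.
  by have := hd w hw; rewrite quot_diag.
Qed.

(** In Caratheodory's form of differentiability the rules of calculus are rules
    for continuous functions. *)
Lemma cdiff_caratheodory f z L q : {for z, continuous q} -> q z = L ->
  (forall w, f w - f z = q w * (w - z)) -> cdiff f z L.
Proof.
move=> cq qz fq e e0; have [d d0 hd] := (cont_cabsP _ _).1 cq _ e0.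
exists d => // w hw; rewrite fq -mulrBl cabsM ler_wpM2r ?cabs_ge0// ltW//.
by rewrite -qz; exact: hd.
Qed.

Lemma cdiff_cont f z L : cdiff f z L -> {for z, continuous f}.
Proof.
move=> /cdiff_quot h.
have -> : f = (fun w => quot f z L w * (w - z) + f z).
  by apply/funext => w; rewrite -quotE subrK.
apply: contD; last exact: cont_cst.
by apply: contM; [exact: h | apply: contB; [exact: cont_idC | exact: cont_cst]].
Qed.

Lemma derivable_cont f z : derivable f z 1 -> {for z, continuous f}.
Proof. by move/derivable_cdiff/cdiff_cont. Qed.

Lemma cdiff_near f g z L (d : R) : 0 < d ->
  (forall w, cabs (w - z) < d -> f w = g w) -> cdiff f z L -> cdiff g z L.
Proof.
move=> d0 fg h e e0; have [d1 d10 hd] := h _ e0.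
exists (Num.min d d1); first by rewrite lt_min d0.
move=> w; rewrite lt_min => /andP[h1 h2].
by rewrite -!fg// ?subrr ?cabs0//; apply: hd.
Qed.

Lemma cdiff_cst (c : R[i]) z : cdiff (fun=> c) z 0.
Proof.
by move=> e e0; exists 1 => // w _; rewrite subrr mul0r subr0 cabs0 mulr_ge0 ?cabs_ge0// ltW.
Qed.

Lemma cdiff_id z : cdiff (fun w => w) z 1.
Proof.
by move=> e e0; exists 1 => // w _; rewrite mul1r subrr cabs0 mulr_ge0 ?cabs_ge0// ltW.
Qed.

Lemma cdiffD f g z L M : cdiff f z L -> cdiff g z M ->
  cdiff (fun w => f w + g w) z (L + M).
Proof.
move=> /cdiff_quot hf /cdiff_quot hg.
apply: (@cdiff_caratheodory _ _ _ (fun w => quot f z L w + quot g z M w)).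
- by apply: contD; [exact: hf|exact: hg].
- by rewrite !quot_diag.
- by move=> w; rewrite mulrDl -!quotE; ring.
Qed.

Lemma cdiffM f g z L M : cdiff f z L -> cdiff g z M ->
  cdiff (fun w => f w * g w) z (L * g z + f z * M).
Proof.
move=> hf' hg'; have hgc := cdiff_cont hg'.
move: hf' hg' => /cdiff_quot hf /cdiff_quot hg.
apply: (@cdiff_caratheodory _ _ _ (fun w => quot f z L w * g w + f z * quot g z M w)).
- by apply: contD; apply: contM; [exact: hf|exact: hgc|exact: cont_cst|exact: hg].
- by rewrite !quot_diag.
- by move=> w; rewrite mulrDl mulrAC -quotE -mulrA -quotE; ring.
Qed.

Lemma cdiffZ (c : R[i]) f z L : cdiff f z L -> cdiff (fun w => c * f w) z (c * L).
Proof. by move=> h; have := cdiffM (cdiff_cst c z) h; rewrite mul0r add0r. Qed.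

Lemma cdiffN f z L : cdiff f z L -> cdiff (fun w => - f w) z (- L).
Proof.
move=> h; have := cdiffZ (-1) h; rewrite mulN1r.
by under [X in cdiff X _ _]eq_fun do rewrite mulN1r.
Qed.

Lemma cdiffB f g z L M : cdiff f z L -> cdiff g z M ->
  cdiff (fun w => f w - g w) z (L - M).
Proof. by move=> hf hg; exact: cdiffD hf (cdiffN hg). Qed.

Lemma cdiff_comp f g z L M : cdiff f z L -> cdiff g (f z) M ->
  cdiff (fun w => g (f w)) z (M * L).
Proof.
move=> hf' hg'; have hfc := cdiff_cont hf'.
move: hf' hg' => /cdiff_quot hf /cdiff_quot hg.
apply: (@cdiff_caratheodory _ _ _ (fun w => quot g (f z) M (f w) * quot f z L w)).
- apply: contM; last exact: hf.
  exact: (contcomp hfc hg).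
- by rewrite !quot_diag.
- by move=> w; rewrite -mulrA -!quotE.
Qed.

Lemma cdiffV f z L : f z != 0 -> cdiff f z L ->
  cdiff (fun w => (f w)^-1) z (- (f z) ^- 2 * L).
Proof.
move=> fz0 hf'; have hfc := cdiff_cont hf'.
have hq : cdiff (fun w => w^-1) (f z) (- (f z) ^- 2).
  have cV : {for f z, continuous (fun w : R[i] => w^-1)}.
    by apply: contV; [exact: fz0|exact: cont_idC].
  have d0 : 0 < cabs (f z) by rewrite cabs_gt0.
  apply: (@cdiff_caratheodory _ _ _ (fun w => if w == 0 then (f z)^-2 else - (f z)^-1 * w^-1)).
  - apply/cont_cabsP => e e0.
    have c2 : {for f z, continuous (fun w : R[i] => - (f z)^-1 * w^-1)}.
      by apply: contM; [exact: cont_cst|exact: cV].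
    have [d d1 hd] := (cont_cabsP _ _).1 c2 _ e0.
    exists (Num.min d (cabs (f z))); first by rewrite lt_min d1.
    move=> w; rewrite lt_min => /andP[h1 h2].
    rewrite (negbTE fz0) ifF; first exact: hd.
    apply/negP => /eqP w0; move: h2; rewrite w0 sub0r cabsN ltxx//.
  - by rewrite (negbTE fz0) -exprVn expr2 mulNr.
  - move=> w; case: eqVneq => [->|w0]; first by rewrite invr0; field.
    by field; rewrite fz0 w0.
exact: (cdiff_comp hf' hq).
Qed.

Lemma cdiff_quot_off f z0 L z : z != z0 -> derivable f z 1 ->
  derivable (quot f z0 L) z 1.
Proof.
move=> zz0 hf; have d0 : 0 < cabs (z - z0) by rewrite cabs_gt0 subr_eq0.
have h1 := cdiffB (derivable_cdiff hf) (cdiff_cst (f z0) z).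
have h2 := cdiffB (cdiff_id z) (cdiff_cst z0 z).
have h3 : (fun w => w - z0) z != 0 by rewrite subr_eq0.
have h := cdiffM h1 (@cdiffV (fun w => w - z0) _ _ h3 h2).
apply/cdiff_derivable; apply: cdiff_near d0 _ h => w hw.
rewrite /quot ifF//; apply/negP => /eqP wz; move: hw.
by rewrite wz cabsB ltxx.
Qed.

Lemma quot_cont f z0 L z : {for z, continuous f} -> z != z0 ->
  {for z, continuous (quot f z0 L)}.
Proof.
move=> cf zz0; have d0 : 0 < cabs (z - z0) by rewrite cabs_gt0 subr_eq0.
have h : {for z, continuous (fun w => (f w - f z0) / (w - z0))}.
  apply: contM; first by apply: contB; [exact: cf|exact: cont_cst].
  apply: contV; first by rewrite subr_eq0.
  by apply: contB; [exact: cont_idC|exact: cont_cst].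
apply/cont_cabsP => e e0; have [d d1 hd] := (cont_cabsP _ _).1 h _ e0.
exists (Num.min d (cabs (z - z0))); first by rewrite lt_min d1.
move=> w; rewrite lt_min => /andP[h1 h2].
rewrite /quot (negbTE zz0) ifF; first exact: hd.
by apply/negP => /eqP w0; move: h2; rewrite w0 cabsB ltxx.
Qed.

End ComplexDerivative.

(** * Integrals over segments *)

Section SegmentIntegral.
Variable R : realType.
Implicit Types (a b c x y M : R) (f g : R -> R).

Definition cont_seg (U : topologicalType) a b (f : R -> U) :=
  forall x, a <= x <= b -> {for x, continuous f}.

Definition rint f a b : R := \int[lebesgue_measure]_(x in `[a, b]) f x.

Lemma cont_seg_integrable a b f : cont_seg a b f ->
  lebesgue_measure.-integrable `[a, b] (EFin \o f).
Proof.
move=> h; apply: continuous_compact_integrable; first exact: segment_compact.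
apply: continuous_in_subspaceT => x; rewrite inE /= in_itv /=; exact: h.
Qed.

Lemma rintD a b f g : cont_seg a b f -> cont_seg a b g ->
  rint (fun x => f x + g x) a b = rint f a b + rint g a b.
Proof. by move=> hf hg; apply: RintegralD => //; exact: cont_seg_integrable. Qed.

Lemma rintZ a b k f : cont_seg a b f -> rint (fun x => k * f x) a b = k * rint f a b.
Proof. by move=> hf; apply: RintegralZl => //; exact: cont_seg_integrable. Qed.

Lemma rint_eq a b f g : (forall x, a <= x <= b -> f x = g x) -> rint f a b = rint g a b.
Proof.
by move=> h; apply: eq_Rintegral => x; rewrite inE /= in_itv /= => /h.
Qed.

Lemma rint_cst a b k : a <= b -> rint (fun=> k) a b = k * (b - a).
Proof.
move=> ab; rewrite /rint Rintegral_cst//= lebesgue_measure_itv/= lte_fin.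
by move: ab; rewrite le_eqVlt => /orP[/eqP->|->//]; rewrite ltxx subrr.
Qed.

Lemma rint_le a b f g : cont_seg a b f -> cont_seg a b g ->
  (forall x, a <= x <= b -> f x <= g x) -> rint f a b <= rint g a b.
Proof. by move=> hf hg h; apply: le_Rintegral => //; exact: cont_seg_integrable. Qed.

Lemma cont_seg_sub (U : topologicalType) a b c d (f : R -> U) :
  a <= c -> d <= b -> cont_seg a b f -> cont_seg c d f.
Proof.
move=> ac db h x /andP[cx xd]; apply: h.
by rewrite (le_trans ac cx) (le_trans xd db).
Qed.

Lemma rint_chasles a b c f : a <= b -> b <= c -> cont_seg a c f ->
  rint f a c = rint f a b + rint f b c.
Proof.
move=> ab bc hf; have hi := cont_seg_integrable hf.
have h1 := cont_seg_integrable (cont_seg_sub ab (lexx c) hf).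
apply/eqP; rewrite addrC -subr_eq /rint; apply/eqP.
rewrite Rintegral_itvB ?bnd_simp//.
apply: Rintegral_itv_obnd_cbnd; apply: integrableS h1 => //.
by apply: subset_itvr; rewrite bnd_simp.
Qed.

End SegmentIntegral.

Section ComplexIntegral.
Variable R : realType.
Implicit Types (a b c x y M : R) (f g : R -> R[i]).

Definition cint f a b : R[i] :=
  (rint (fun x => complex.Re (f x)) a b) +i* (rint (fun x => complex.Im (f x)) a b).

Lemma cont_seg_Re a b f : cont_seg a b f -> cont_seg a b (fun x => complex.Re (f x)).
Proof. by move=> h x /h hx; apply: (contcomp hx); exact: cont_Re. Qed.

Lemma cont_seg_Im a b f : cont_seg a b f -> cont_seg a b (fun x => complex.Im (f x)).
Proof. by move=> h x /h hx; apply: (contcomp hx); exact: cont_Im. Qed.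

Lemma cint_eq a b f g : (forall x, a <= x <= b -> f x = g x) -> cint f a b = cint g a b.
Proof. by move=> h; congr (_ +i* _); apply: rint_eq => x /h ->. Qed.

Lemma cintD a b f g : cont_seg a b f -> cont_seg a b g ->
  cint (fun x => f x + g x) a b = cint f a b + cint g a b.
Proof.
move=> hf hg.
have -> : cint f a b + cint g a b =
    (rint (fun x => complex.Re (f x)) a b + rint (fun x => complex.Re (g x)) a b) +i*
    (rint (fun x => complex.Im (f x)) a b + rint (fun x => complex.Im (g x)) a b) by [].
rewrite -(rintD (cont_seg_Re hf) (cont_seg_Re hg)) -(rintD (cont_seg_Im hf) (cont_seg_Im hg)).
by congr (_ +i* _); apply: rint_eq => x _; rewrite raddfD.
Qed.

Lemma cintZ a b (k : R[i]) f : cont_seg a b f -> cint (fun x => k * f x) a b = k * cint f a b.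
Proof.
move=> hf; have hR := cont_seg_Re hf; have hI := cont_seg_Im hf.
case: k => p q; rewrite [RHS]/GRing.mul /=; congr (_ +i* _).
- rewrite -(rintZ p hR) -mulNr -(rintZ (- q) hI) -rintD.
  + by apply: rint_eq => x _; case: (f x) => ? ? /=; rewrite mulNr.
  + by move=> x hx; apply: cvgM; [exact: cvg_cst|exact: hR].
  + by move=> x hx; apply: cvgM; [exact: cvg_cst|exact: hI].
- rewrite -(rintZ p hI) -(rintZ q hR) -rintD.
  + by apply: rint_eq => x _; case: (f x) => ? ? /=.
  + by move=> x hx; apply: cvgM; [exact: cvg_cst|exact: hI].
  + by move=> x hx; apply: cvgM; [exact: cvg_cst|exact: hR].
Qed.

Lemma cont_segZ a b (k : R[i]) f : cont_seg a b f -> cont_seg a b (fun x => k * f x).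
Proof. by move=> hf x hx; apply: contM; [exact: cont_cst|exact: hf]. Qed.

Lemma cont_segB a b f g : cont_seg a b f -> cont_seg a b g -> cont_seg a b (fun x => f x - g x).
Proof. by move=> hf hg x hx; apply: contB; [exact: hf|exact: hg]. Qed.

Lemma cont_seg_cst a b (k : R[i]) : cont_seg a b (fun=> k).
Proof. by move=> x hx; exact: cont_cst. Qed.

Lemma cintB a b f g : cont_seg a b f -> cont_seg a b g ->
  cint (fun x => f x - g x) a b = cint f a b - cint g a b.
Proof.
move=> hf hg; transitivity (cint f a b + -1 * cint g a b); last by rewrite mulN1r.
rewrite -(cintZ (-1) hg) -(cintD hf (cont_segZ (k := -1) hg)).
by apply: cint_eq => x _; rewrite mulN1r.
Qed.

Lemma cint_cst a b (k : R[i]) : a <= b -> cint (fun=> k) a b = k * (b - a)%:C.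
Proof.
move=> ab; rewrite /cint !rint_cst//; case: k => p q.
by rewrite [RHS]/GRing.mul /= !mulr0 subr0 add0r.
Qed.

Lemma cint_chasles a b c f : a <= b -> b <= c -> cont_seg a c f ->
  cint f a c = cint f a b + cint f b c.
Proof.
move=> ab bc hf; rewrite /cint (rint_chasles ab bc (cont_seg_Re hf)).
by rewrite (rint_chasles ab bc (cont_seg_Im hf)).
Qed.

(** Rotating the integral onto the positive axis reduces the estimate to that
    of the real part, so that no constant is lost. *)
Lemma cint_bound a b f M : a <= b -> cont_seg a b f ->
  (forall x, a <= x <= b -> cabs (f x) <= M) -> cabs (cint f a b) <= M * (b - a).
Proof.
move=> ab hf hM; set I := cint f a b.
have [I0|I0] := eqVneq I 0.
  rewrite I0 cabs0 mulr_ge0 ?subr_ge0//.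
  by apply: le_trans (cabs_ge0 (f a)) (hM a _); rewrite lexx.
have cI : 0 < cabs I by rewrite cabs_gt0.
have e1 : cint (fun x => I^*%C * f x) a b = (cabs I ^+ 2)%:C.
  by rewrite cintZ// -/I mulrC mulcJ.
have e2 : rint (fun x => complex.Re (I^*%C * f x)) a b = cabs I ^+ 2.
  by move: e1 => /(congr1 (@complex.Re R)).
have : cabs I ^+ 2 <= rint (fun=> cabs I * M) a b.
  rewrite -e2; apply: rint_le.
  - by apply: cont_seg_Re; exact: cont_segZ.
  - by move=> x _; exact: cvg_cst.
  - move=> x hx; apply: le_trans (ler_norm _) _; apply: le_trans (abs_Re_le _) _.
    by rewrite cabsM cabs_conj ler_wpM2l ?cabs_ge0// hM.
by rewrite rint_cst// -mulrA expr2 ler_pM2l.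
Qed.

Lemma cint_near a b f (k : R[i]) M : a <= b -> cont_seg a b f ->
  (forall x, a <= x <= b -> cabs (f x - k) <= M) ->
  cabs (cint f a b - k * (b - a)%:C) <= M * (b - a).
Proof.
move=> ab hf hM; rewrite -(cint_cst k ab) -(cintB hf (@cont_seg_cst a b k)).
exact: (cint_bound ab (cont_segB hf (@cont_seg_cst a b k)) hM).
Qed.

End ComplexIntegral.

(** * Goursat's theorem on rectangles *)

Section Goursat.
Variable R : realType.
Implicit Types (a b c d x y : R) (g : R[i] -> R[i]).

(** The integral of [g dz] over the boundary of a rectangle. Opposite sides share
    one integrand, so that affine functions visibly contribute nothing. *)
Definition rect_cycle g a b c d : R[i] :=
  cint (fun x => g (x +i* c) - g (x +i* d)) a b +
  'i * cint (fun y => g (b +i* y) - g (a +i* y)) c d.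

Definition on_rect (P : R[i] -> Prop) a b c d :=
  forall x y, a <= x <= b -> c <= y <= d -> P (x +i* y).

Lemma cont_horiz c x : {for x, continuous (fun x => x +i* c)}.
Proof.
apply/cvg_cabsP => e e0; apply/nbhs_realP; exists e => // w hw.
rewrite (_ : (w +i* c) - (x +i* c) = (w - x)%:C) ?cabs_rC//.
by rewrite [LHS]/GRing.add /= subrr.
Qed.

Lemma cont_verti c x : {for x, continuous (fun x => c +i* x)}.
Proof.
apply/cvg_cabsP => e e0; apply/nbhs_realP; exists e => // w hw.
rewrite (_ : (c +i* w) - (c +i* x) = 'i * (w - x)%:C).
  by rewrite cabsM cabs_rC [cabs 'i]cabsE /= expr0n expr1n add0r sqrtr1 mul1r.
by rewrite [LHS]/GRing.add [RHS]/GRing.mul /=; congr (_ +i* _); ring.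
Qed.

Lemma on_rect_horiz g a b c d y : on_rect (fun z => {for z, continuous g}) a b c d ->
  c <= y <= d -> cont_seg a b (fun x => g (x +i* y)).
Proof. by move=> h hy x hx; apply: (contcomp (@cont_horiz y x)); exact: h. Qed.

Lemma on_rect_verti g a b c d x : on_rect (fun z => {for z, continuous g}) a b c d ->
  a <= x <= b -> cont_seg c d (fun y => g (x +i* y)).
Proof. by move=> h hx y hy; apply: (contcomp (@cont_verti x y)); exact: h. Qed.

Lemma on_rect_sub P a b c d a' b' c' d' : on_rect P a b c d ->
  a <= a' -> b' <= b -> c <= c' -> d' <= d -> on_rect P a' b' c' d'.
Proof.
move=> h h1 h2 h3 h4 x y /andP[x1 x2] /andP[y1 y2]; apply: h.
  by rewrite (le_trans h1 x1) (le_trans x2 h2).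
by rewrite (le_trans h3 y1) (le_trans y2 h4).
Qed.

Lemma rect_cycle_splitx g a b c d m : a <= m <= b -> c <= d ->
  on_rect (fun z => {for z, continuous g}) a b c d ->
  rect_cycle g a b c d = rect_cycle g a m c d + rect_cycle g m b c d.
Proof.
move=> /andP[am mb] cd h; have ab := le_trans am mb.
have v x : a <= x <= b -> cont_seg c d (fun y => g (x +i* y)).
  exact: on_rect_verti h.
have va : cont_seg c d (fun y => g (a +i* y)) by apply: v; rewrite lexx.
have vb : cont_seg c d (fun y => g (b +i* y)) by apply: v; rewrite lexx andbT.
have vm : cont_seg c d (fun y => g (m +i* y)) by apply: v; rewrite am.
rewrite /rect_cycle (cint_chasles am mb); last first.
  by apply: cont_segB; apply: on_rect_horiz h _; rewrite lexx ?cd.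
by rewrite (cintB vb va) (cintB vm va) (cintB vb vm); ring.
Qed.

Lemma rect_cycle_splity g a b c d m : a <= b -> c <= m <= d ->
  on_rect (fun z => {for z, continuous g}) a b c d ->
  rect_cycle g a b c d = rect_cycle g a b c m + rect_cycle g a b m d.
Proof.
move=> ab /andP[cm md] h; have cd := le_trans cm md.
have v y : c <= y <= d -> cont_seg a b (fun x => g (x +i* y)).
  exact: on_rect_horiz h.
have vc : cont_seg a b (fun x => g (x +i* c)) by apply: v; rewrite lexx.
have vd : cont_seg a b (fun x => g (x +i* d)) by apply: v; rewrite lexx andbT.
have vm : cont_seg a b (fun x => g (x +i* m)) by apply: v; rewrite cm.
rewrite /rect_cycle (cint_chasles cm md); last first.
  by apply: cont_segB; apply: on_rect_verti h _; rewrite lexx ?ab.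
by rewrite (cintB vc vd) (cintB vc vm) (cintB vm vd); ring.
Qed.

(** Opposite sides being integrated together, an affine function contributes
    two constant integrands, and these cancel. *)
Lemma rect_cycle_affine g a b c d (k l : R[i]) (M : R) : a <= b -> c <= d ->
  on_rect (fun z => {for z, continuous g}) a b c d ->
  on_rect (fun z => cabs (g z - k - l * z) <= M) a b c d ->
  cabs (rect_cycle g a b c d) <= M * 2 * ((b - a) + (d - c)).
Proof.
move=> ab cd h hM.
have ca : a <= a <= b by rewrite lexx.
have cb : a <= b <= b by rewrite lexx andbT.
have cc : c <= c <= d by rewrite lexx.
have cdd : c <= d <= d by rewrite lexx andbT.
set H := fun x => g (x +i* c) - g (x +i* d).
set V := fun y => g (b +i* y) - g (a +i* y).
have hH : cabs (cint H a b - l * ('i * (c - d)%:C) * (b - a)%:C) <= M * 2 * (b - a).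
  apply: cint_near => //; first by apply: cont_segB; apply: on_rect_horiz h _.
  move=> x hx; rewrite /H.
  rewrite (_ : _ - _ = (g (x +i* c) - k - l * (x +i* c)) -
     (g (x +i* d) - k - l * (x +i* d))).
    apply: le_trans (cabsD _ _) _; rewrite cabsN mulr_natr.
    by rewrite mulr2n lerD ?hM.
  rewrite (_ : 'i * (c - d)%:C = (x +i* c) - (x +i* d)); first by ring.
  by rewrite [LHS]/GRing.mul [RHS]/GRing.add /=; congr (_ +i* _); ring.
have hV : cabs (cint V c d - l * (b - a)%:C * (d - c)%:C) <= M * 2 * (d - c).
  apply: cint_near => //; first by apply: cont_segB; apply: on_rect_verti h _.
  move=> y hy; rewrite /V.
  rewrite (_ : _ - _ = (g (b +i* y) - k - l * (b +i* y)) -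
     (g (a +i* y) - k - l * (a +i* y))).
    apply: le_trans (cabsD _ _) _; rewrite cabsN mulr_natr.
    by rewrite mulr2n lerD ?hM.
  rewrite (_ : (b - a)%:C = (b +i* y) - (a +i* y)); first by ring.
  by rewrite [RHS]/GRing.add /=; congr (_ +i* _); ring.
rewrite /rect_cycle -/H -/V mulrDr.
rewrite (_ : _ + _ = (cint H a b - l * ('i * (c - d)%:C) * (b - a)%:C) +
   'i * (cint V c d - l * (b - a)%:C * (d - c)%:C)).
  apply: le_trans (cabsD _ _) _; apply: lerD => //.
  by rewrite cabsM [cabs 'i]cabsE /= expr0n expr1n add0r sqrtr1 mul1r.
by rewrite -[c - d]opprB rmorphN; ring.
Qed.

End Goursat.

Section GoursatTheorem.
Variable R : realType.
Implicit Types (a b c d x y : R) (g : R[i] -> R[i]).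

Lemma nested_itv (u l : nat -> R) : (forall n, 0 <= l n) ->
  (forall n, u n <= u n.+1) -> (forall n, u n.+1 + l n.+1 <= u n + l n) ->
  exists x, forall n, u n <= x <= u n + l n.
Proof.
move=> l0 hu hl.
have uH n k : u n <= u (n + k)%N.
  by elim: k => [|k IH]; rewrite ?addn0// addnS (le_trans IH).
have lH n k : u (n + k)%N + l (n + k)%N <= u n + l n.
  by elim: k => [|k IH]; rewrite ?addn0// addnS (le_trans (hl _)).
have key n m : u m <= u n + l n.
  have [nm|mn] := leqP n m.
    rewrite -(subnKC nm); apply: le_trans (lH n (m - n)%N).
    by rewrite lerDl l0.
  have := uH m (n - m)%N; rewrite subnKC 1?ltnW// => /le_trans; apply.
  by rewrite lerDl l0.
have ub n : ubound (range u) (u n + l n) by move=> _ [m _ <-]; exact: key.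
exists (sup (range u)) => n; apply/andP; split.
  apply: ub_le_sup; first by exists (u 0%N + l 0%N); exact: ub.
  by exists n.
by apply: ge_sup; [exists (u 0%N); exists 0%N | exact: ub].
Qed.

Lemma pow2_small (S e : R) : 0 < e -> exists n, S / 2 ^+ n < e.
Proof.
move=> e0; exists (Num.bound `|S / e|).
rewrite ltr_pdivrMr ?exprn_gt0// mulrC -ltr_pdivrMr//.
apply: le_lt_trans (ler_norm _) _; apply: lt_le_trans (archi_boundP _) _ => //.
by rewrite -natrX ler_nat ltnW//; exact: ltn_expl.
Qed.

(** Two-dimensional Cousin principle: if the conclusion failed, a nested sequence
    of quarters without [P] would shrink to a point that contradicts the local
    hypothesis. *)
Lemma quartering (L H : R) (P : R -> R -> R -> Prop) a c : 0 <= L -> 0 <= H ->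
  (forall x y s, 0 < s -> P x y (s / 2) -> P (x + L * (s / 2)) y (s / 2) ->
     P x (y + H * (s / 2)) (s / 2) -> P (x + L * (s / 2)) (y + H * (s / 2)) (s / 2) ->
     P x y s) ->
  (forall p q, a <= p <= a + L -> c <= q <= c + H -> exists2 e, 0 < e &
     forall x y s, 0 < s -> s < e -> a <= x -> c <= y -> x + L * s <= a + L -> y + H * s <= c + H ->
       x <= p <= x + L * s -> y <= q <= y + H * s -> P x y s) ->
  P a c 1.
Proof.
move=> L0 H0 quart loc; apply: contrapT => nP.
pose sz (n : nat) : R := 2 ^- n.
have sz0 n : 0 < sz n by rewrite invr_gt0 exprn_gt0.
have szS n : sz n.+1 = sz n / 2 by rewrite /sz exprS invfM mulrC.
pose Q (n : nat) (p p' : R * R) := [/\ p.1 <= p'.1, p.2 <= p'.2,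
   p'.1 + L * sz n.+1 <= p.1 + L * sz n, p'.2 + H * sz n.+1 <= p.2 + H * sz n &
   ~ P p'.1 p'.2 (sz n.+1)].
have step n p : ~ P p.1 p.2 (sz n) -> exists p', Q n p p'.
  move=> hp; apply: contrapT => /forallNP hn; apply: hp.
  have hL : 0 <= L * (sz n / 2) by rewrite mulr_ge0// divr_ge0// ltW.
  have hH : 0 <= H * (sz n / 2) by rewrite mulr_ge0// divr_ge0// ltW.
  by apply: quart => //; apply: contrapT => h;
    [ apply: (hn (p.1, p.2)) | apply: (hn (p.1 + L * (sz n / 2), p.2))
    | apply: (hn (p.1, p.2 + H * (sz n / 2)))
    | apply: (hn (p.1 + L * (sz n / 2), p.2 + H * (sz n / 2)))];
    split; rewrite /= ?szS//; lra.
pose nxt n p := xget p [set p' | Q n p p'].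
pose s := fix s n := if n is m.+1 then nxt m (s m) else (a, c).
have sP n : ~ P (s n).1 (s n).2 (sz n).
  elim: n => [|n IH]; first by rewrite /sz expr0 invr1.
  by have [p' hp'] := step n _ IH; rewrite /= /nxt; case: xgetP => [q -> []|/(_ p')].
have sQ n : Q n (s n) (s n.+1).
  have [p' hp'] := step n _ (sP n).
  by rewrite /= /nxt; case: xgetP => [q -> //|/(_ p')].
have [p hp] : exists p, forall n, (s n).1 <= p <= (s n).1 + L * sz n.
  by apply: (nested_itv (u := fun n => (s n).1) (l := fun n => L * sz n)) => n;
    [rewrite mulr_ge0// ltW | case: (sQ n) | case: (sQ n)].
have [q hq] : exists q, forall n, (s n).2 <= q <= (s n).2 + H * sz n.
  by apply: (nested_itv (u := fun n => (s n).2) (l := fun n => H * sz n)) => n;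
    [rewrite mulr_ge0// ltW | case: (sQ n) | case: (sQ n)].
have inn n : [/\ a <= (s n).1, c <= (s n).2, (s n).1 + L * sz n <= a + L &
    (s n).2 + H * sz n <= c + H].
  elim: n => [|n [h1 h2 h3 h4]]; first by rewrite /= /sz expr0 invr1 !mulr1.
  have [k1 k2 k3 k4 _] := sQ n; split; lra.
have hp0 := hp 0%N; have hq0 := hq 0%N.
rewrite /= /sz expr0 invr1 !mulr1 in hp0 hq0.
have [e e0 he] := loc p q hp0 hq0.
have [n hn] := pow2_small 1 e0.
have [h1 h2 h3 h4] := inn n.
by apply: (sP n); apply: he => //; rewrite /sz -[_^-1]mul1r.
Qed.

(** Differentiability alone makes the integral over a subrectangle of size [s]
    an [o(s ^ 2)], which the quartering sums up to [0]. *)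
Lemma goursat g a b c d : a <= b -> c <= d ->
  on_rect (fun z => derivable g z 1) a b c d -> rect_cycle g a b c d = 0.
Proof.
move=> ab cd hg.
have cg : on_rect (fun z => {for z, continuous g}) a b c d.
  by move=> x y hx hy; apply: derivable_cont; exact: hg.
pose L := b - a; pose H := d - c.
have L0 : 0 <= L by rewrite subr_ge0.
have H0 : 0 <= H by rewrite subr_ge0.
suff key e : 0 < e -> cabs (rect_cycle g a b c d) <= e * (L + H) ^+ 2.
  apply/eqP; rewrite -cabs_eq0 eq_le cabs_ge0 andbT.
  apply/ler_addgt0Pr => e e0; rewrite add0r.
  have S0 : 0 <= (L + H) ^+ 2 by rewrite sqr_ge0.
  have q0 : 0 < e / ((L + H) ^+ 2 + 1) by rewrite divr_gt0//; lra.
  apply: le_trans (key _ q0) _.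
  by rewrite mulrAC ler_pdivrMr; [nra|lra].
move=> e0.
pose P x y s := a <= x -> c <= y -> x + L * s <= b -> y + H * s <= d -> 0 < s ->
  cabs (rect_cycle g x (x + L * s) y (y + H * s)) <= e * ((L + H) * s) ^+ 2.
suff : P a c 1.
  by rewrite /P !mulr1 /L /H !subrKC; apply.
apply: (@quartering L H) => //.
- move=> x y s s0 P1 P2 P3 P4 ax cy xb yd _.
  have s20 : 0 < s / 2 by rewrite divr_gt0.
  have Ls : 0 <= L * (s / 2) by rewrite mulr_ge0// ltW.
  have Hs : 0 <= H * (s / 2) by rewrite mulr_ge0// ltW.
  have xE : x + L * (s / 2) + L * (s / 2) = x + L * s by field.
  have yE : y + H * (s / 2) + H * (s / 2) = y + H * s by field.
  have sub : on_rect (fun z => {for z, continuous g}) x (x + L * s) y (y + H * s).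
    exact: on_rect_sub cg ax xb cy yd.
  have ym : y <= y + H * (s / 2) <= y + H * s by rewrite -yE lerDl Hs /= lerDl.
  have xm : x <= x + L * (s / 2) <= x + L * s by rewrite -xE lerDl Ls /= lerDl.
  have [xm1 xm2] := andP xm; have [ym1 ym2] := andP ym.
  rewrite (rect_cycle_splitx xm (le_trans ym1 ym2) sub).
  rewrite (rect_cycle_splity xm1 ym (on_rect_sub sub (lexx _) xm2 (lexx _) (lexx _))).
  rewrite (rect_cycle_splity xm2 ym (on_rect_sub sub xm1 (lexx _) (lexx _) (lexx _))).
  rewrite -!xE -!yE in xb yd *.
  have ax' := le_trans ax xm1; have cy' := le_trans cy ym1.
  have xb' : x + L * (s / 2) <= b by apply: le_trans xb; rewrite lerDl.
  have yd' : y + H * (s / 2) <= d by apply: le_trans yd; rewrite lerDl.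
  have {}P1 := P1 ax cy xb' yd' s20.
  have {}P2 := P2 ax' cy xb yd' s20.
  have {}P3 := P3 ax cy' xb' yd s20.
  have {}P4 := P4 ax' cy' xb yd s20.
  apply: le_trans (cabsD _ _) _.
  have h1 := cabsD (rect_cycle g x (x + L * (s / 2)) y (y + H * (s / 2)))
    (rect_cycle g x (x + L * (s / 2)) (y + H * (s / 2)) (y + H * (s / 2) + H * (s / 2))).
  have h2 := cabsD (rect_cycle g (x + L * (s / 2)) (x + L * (s / 2) + L * (s / 2)) y (y + H * (s / 2)))
    (rect_cycle g (x + L * (s / 2)) (x + L * (s / 2) + L * (s / 2)) (y + H * (s / 2)) (y + H * (s / 2) + H * (s / 2))).
  apply: le_trans (lerD h1 h2) _; apply: le_trans (lerD (lerD P1 P3) (lerD P2 P4)) _.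
  by rewrite le_eqVlt; apply/orP; left; apply/eqP; field.
- move=> p q hp hq; rewrite !subrKC in hp hq.
  have e20 : 0 < e / 2 by rewrite divr_gt0.
  have [dl dl0 hd] := derivable_cdiff (hg p q hp hq) e20.
  exists (dl / (L + H + 1)); first by rewrite divr_gt0//; lra.
  move=> x y s s0 sd ax cy xb yd px qy _ _ _ _ _; rewrite !subrKC in xb yd.
  have Ls : 0 <= L * s by rewrite mulr_ge0// ltW.
  have Hs : 0 <= H * s by rewrite mulr_ge0// ltW.
  have sd' : (L + H) * s < dl.
    move: sd; rewrite ltr_pdivlMr; last by lra.
    by nra.
  have near u v : x <= u <= x + L * s -> y <= v <= y + H * s ->
      cabs ((u +i* v) - (p +i* q)) <= (L + H) * s.
    move=> /andP[u1 u2] /andP[v1 v2]; have [p1 p2] := andP px; have [q1 q2] := andP qy.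
    apply: le_trans (cabs_Re_Im _) _; rewrite mulrDl /=.
    by apply: lerD; rewrite ler_norml; lra.
  have := @rect_cycle_affine R g x (x + L * s) y (y + H * s)
    (g (p +i* q) - derive1 g (p +i* q) * (p +i* q)) (derive1 g (p +i* q))
    (e / 2 * ((L + H) * s)).
  rewrite !lerDl => /(_ Ls Hs (on_rect_sub cg ax xb cy yd)) h.
  apply: (le_trans (h _)).
    move=> u v hu hv; rewrite (_ : _ - _ = g (u +i* v) - g (p +i* q) -
       derive1 g (p +i* q) * ((u +i* v) - (p +i* q))); last by ring.
    have hn := near u v hu hv.
    apply: le_trans (hd _ (le_lt_trans hn sd')) _.
    by rewrite ler_pM2l.
  by rewrite le_eqVlt; apply/orP; left; apply/eqP; field.
Qed.

End GoursatTheorem.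

(** * The complex exponential *)

Section ComplexExponential.
Variable R : realType.
Implicit Types (x y r t : R) (z w : R[i]).

Definition circ r t : R[i] := (r * cos t) +i* (r * sin t).

Definition cexp z : R[i] := circ (expR (complex.Re z)) (complex.Im z).

Lemma cabs_circ r t : 0 <= r -> cabs (circ r t) = r.
Proof.
move=> r0; rewrite cabsE /= !exprMn -mulrDr cos2Dsin2 mulr1 sqrtr_sqr.
by rewrite ger0_norm.
Qed.

Lemma cexpD z w : cexp (z + w) = cexp z * cexp w.
Proof.
case: z w => [a b] [c d]; rewrite /cexp /circ /= expRD cosD sinD.
by rewrite [RHS]/GRing.mul /=; congr (_ +i* _); ring.
Qed.

Lemma real_diff_bound (f : R -> R) (x l e : R) : is_derive x 1 f l -> 0 < e ->
  exists2 d : R, 0 < d & forall h, `|h| < d -> `|f (x + h) - f x - l * h| <= e * `|h|.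
Proof.
move=> [dfx dfl] e0.
have h : h^-1 *: ((f \o shift x) (h *: (1 : R)) - f x) @[h --> 0^'] --> l.
  by rewrite -dfl; exact: dfx.
move: h => /cvgrPdist_lt h; have /nbhs_realP[d d0 hd] := h _ e0.
exists d => // k kd; have [->|k0] := eqVneq k 0.
  by rewrite addr0 subrr mulr0 subr0 !normr0 mulr0.
have := hd k; rewrite subr0 => /(_ kd k0) /= hk.
rewrite (_ : f (x + k) - f x - l * k =
   - (l - k^-1 *: (f (k *: 1 + x) - f x)) * k).
  by rewrite normrM normrN ler_wpM2r// ltW.
rewrite -[k *: 1]/(k * 1) mulr1 -[_ *: _]/(k^-1 * _) [k + x]addrC opprB mulrBl.
by rewrite mulrAC mulVf// mul1r.
Qed.

Lemma cdiff_cexp0 : cdiff cexp 0 1.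
Proof.
move=> e e0.
have [e' [e'0 e'1 e'e]] : exists e' : R, [/\ 0 < e', e' <= 1 & e' * 8 <= e].
  exists (Num.min (e / 8) 1); split.
  - by rewrite lt_min ltr01 andbT divr_gt0.
  - by rewrite ge_min lexx orbT.
  - by rewrite -ler_pdivlMr// ge_min lexx.
have [d1 d10 h1] := real_diff_bound (is_derive_expR (0 : R)) e'0.
have [d2 d20 h2] := real_diff_bound (is_derive_cos (0 : R)) e'0.
have [d3 d30 h3] := real_diff_bound (is_derive_sin (0 : R)) e'0.
exists (Num.min e' (Num.min d1 (Num.min d2 d3))).
  by rewrite !lt_min e'0 d10 d20 d30.
move=> [x y]; rewrite subr0 !lt_min => /and4P[k0 k1 k2 k3].
have hx : `|x| <= cabs (x +i* y) := abs_Re_le (x +i* y).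
have hy : `|y| <= cabs (x +i* y) := abs_Im_le (x +i* y).
have {h1} := h1 x (le_lt_trans hx k1); rewrite add0r expR0 mul1r => h1.
have {h2} := h2 y (le_lt_trans hy k2); rewrite add0r cos0 sin0 oppr0 mul0r subr0 => h2.
have {h3} := h3 y (le_lt_trans hy k3); rewrite add0r cos0 sin0 mul1r subr0 => h3.
have xe := le_lt_trans hx k0.
have e1 : cexp 0 = 1 by rewrite /cexp /circ /= expR0 cos0 sin0 mulr1 mulr0.
rewrite e1 mul1r /cexp /circ /=.
set N := cabs _ in hx hy *; rewrite -/N.
apply: le_trans (cabs_Re_Im _) _ => /=; rewrite !subr0.
have cy : `|cos y| <= 1 by exact: cos_max.
have sy : `|sin y| <= 2 * `|y|.
  rewrite -[sin y](subrK y); apply: le_trans (ler_normD _ _) _.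
  by have := normr_ge0 y; nra.
have ex : `|expR x - 1| <= 2 * `|x|.
  rewrite -[expR x - 1](subrK x); apply: le_trans (ler_normD _ _) _.
  by have := normr_ge0 x; nra.
have nx := normr_ge0 x; have ny := normr_ge0 y.
have A1 : `|expR x * cos y - 1 - x| <= e' * N + 2 * (e' * N).
  rewrite (_ : _ - _ = (expR x - 1 - x) * cos y + (1 + x) * (cos y - 1)); last by ring.
  apply: le_trans (ler_normD _ _) _; rewrite !normrM; apply: lerD.
    apply: le_trans (ler_pM (normr_ge0 _) (normr_ge0 _) h1 cy) _.
    by rewrite mulr1 ler_pM2l.
  apply: ler_pM => //; first by apply: le_trans (ler_normD _ _) _; rewrite normr1; lra.
  by apply: le_trans h2 _; rewrite ler_pM2l.
have A2 : `|expR x * sin y - y| <= 4 * (e' * N) + e' * N.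
  rewrite (_ : _ - _ = (expR x - 1) * sin y + (sin y - y)); last by ring.
  apply: le_trans (ler_normD _ _) _; apply: lerD; last first.
    by apply: le_trans h3 _; rewrite ler_pM2l.
  rewrite normrM; apply: le_trans (ler_pM (normr_ge0 _) (normr_ge0 _) ex sy) _.
  rewrite mulrACA -natrM ler_pM2l//; apply: ler_pM => //; exact: ltW.
apply: le_trans (lerD A1 A2) _.
have N0 : 0 <= N := cabs_ge0 _.
have : e' * N * 8 <= e * N by rewrite mulrAC ler_wpM2r.
by move: (e' * N) (e * N) => P Q; lra.
Qed.

Lemma cdiff_cexp z : cdiff cexp z (cexp z).
Proof.
have h1 : cdiff (fun w => w - z) z (1 - 0).
  by apply: cdiffB; [exact: cdiff_id|exact: cdiff_cst].
have h0 : cdiff cexp ((fun w => w - z) z) 1 by rewrite /= subrr; exact: cdiff_cexp0.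
have := cdiffZ (cexp z) (cdiff_comp h1 h0).
rewrite subr0 !mulr1.
rewrite (_ : (fun w => _) = cexp)//.
by apply/funext => w; rewrite -cexpD subrKC.
Qed.

Lemma cexp_ln r t : 0 < r -> cexp (ln r +i* t) = circ r t.
Proof. by move=> r0; rewrite /cexp /= lnK. Qed.

Lemma circ_cont r t : {for t, continuous (circ r)}.
Proof.
have -> : circ r = (fun s => (r * cos s)%:C + 'i * (r * sin s)%:C).
  by apply/funext => s; rewrite [LHS]ReImE.
apply: contD; last apply: contM; [|exact: cont_cst|].
- apply: (continuous_comp (f := fun s => r * cos s) (g := fun y => y%:C)).
    by apply: cvgM; [exact: cvg_cst|exact: continuous_cos].
  exact: cont_rC.
- apply: (continuous_comp (f := fun s => r * sin s) (g := fun y => y%:C)).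
    by apply: cvgM; [exact: cvg_cst|exact: continuous_sin].
  exact: cont_rC.
Qed.

Lemma circ_dist r s t : cabs (circ r t - circ s t) = `|r - s|.
Proof.
rewrite (_ : _ - _ = (r - s)%:C * circ 1 t); last first.
  rewrite /circ [LHS]/GRing.add [RHS]/GRing.mul /=; congr (_ +i* _); ring.
by rewrite cabsM cabs_rC cabs_circ// mulr1.
Qed.

End ComplexExponential.

(** * The mean value property *)

Section CircleMean.
Variable R : realType.
Implicit Types (r s t e : R) (z w : R[i]) (f g : R[i] -> R[i]).

Definition cmean f r : R[i] := (2 * pi)^-1%:C * cint (fun t => f (circ r t)) 0 (2 * pi).

Let twopi_gt0 : 0 < 2 * pi :> R.
Proof. by rewrite mulr_gt0// pi_gt0. Qed.

Let twopi_inv : 0 <= (2 * pi)^-1 :> R.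
Proof. by rewrite invr_ge0 ltW. Qed.

Definition cont_on_circle f r := forall z, cabs z = r -> {for z, continuous f}.

Lemma cont_seg_circ a b f r : 0 <= r -> cont_on_circle f r ->
  cont_seg a b (fun t => f (circ r t)).
Proof.
move=> r0 h t _; apply: (contcomp (@circ_cont R r t)).
by apply: h; rewrite cabs_circ.
Qed.

Lemma cmean_near f r (k : R[i]) M : 0 <= r -> cont_on_circle f r ->
  (forall z, cabs z = r -> cabs (f z - k) <= M) -> cabs (cmean f r - k) <= M.
Proof.
move=> r0 hf hM.
have h := @cint_near R 0 (2 * pi) (fun t => f (circ r t)) k M (ltW twopi_gt0)
  (@cont_seg_circ 0 (2 * pi) _ _ r0 hf) (fun x _ => hM _ (cabs_circ x r0)).
rewrite subr0 in h.
have p0 : ((2 * pi)%:C : R[i]) != 0.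
  by rewrite -cabs_gt0 cabs_rC ger0_norm// ltW.
rewrite (_ : cmean f r - k = (2 * pi)^-1%:C *
  (cint (fun t => f (circ r t)) 0 (2 * pi) - k * (2 * pi)%:C)).
  by rewrite cabsM cabs_rC (ger0_norm twopi_inv) ler_pdivrMl// [X in _ <= X]mulrC.
by rewrite mulrBr /cmean fmorphV /= [k * _]mulrC mulKf.
Qed.

Lemma cmean_bound f r M : 0 <= r -> cont_on_circle f r ->
  (forall z, cabs z = r -> cabs (f z) <= M) -> cabs (cmean f r) <= M.
Proof.
move=> r0 hf hM; rewrite -[cmean f r]subr0; apply: cmean_near => // z hz.
by rewrite subr0 hM.
Qed.

Lemma cmeanB f g r : 0 <= r -> cont_on_circle f r -> cont_on_circle g r ->
  cmean (fun z => f z - g z) r = cmean f r - cmean g r.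
Proof.
move=> r0 hf hg; rewrite /cmean -mulrBr.
by rewrite -(cintB (@cont_seg_circ 0 (2 * pi) _ _ r0 hf) (@cont_seg_circ 0 (2 * pi) _ _ r0 hg)).
Qed.

Lemma cmeanZ (k : R[i]) f r : 0 <= r -> cont_on_circle f r ->
  cmean (fun z => k * f z) r = k * cmean f r.
Proof.
move=> r0 hf; rewrite /cmean (cintZ k (@cont_seg_circ 0 (2 * pi) _ _ r0 hf)).
by rewrite mulrCA.
Qed.

Lemma cmean_eq f g r : 0 <= r -> (forall z, cabs z = r -> f z = g z) ->
  cmean f r = cmean g r.
Proof.
move=> r0 h; rewrite /cmean; congr (_ * _); apply: cint_eq => t _.
by apply: h; rewrite cabs_circ.
Qed.

(** In logarithmic coordinates the annulus is a rectangle, and by periodicity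
    its horizontal sides cancel. *)
Lemma cmean_annulus f s t : 0 < s -> s <= t ->
  (forall z, s <= cabs z <= t -> derivable f z 1) -> cmean f s = cmean f t.
Proof.
move=> s0 st hf; have t0 := lt_le_trans s0 st.
pose g := fun w => f (cexp w).
have dg : on_rect (fun z => derivable g z 1) (ln s) (ln t) 0 (2 * pi).
  move=> x y /andP[x1 x2] _.
  have d : derivable f (cexp (x +i* y)) 1.
    apply: hf; rewrite /cexp /= cabs_circ ?expR_ge0//.
    by rewrite -[s]lnK// -[t]lnK// !ler_expR x1 x2.
  exact: cdiff_derivable (cdiff_comp (cdiff_cexp (x +i* y)) (derivable_cdiff d)).
have lst : ln s <= ln t by rewrite ler_ln.
have := goursat lst (ltW twopi_gt0) dg; rewrite /rect_cycle.
rewrite (@cint_eq _ _ _ _ (fun=> 0)); last first.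
  move=> x _; apply/eqP; rewrite subr_eq0 /g /cexp /circ /= cos0 sin0.
  by rewrite (_ : 2 * pi = pi *+ 2) ?cos2pi ?sin2pi// mulr_natl.
rewrite cint_cst// mul0r add0r => /eqP; rewrite mulf_eq0.
have -> : ('i == 0 :> R[i]) = false by rewrite eq_complex /= oner_eq0 andbF.
have hc u : 0 < u -> (forall z, cabs z = u -> derivable f z 1) -> 
    cont_seg 0 (2 * pi) (fun t => f (circ u t)).
  move=> u0 hu; apply: cont_seg_circ; first exact: ltW.
  by move=> z /hu; exact: derivable_cont.
rewrite /= (@cint_eq _ _ _ _ (fun y => f (circ t y) - f (circ s y))); last first.
  by move=> y _; rewrite /g !cexp_ln.
rewrite cintB; first last.
- by apply: hc => // z zs; apply: hf; rewrite zs lexx.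
- by apply: hc => // z zt; apply: hf; rewrite zt lexx andbT.
by rewrite subr_eq0 /cmean => /eqP ->.
Qed.

Lemma cmean_cont f s e : 0 <= s -> cont_on_circle f s -> 0 < e ->
  exists2 d, 0 < d & forall t, 0 <= t -> `|t - s| < d -> cont_on_circle f t ->
     cabs (cmean f t - cmean f s) <= e.
Proof.
move=> s0 hf e0.
have cov : compact `[0, 2 * pi : R] by exact: segment_compact.
have /nbhs_realP[d d0 hd] : \forall t \near s, `[0, 2 * pi : R] `<=`
    (fun u => cabs (f (circ t u) - f (circ s u)) < e).
  apply: (proj1 (compact_near_coveringP _) cov _ (nbhs s)
    (fun t u => cabs (f (circ t u) - f (circ s u)) < e) (nbhs_filter s)).
  move=> u _; have e20 : 0 < e / 2 by rewrite divr_gt0.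
  have cu : {for circ s u, continuous f} by apply: hf; rewrite cabs_circ.
  have [d d0 hd] := (cont_cabsP _ _).1 cu _ e20.
  have d20 : 0 < d / 2 by rewrite divr_gt0.
  have /nbhs_realP[d1 d10 hd1] := (cvg_cabsP (nbhs_filter u) _ _).1 (@circ_cont R s u) _ d20.
  exists ([set u' | `|u' - u| < d1], [set t | `|t - s| < d / 2]).
    by split; apply/nbhs_realP; [exists d1|exists (d / 2)].
  move=> [u' t] /= [hu' ht].
  have h1 := hd1 _ hu'.
  rewrite (_ : _ - _ = (f (circ t u') - f (circ s u)) - (f (circ s u') - f (circ s u))); last by ring.
  apply: le_lt_trans (cabsD _ _) _; rewrite cabsN [e]splitr.
  apply: ltrD; apply: hd; last by apply: lt_trans h1 _; lra.
  apply: le_lt_trans (cabs_tri _ (circ s u') _) _.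
  by rewrite circ_dist [d]splitr ltrD.
exists d => // t t0 ts ht; have ht' := hd t ts.
rewrite /cmean -mulrBr.
rewrite -(cintB (@cont_seg_circ 0 (2 * pi) _ _ t0 ht) (@cont_seg_circ 0 (2 * pi) _ _ s0 hf)).
rewrite cabsM cabs_rC (ger0_norm twopi_inv) ler_pdivrMl// [X in _ <= X]mulrC.
rewrite -[X in _ <= _ * X]subr0; apply: cint_bound; first exact: ltW.
  by apply: cont_segB; exact: cont_seg_circ.
by move=> u hu; apply/ltW/ht'; rewrite /= in_itv.
Qed.

End CircleMean.

Section MeanValue.
Variable R : realType.
Implicit Types (r s t e : R) (z w : R[i]) (f g : R[i] -> R[i]).

Lemma eq_of_cabs_le z w : (forall e, 0 < e -> cabs (z - w) <= e) -> z = w.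
Proof.
move=> h; apply/eqP; rewrite -subr_eq0 -cabs_eq0 eq_le cabs_ge0 andbT.
by apply/ler_addgt0Pr => e e0; rewrite add0r h.
Qed.

Lemma cmean_limit f s (k : R[i]) : 0 <= s -> cont_on_circle f s ->
  (forall d, 0 < d -> exists t, [/\ 0 <= t, `|t - s| < d, cont_on_circle f t &
     cmean f t = k]) -> cmean f s = k.
Proof.
move=> s0 hf h; apply: eq_of_cabs_le => e e0.
have [d d0 hd] := cmean_cont s0 hf e0.
have [t [t0 ts ct tk]] := h _ d0.
by rewrite cabsB -tk; exact: hd.
Qed.

Lemma cmean0 f : {for 0, continuous f} -> cmean f 0 = f 0.
Proof.
move=> hf; apply: eq_of_cabs_le => e e0; apply: cmean_near; first exact: lexx.
  by move=> z /eqP; rewrite cabs_eq0 => /eqP->.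
by move=> z /eqP; rewrite cabs_eq0 => /eqP->; rewrite subrr cabs0 ltW.
Qed.

(** The mean is constant on either side of the circle [|z| = r1], it depends
    continuously on the radius, and it tends to [f 0] at the centre. The
    exceptional circle makes room for the removable point of a difference
    quotient. *)
Lemma mean_value f r r1 : 0 < r ->
  (forall z, cabs z <= r -> {for z, continuous f}) ->
  (forall z, 0 < cabs z < r -> cabs z != r1 -> derivable f z 1) ->
  cmean f r = f 0.
Proof.
move=> r0 cf df.
have cc t : t <= r -> cont_on_circle f t by move=> tr z zt; apply: cf; rewrite zt.
wlog r10 : r1 df / 0 < r1 => [hw|].
  have [r1p|r1n] := ltP 0 r1; first exact: hw df r1p.
  apply: (hw (2 * r)); last by rewrite mulr_gt0.
  move=> z hz _; apply: df => //; apply/eqP => zr; move: hz; rewrite zr; lra.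
have f0 : {for 0, continuous f} by apply: cf; rewrite cabs0 ltW.
have inner s : 0 < s -> s < r -> s < r1 -> cmean f s = f 0.
  move=> s0 sr sr1; rewrite -(cmean0 f0); apply/esym.
  apply: cmean_limit; [exact: lexx|by apply: cc; exact: ltW|].
  move=> d d0; exists (Num.min s (d / 2)).
  have m0 : 0 < Num.min s (d / 2) by rewrite lt_min s0 divr_gt0.
  have ms : Num.min s (d / 2) <= s by rewrite ge_min lexx.
  have md : Num.min s (d / 2) <= d / 2 by rewrite ge_min lexx orbT.
  split; first exact: ltW.
  - by rewrite subr0 ger0_norm ?ltW// (le_lt_trans md)//; lra.
  - by apply: cc; lra.
  - apply: (cmean_annulus m0 ms) => z /andP[z1 z2]; apply: df; first by apply/andP; split; lra.
    by apply/eqP => h; move: z2; rewrite h; lra.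
have crit : r1 <= r -> cmean f r1 = f 0.
  move=> r1r; apply: cmean_limit; [exact: ltW|exact: cc|].
  move=> d d0; exists (Num.max (r1 / 2) (r1 - d / 2)).
  have m0 : r1 / 2 <= Num.max (r1 / 2) (r1 - d / 2) by rewrite le_max lexx.
  have md : r1 - d / 2 <= Num.max (r1 / 2) (r1 - d / 2) by rewrite le_max lexx orbT.
  have mr : Num.max (r1 / 2) (r1 - d / 2) < r1 by rewrite gt_max; apply/andP; split; lra.
  split; [lra| |by apply: cc; lra|by apply: inner; lra].
  by rewrite ltr_norml; apply/andP; split; lra.
have outer s : r1 < s -> s < r -> cmean f s = f 0.
  move=> r1s sr; rewrite -crit; last by lra.
  apply/esym; apply: cmean_limit; [exact: ltW|by apply: cc; lra|].
  move=> d d0; exists (Num.min s (r1 + d / 2)).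
  have m0 : Num.min s (r1 + d / 2) <= s by rewrite ge_min lexx.
  have md : Num.min s (r1 + d / 2) <= r1 + d / 2 by rewrite ge_min lexx orbT.
  have mr : r1 < Num.min s (r1 + d / 2) by rewrite lt_min; apply/andP; split; lra.
  split; [lra| |by apply: cc; lra|].
    by rewrite ltr_norml; apply/andP; split; lra.
  apply: cmean_annulus; [by lra|exact: m0|].
  move=> z /andP[z1 z2]; apply: df; first by apply/andP; split; lra.
  by apply/eqP => h; move: z1; rewrite h; lra.
have [rr1|rr1] := eqVneq r r1; first by rewrite rr1; apply: crit; rewrite rr1.
apply: cmean_limit; [exact: ltW|exact: cc|] => d d0.
have [r1r|r1r] := ltP r1 r.
- exists (Num.max ((r + r1) / 2) (r - d / 2)).
  have m0 : (r + r1) / 2 <= Num.max ((r + r1) / 2) (r - d / 2) by rewrite le_max lexx.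
  have md : r - d / 2 <= Num.max ((r + r1) / 2) (r - d / 2) by rewrite le_max lexx orbT.
  have mr : Num.max ((r + r1) / 2) (r - d / 2) < r by rewrite gt_max; apply/andP; split; lra.
  split; [lra| |by apply: cc; lra|by apply: outer; lra].
  by rewrite ltr_norml; apply/andP; split; lra.
- exists (Num.max (r / 2) (r - d / 2)).
  have m0 : r / 2 <= Num.max (r / 2) (r - d / 2) by rewrite le_max lexx.
  have md : r - d / 2 <= Num.max (r / 2) (r - d / 2) by rewrite le_max lexx orbT.
  have mr : Num.max (r / 2) (r - d / 2) < r by rewrite gt_max; apply/andP; split; lra.
  split; [lra| |by apply: cc; lra|by apply: inner; lra].
  by rewrite ltr_norml; apply/andP; split; lra.
Qed.

Lemma mean_bound f r M : 0 < r ->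
  (forall z, cabs z <= r -> {for z, continuous f}) ->
  (forall z, 0 < cabs z < r -> derivable f z 1) ->
  (forall z, cabs z = r -> cabs (f z) <= M) -> cabs (f 0) <= M.
Proof.
move=> r0 cf df hM; rewrite -(mean_value (r1 := 0) r0 cf) => [|z hz _]; last exact: df.
apply: cmean_bound => //; first exact: ltW.
by move=> z zr; apply: cf; rewrite zr.
Qed.

(** Upper bounds, lower bounds and Lipschitz constants on compact sets all come
    from this form of compactness, with a suitable [P]. *)
Lemma compact_small (K : set R[i]) (P : R -> R[i] -> Prop) : compact K ->
  (forall z, K z -> exists2 d, 0 < d &
     forall e w, 0 < e < d -> cabs (w - z) < d -> P e w) ->
  exists2 d, 0 < d & forall e, 0 < e < d -> forall z, K z -> P e z.
Proof.
move=> cK h.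
have := proj1 (compact_near_coveringP K) cK R (0^'+) P (at_right_proper_filter 0).
case.
  move=> z /h[d d0 hd].
  exists ([set w | cabs (w - z) < d], [set e | 0 < e < d]).
    split; first by apply/nbhs_cabsP; exists d.
    by near=> e; apply/andP; split; near: e; [exact: nbhs_right_gt|exact: nbhs_right_lt].
  by move=> [w e] /= [hw he]; exact: hd.
move=> d /= d0 hd; exists d => // e /andP[e0 ed].
apply: hd => //=; by rewrite sub0r normrN gtr0_norm.
Unshelve. all: by end_near.
Qed.

Lemma cont_bounded_disc f r : (forall z, cabs z <= r -> {for z, continuous f}) ->
  exists2 M, 0 < M & forall w, cabs w <= r -> cabs (f w) <= M.
Proof.
move=> cf.
have [|d d0 hd] := compact_small (P := fun e w => cabs (f w) <= e^-1) (@compact_closed_disk R r).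
  move=> z zr; have [d d0 hd] := (cont_cabsP _ _).1 (cf z zr) 1 ltr01.
  have p0 : 0 < cabs (f z) + 1 by have := cabs_ge0 (f z); lra.
  exists (Num.min d (cabs (f z) + 1)^-1); first by rewrite lt_min d0 invr_gt0.
  move=> e w /andP[e0]; rewrite !lt_min => /andP[_ e1] /andP[wd _].
  have h1 : cabs (f z) + 1 <= e^-1 by rewrite -[_ + 1]invrK lef_pV2 ?posrE ?invr_gt0// ltW.
  apply: le_trans h1; have := hd w wd; have := cabs_sub (f w) (f z); lra.
exists (d / 2)^-1; first by rewrite invr_gt0 divr_gt0.
by move=> w wr; apply: hd => //; apply/andP; split; lra.
Qed.

(** The mean value property of [f] and of [w (f w - f a) / (w - a)] gives
    [f a - f 0 = a * mean ((f w - f a) / (w - a))], and the mean on the right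
    converges when [a] tends to [0]. *)
Lemma removable0 f r : 0 < r -> (forall z, cabs z < r -> {for z, continuous f}) ->
  (forall z, 0 < cabs z < r -> derivable f z 1) -> derivable f 0 1.
Proof.
move=> r0 cf df; pose s := r / 2.
have s0 : 0 < s by rewrite divr_gt0.
have s0' := ltW s0.
have sr : s < r by rewrite /s; lra.
have cf' z : cabs z <= s -> {for z, continuous f}.
  by move=> zs; apply: cf; exact: le_lt_trans sr.
pose q a w := (f w - f a) / (w - a).
have cq a : cabs a < s -> cont_on_circle (q a) s.
  move=> as_ z zs; apply: contM.
    by apply: contB; [apply: cf'; rewrite zs|exact: cont_cst].
  apply: contV; last by apply: contB; [exact: cont_idC|exact: cont_cst].
  by rewrite subr_eq0; apply/eqP => za; move: as_; rewrite -za zs ltxx.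
have fs : cont_on_circle f s by move=> z zs; apply: cf'; rewrite zs.
have mf : cmean f s = f 0.
  apply: (mean_value (r1 := 0) s0 cf') => z /andP[z0 zs] _; apply: df.
  by rewrite z0 (lt_trans zs).
have key a : cabs a < s -> a != 0 -> f a - f 0 = a * cmean (q a) s.
  move=> as_ a0; have ca0 : 0 < cabs a by rewrite cabs_gt0.
  have da : derivable f a 1 by apply: df; rewrite ca0 (lt_trans as_).
  pose h w := w * quot f a (derive1 f a) w.
  have ch z : cabs z <= s -> {for z, continuous h}.
    move=> zs; apply: contM; first exact: cont_idC.
    have [->|za] := eqVneq z a; first by apply/cdiff_quot; exact: derivable_cdiff.
    exact: quot_cont (cf' z zs) za.
  have : cmean h s = h 0.
    apply: (mean_value (r1 := cabs a) s0 ch) => z /andP[z0 zs] zna.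
    have za : z != a by apply/eqP => za; move: zna; rewrite za eqxx.
    have dz : derivable f z 1 by apply: df; rewrite z0 (lt_trans zs).
    have := cdiffM (cdiff_id z) (derivable_cdiff (cdiff_quot_off (L := derive1 f a) za dz)).
    exact: cdiff_derivable.
  rewrite [h 0]mul0r => hm.
  have : cmean (fun w => h w - (f w - f a)) s = cmean (fun w => a * q a w) s.
    apply: cmean_eq; first exact: ltW.
    move=> z zs; have za : z != a by apply/eqP => za; move: as_; rewrite -za zs ltxx.
    rewrite /h /q /quot (negbTE za); field.
    by rewrite subr_eq0.
  have chs : cont_on_circle h s by move=> z zs; apply: ch; rewrite zs.
  have cca : cont_on_circle (fun=> f a) s by move=> z zs; exact: cont_cst.
  have cfa : cont_on_circle (fun w => f w - f a) s.
    by move=> z zs; apply: contB; [exact: fs|exact: cont_cst].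
  rewrite (cmeanZ a s0' (cq a as_)) (cmeanB s0' chs cfa) (cmeanB s0' fs cca).
  rewrite hm mf => <-.
  have -> : cmean (fun=> f a) s = f a.
    apply: eq_of_cabs_le => e e0; apply: cmean_near; first exact: ltW.
      by move=> z zs; exact: cont_cst.
    by move=> z _; rewrite subrr cabs0 ltW.
  by rewrite sub0r opprB.
have c0 : {for 0, continuous f} by apply: cf; rewrite cabs0.
apply: (@cdiff_derivable _ f 0 (cmean (q 0) s)) => e e0.
have c00 : cabs (0 : R[i]) < s by rewrite cabs0.
(* it remains to see that the difference quotients converge uniformly on the circle *)
suff [d d0 hd] : exists2 d, 0 < d & forall a, cabs a < d -> cabs a < s ->
    forall w, cabs w = s -> cabs (q a w - q 0 w) <= e.
  exists (Num.min d s); first by rewrite lt_min d0.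
  move=> a; rewrite subr0 lt_min => /andP[ad as_].
  have [->|a0] := eqVneq a 0; first by rewrite subrr mulr0 subr0 cabs0 mulr0.
  rewrite key// [_ * a]mulrC -mulrBr cabsM mulrC ler_wpM2r ?cabs_ge0//.
  rewrite -(cmeanB s0' (cq a as_) (cq 0 c00)).
  apply: cmean_bound; first exact: ltW.
    by move=> z zs; apply: contB; apply: cq.
  by move=> w ws; exact: hd.
have [M M0 hM] : exists2 M, 0 < M & forall w, cabs w <= s -> cabs (f w) <= M.
  exact: cont_bounded_disc.
have s20 : 0 < s / 2 by rewrite divr_gt0.
have es0 : 0 < e * s / 4 by rewrite divr_gt0// mulr_gt0.
have [d d0 hd] := (cont_cabsP _ _).1 c0 _ es0.
have ms0 : 0 < e * s ^+ 2 / (8 * M).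
  by rewrite divr_gt0// ?mulr_gt0// exprn_gt0.
exists (Num.min (s / 2) (Num.min d (e * s ^+ 2 / (8 * M)))).
  by rewrite !lt_min s20 d0 ms0.
move=> a; rewrite !lt_min => /and3P[a1 a2 a3] as_ w ws.
have w0 : w != 0 by rewrite -cabs_gt0 ws.
have wa : s / 2 <= cabs (w - a).
  by have := cabs_sub w a; rewrite ws; lra.
have wa0 : w - a != 0 by rewrite -cabs_gt0; lra.
rewrite (_ : _ - _ = (w * (f 0 - f a) + a * (f w - f 0)) / (w * (w - a))); last first.
  by rewrite /q subr0; field; rewrite w0 wa0.
rewrite cabsM cabsV cabsM ws ler_pdivrMr; last by rewrite mulr_gt0//; lra.
apply: le_trans (cabsD _ _) _; rewrite !cabsM ws [cabs (f 0 - _)]cabsB.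
have h1 : cabs (f a - f 0) < e * s / 4 by apply: hd; rewrite subr0.
have h2 : cabs (f w - f 0) <= 2 * M.
  apply: le_trans (cabsD _ _) _; rewrite cabsN mulr_natl mulr2n.
  by apply: lerD; apply: hM; rewrite ?ws ?cabs0 ?lexx.
have h3 : cabs a * cabs (f w - f 0) <= e * s ^+ 2 / 4.
  apply: le_trans (ler_pM (cabs_ge0 _) (cabs_ge0 _) (ltW a3) h2) _.
  by rewrite le_eqVlt; apply/orP; left; apply/eqP; field; rewrite gt_eqF.
have h4 : s * cabs (f a - f 0) <= e * s ^+ 2 / 4.
  rewrite (_ : e * s ^+ 2 / 4 = s * (e * s / 4)); last by ring.
  by rewrite ler_pM2l// ltW.
apply: le_trans (lerD h4 h3) _.
rewrite (_ : e * s ^+ 2 / 4 + e * s ^+ 2 / 4 = e * (s * (s / 2))); last by field.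
by rewrite ler_pM2l// ler_pM2l.
Qed.

End MeanValue.

(** * Automorphisms of the disk *)

Section Moebius.
Variable R : realType.
Implicit Types (a z w : R[i]).

(** The automorphism of the disk that moves [a] to [0]; the modulus of [mob a z]
    is the pseudo-hyperbolic distance of [a] and [z]. *)
Definition mob a z : R[i] := (z - a) / (1 - a^*%C * z).

Lemma mob_den_ge a z : 1 - cabs a * cabs z <= cabs (1 - a^*%C * z).
Proof. by have := cabs_sub 1 (a^*%C * z); rewrite cabs1 cabsM cabs_conj. Qed.

Lemma mob_den_le a z : cabs (1 - a^*%C * z) <= 1 + cabs a * cabs z.
Proof. by have := cabsD 1 (- (a^*%C * z)); rewrite cabsN cabs1 cabsM cabs_conj. Qed.

Lemma cabsM_lt1 a z : cabs a < 1 -> cabs z <= 1 -> cabs a * cabs z < 1.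
Proof. by move=> a1 z1; have := cabs_ge0 a; have := cabs_ge0 z; nra. Qed.

Lemma mob_den_gt0 a z : cabs a < 1 -> cabs z <= 1 -> 0 < cabs (1 - a^*%C * z).
Proof.
by move=> a1 z1; have := mob_den_ge a z; have := cabsM_lt1 a1 z1; lra.
Qed.

Lemma mob_den_neq0 a z : cabs a < 1 -> cabs z <= 1 -> 1 - a^*%C * z != 0.
Proof. by move=> a1 z1; rewrite -cabs_gt0 mob_den_gt0. Qed.

Lemma mob_core a z : cabs (1 - a^*%C * z) ^+ 2 - cabs (z - a) ^+ 2 =
  (1 - cabs a ^+ 2) * (1 - cabs z ^+ 2).
Proof. by rewrite !sqr_cabs; case: a z => [p q] [x y] /=; ring. Qed.

Lemma mob_sq a z : cabs a < 1 -> cabs z <= 1 ->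
  1 - cabs (mob a z) ^+ 2 =
  (1 - cabs a ^+ 2) * (1 - cabs z ^+ 2) / cabs (1 - a^*%C * z) ^+ 2.
Proof.
move=> a1 z1; have d0 := mob_den_gt0 a1 z1.
by rewrite -mob_core /mob cabsM cabsV; field; rewrite gt_eqF.
Qed.

Lemma sqr_lt1 (x : R) : 0 <= x -> x < 1 -> 0 < 1 - x ^+ 2.
Proof. by move=> x0 x1; nra. Qed.

Lemma mob_disk a z : disk a -> disk z -> disk (mob a z).
Proof.
rewrite /disk /= => a1 z1; have d0 := mob_den_gt0 a1 (ltW z1).
have : 0 < 1 - cabs (mob a z) ^+ 2.
  rewrite mob_sq ?ltW// divr_gt0 ?exprn_gt0//.
  by rewrite mulr_gt0// sqr_lt1// cabs_ge0.
by have := cabs_ge0 (mob a z); nra.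
Qed.

Lemma mobxx a : mob a a = 0.
Proof. by rewrite /mob subrr mul0r. Qed.

Lemma mob0 a : mob a 0 = - a.
Proof. by rewrite /mob sub0r mulr0 subr0 divr1. Qed.

Lemma disk0 : disk (0 : R[i]).
Proof. by rewrite /disk /= cabs0. Qed.

Lemma diskN a : disk a -> disk (- a).
Proof. by rewrite /disk /= cabsN. Qed.

Lemma mulJc a : a^*%C * a = (cabs a ^+ 2)%:C.
Proof. by rewrite mulrC mulcJ. Qed.

Lemma mobK a z : disk a -> disk z -> mob (- a) (mob a z) = z.
Proof.
rewrite /disk /= => a1 z1; have d0 := mob_den_neq0 a1 (ltW z1).
have q0 : 1 - a^*%C * a != 0 := mob_den_neq0 a1 (ltW a1).
rewrite /mob rmorphN /= opprK.
rewrite (_ : (z - a) / (1 - a^*%C * z) + a = z * (1 - a^*%C * a) / (1 - a^*%C * z)).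
  rewrite (_ : 1 - - a^*%C * ((z - a) / (1 - a^*%C * z)) = (1 - a^*%C * a) / (1 - a^*%C * z)).
    by field; rewrite d0 q0.
  by field.
by field.
Qed.

Lemma mobNK a z : disk a -> disk z -> mob a (mob (- a) z) = z.
Proof. by move=> /diskN/mobK h /h; rewrite opprK. Qed.

Lemma cdiff_mob a z : disk a -> disk z ->
  cdiff (mob a) z ((1 - cabs a ^+ 2)%:C / (1 - a^*%C * z) ^+ 2).
Proof.
rewrite /disk /= => a1 z1; have d0 := mob_den_neq0 a1 (ltW z1).
have h1 := cdiffB (cdiff_id z) (cdiff_cst a z).
have h2 := cdiffB (cdiff_cst (1 : R[i]) z) (cdiffZ a^*%C (cdiff_id z)).
have := cdiffM h1 (cdiffV (f := fun w => 1 - a^*%C * w) d0 h2).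
congr cdiff.
by rewrite raddfB /= -mulJc rmorph1; field.
Qed.

Lemma mob_sym a z : cabs (mob a z) = cabs (mob z a).
Proof.
rewrite /mob !cabsM !cabsV [cabs (a - z)]cabsB; congr (_ / _).
by rewrite -cabs_conj rmorphB rmorph1 rmorphM /= conjcK mulrC.
Qed.

Lemma mob_ge a z : disk a -> disk z -> cabs (z - a) <= 2 * cabs (mob a z).
Proof.
rewrite /disk /= => a1 z1; rewrite /mob cabsM cabsV mulrCA ler_peMr ?cabs_ge0//.
rewrite ler_pdivlMr ?mob_den_gt0 ?(ltW z1)// mul1r.
by apply: le_trans (mob_den_le a z) _; have := cabsM_lt1 a1 (ltW z1); lra.
Qed.

Lemma mob_le a z : disk a -> disk z -> cabs (mob a z) <= cabs (z - a) / (1 - cabs a).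
Proof.
rewrite /disk /= => a1 z1; rewrite /mob cabsM cabsV ler_wpM2l ?cabs_ge0//.
rewrite lef_pV2 ?posrE ?mob_den_gt0 ?subr_gt0 ?(ltW z1)//.
apply: le_trans (mob_den_ge a z); rewrite lerD2l lerN2.
by have := cabs_ge0 a; nra.
Qed.

End Moebius.

(** * The Schwarz lemma *)

Section Schwarz.
Variable R : realType.
Implicit Types (a z w : R[i]) (f g h q : R[i] -> R[i]) (M : R).
Local Notation D := (@disk R).
Local Notation hol := (holomorphic_on D).

Lemma hol_cont f z : hol f -> D z -> {for z, continuous f}.
Proof. by move=> hf /hf /derivable_cont. Qed.

Lemma hol_comp_mob f a : D a -> hol f -> hol (fun z => f (mob a z)).
Proof.
move=> Da hf z Dz; have dm := cdiff_mob Da Dz.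
exact: cdiff_derivable (cdiff_comp dm (derivable_cdiff (hf _ (mob_disk Da Dz)))).
Qed.

Lemma hol_mob_comp f a : D a -> hol f -> (forall z, D z -> D (f z)) ->
  hol (fun z => mob a (f z)).
Proof.
move=> Da hf Df z Dz; have dm := cdiff_mob Da (Df _ Dz).
exact: cdiff_derivable (cdiff_comp (derivable_cdiff (hf _ Dz)) dm).
Qed.

(** The automorphism extends continuously to the unit circle, which it
    preserves. *)
Lemma mob_near_circle a (s : R) : D a -> 0 <= s < 1 -> exists r : R, 0 < r < 1 /\
  forall w, cabs w = r -> s < cabs (mob a w) < 1.
Proof.
rewrite /disk /= => a1 /andP[s0 s1]; have a0 := cabs_ge0 a.
have ds := sqr_lt1 s0 s1.
(* by [mob_sq], [1 - |mob a w| ^ 2 <= (1 - r ^ 2) / (1 - |a|) ^ 2]; take [1 - r ^ 2 = k] *)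
pose k := (1 - s ^+ 2) * (1 - cabs a) ^+ 2 / 2.
have qa : 0 < (1 - cabs a) ^+ 2 by rewrite exprn_gt0// subr_gt0.
have qa1 : (1 - cabs a) ^+ 2 <= 1 by nra.
have k0 : 0 < k by rewrite divr_gt0// mulr_gt0.
have k1 : k < 1 by rewrite /k; nra.
have r2 : Num.sqrt (1 - k) ^+ 2 = 1 - k by rewrite sqr_sqrtr//; lra.
have r0 : 0 < Num.sqrt (1 - k) by rewrite sqrtr_gt0; lra.
have r1 : Num.sqrt (1 - k) < 1 by nra.
exists (Num.sqrt (1 - k)); split; first by rewrite r0.
move=> w wr; have w1 : cabs w < 1 by rewrite wr.
have m1 : cabs (mob a w) < 1 := mob_disk (a := a) (z := w) a1 w1.
rewrite m1 andbT ltNge; apply/negP => ms.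
have := mob_sq a1 (ltW w1); rewrite wr r2.
have dg : 1 - cabs a <= cabs (1 - a^*%C * w).
  apply: le_trans (mob_den_ge a w); rewrite lerD2l lerN2; nra.
have dg2 : (1 - cabs a) ^+ 2 <= cabs (1 - a^*%C * w) ^+ 2.
  by rewrite ler_pXn2r ?nnegrE ?cabs_ge0//; lra.
move=> e; have : 1 - s ^+ 2 <= 1 - cabs (mob a w) ^+ 2.
  by rewrite lerD2l lerN2 ler_pXn2r ?nnegrE ?cabs_ge0.
rewrite e ler_pdivlMr; last by apply: lt_le_trans dg2.
have : (1 - cabs a ^+ 2) * (1 - (1 - k)) <= k by nra.
have : (1 - s ^+ 2) * (1 - cabs a) ^+ 2 = 2 * k by rewrite /k; field.
by nra.
Qed.

(** An automorphism moves the given point to the centre, where the mean value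
    property applies on circles close to the boundary. *)
Lemma max_principle q M : hol q ->
  (forall e : R, 0 < e -> exists2 s : R, s < 1 &
      forall z, s < cabs z < 1 -> cabs (q z) <= M + e) ->
  forall z, D z -> cabs (q z) <= M.
Proof.
move=> hq bd a Da; apply/ler_addgt0Pr => e e0.
have [s s1 hs] := bd _ e0.
have s01 : 0 <= Num.max s 0 < 1 by rewrite le_max lexx orbT gt_max s1 ltr01.
have [r [/andP[r0 r1] hr]] := mob_near_circle (diskN Da) s01.
pose h z := q (mob (- a) z).
have hh : hol h := hol_comp_mob (diskN Da) hq.
have -> : q a = h 0 by rewrite /h mob0 opprK.
apply: (mean_bound r0) => z.
- by move=> zr; apply: hol_cont hh _; exact: le_lt_trans r1.
- by move=> /andP[_ zr]; apply: hh; exact: lt_trans r1.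
- move=> zr; apply: hs; have /andP[h1 ->] := hr z zr.
  by rewrite andbT (le_lt_trans _ h1)// le_max lexx.
Qed.

Lemma hol_quot0 f L : hol f -> L = derive1 f 0 -> hol (quot f 0 L).
Proof.
move=> hf -> z Dz; have d0 := derivable_cdiff (hf 0 (disk0 R)).
have off w : w != 0 -> D w -> derivable (quot f 0 (derive1 f 0)) w 1.
  by move=> w0 Dw; apply: cdiff_quot_off w0 (hf w Dw).
have [->|z0] := eqVneq z 0; last exact: off.
apply: (removable0 ltr01).
- move=> w w1; have [->|w0] := eqVneq w 0; first exact/cdiff_quot.
  by apply: derivable_cont; exact: off.
- by move=> w /andP[w0 w1]; apply: off => //; rewrite -cabs_gt0.
Qed.

(** Near the boundary [f z / z] is at most [M / |z|]. *)
Lemma schwarz_quot f M : hol f -> f 0 = 0 -> (forall z, D z -> cabs (f z) <= M) ->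
  forall z, D z -> cabs (quot f 0 (derive1 f 0) z) <= M.
Proof.
move=> hf f0 fM; have M0 : 0 <= M by have := fM 0 (disk0 R); rewrite f0 cabs0.
apply: max_principle; first exact: hol_quot0.
move=> e e0; exists (M / (M + e)); first by rewrite ltr_pdivrMr; lra.
move=> z /andP[z1 z2].
have z0 : 0 < cabs z by apply: le_lt_trans z1; rewrite divr_ge0//; lra.
have zn : z != 0 by rewrite -cabs_gt0.
rewrite /quot (negbTE zn) f0 !subr0 cabsM cabsV ler_pdivrMr//.
apply: le_trans (fM z z2) _.
by move: z1; rewrite ltr_pdivrMr; [rewrite mulrC => /ltW|lra].
Qed.

Lemma schwarz f : hol f -> f 0 = 0 -> (forall z, D z -> cabs (f z) <= 1) ->
  (forall z, D z -> cabs (f z) <= cabs z) /\ cabs (derive1 f 0) <= 1.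
Proof.
move=> hf f0 f1; have h := schwarz_quot hf f0 f1; split.
- move=> z Dz; have := quotE f 0 (derive1 f 0) z; rewrite f0 !subr0 => ->.
  by rewrite cabsM ler_piMl ?cabs_ge0// h.
- by have := h 0 (disk0 R); rewrite quot_diag.
Qed.

(** Conjugation by automorphisms moves both [a] and [f a] to the centre, where
    the Schwarz lemma applies. *)
Definition recenter f a z := mob (f a) (f (mob (- a) z)).

Section Recenter.
Variables (f : R[i] -> R[i]) (a : R[i]).
Hypotheses (hf : hol f) (fD : forall z, D z -> D (f z)) (Da : D a).

Lemma recenter_disk z : D z -> D (recenter f a z).
Proof. by move=> Dz; apply: mob_disk; [exact: fD|apply/fD/mob_disk => //; exact: diskN]. Qed.

Lemma recenter_hol : hol (recenter f a).
Proof.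
apply: hol_mob_comp; [exact: fD|exact: hol_comp_mob (diskN Da) hf|].
by move=> z Dz; apply/fD/mob_disk => //; exact: diskN.
Qed.

Lemma recenter0 : recenter f a 0 = 0.
Proof. by rewrite /recenter mob0 opprK mobxx. Qed.

Lemma recenter_mob z : D z -> recenter f a (mob a z) = mob (f a) (f z).
Proof. by move=> Dz; rewrite /recenter mobK. Qed.

Lemma cabs_1Mcabs2 (b : R[i]) : D b -> cabs (1 - (cabs b ^+ 2)%:C) = 1 - cabs b ^+ 2.
Proof.
move=> b1; rewrite -(rmorph1 (real_complex R)) -rmorphB cabs_rC ger0_norm//.
by apply/ltW/sqr_lt1; rewrite ?cabs_ge0.
Qed.

Lemma recenter_derive : cabs (derive1 (recenter f a) 0) =
  lambda_disk (f a) * cabs (derive1 f a) / lambda_disk a.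
Proof.
have Dfa := fD Da.
have m0 : mob (- a) 0 = a by rewrite mob0 opprK.
have h1 := cdiff_mob (diskN Da) (disk0 R).
have h2 : cdiff f (mob (- a) 0) (derive1 f a) by rewrite m0; exact/derivable_cdiff/hf.
have h3 : cdiff (mob (f a)) (f (mob (- a) 0))
   ((1 - cabs (f a) ^+ 2)%:C / (1 - (f a)^*%C * f a) ^+ 2).
  by rewrite m0; exact: cdiff_mob.
have := cdiff_comp (cdiff_comp h1 h2) h3 => /cdiff_derive1.
rewrite -/(recenter f a) => ->.
have qa : 0 < 1 - cabs a ^+ 2 by apply: sqr_lt1 (cabs_ge0 a) Da.
have qf : 0 < 1 - cabs (f a) ^+ 2 by apply: sqr_lt1 (cabs_ge0 _) Dfa.
rewrite mulr0 subr0 expr1n divr1 cabsN mulJc !cabsM cabsV cabsX !cabs_rC cabs_1Mcabs2//.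
rewrite !ger0_norm ?ltW// /lambda_disk invrK.
by field; rewrite gt_eqF.
Qed.

End Recenter.

Lemma schwarz_pick f z w : hol f -> (forall z, D z -> D (f z)) -> D z -> D w ->
  cabs (mob (f w) (f z)) <= cabs (mob w z).
Proof.
move=> hf fD Dz Dw; rewrite -(recenter_mob f Dw Dz).
apply: (schwarz (recenter_hol hf fD Dw) (recenter0 f w) _).1; last exact: mob_disk.
by move=> u Du; apply/ltW; exact: recenter_disk.
Qed.

Lemma lambda_disk_gt0 z : D z -> 0 < lambda_disk z.
Proof. by move=> Dz; rewrite invr_gt0; apply: sqr_lt1 (cabs_ge0 z) Dz. Qed.

Lemma schwarz_pick_density f z : hol f -> (forall z, D z -> D (f z)) -> D z ->
  lambda_disk (f z) * cabs (derive1 f z) <= lambda_disk z.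
Proof.
move=> hf fD Dz.
have h : cabs (derive1 (recenter f z) 0) <= 1.
  apply: (schwarz (recenter_hol hf fD Dz) (recenter0 f z) _).2.
  by move=> u Du; apply/ltW; exact: recenter_disk.
rewrite (recenter_derive hf fD Dz) in h.
by move: h; rewrite ler_pdivrMr ?mul1r//; exact: lambda_disk_gt0.
Qed.

(** With [q = f z / z], Schwarz-Pick compares [r q] with its value [r] at the
    centre; when [r] tends to [1] this becomes [|q - 1| <= |z| |q - 1|]. *)
Lemma schwarz_rigid f : hol f -> (forall z, D z -> D (f z)) -> f 0 = 0 ->
  derive1 f 0 = 1 -> forall z, D z -> f z = z.
Proof.
move=> hf fD f0 f1 z Dz.
have hq : hol (quot f 0 1) := hol_quot0 hf (esym f1).
have q1 w : D w -> cabs (quot f 0 1 w) <= 1.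
  move=> Dw; rewrite -f1; apply: (schwarz_quot hf f0) => // u /fD; exact: ltW.
set Q := quot f 0 1 z.
suff Q1 : Q = 1.
  by have := quotE f 0 1 z; rewrite f0 !subr0 -/Q Q1 mul1r.
have key (r : R) : 0 < r < 1 -> r * cabs (Q - 1) <= cabs z * cabs (1 - (r ^+ 2)%:C * Q).
  move=> /andP[r0 r1].
  have hr : hol (fun w => r%:C * quot f 0 1 w).
    by move=> w /hq/derivable_cdiff/(cdiffZ r%:C)/cdiff_derivable.
  have rD w : D w -> D (r%:C * quot f 0 1 w).
    move=> /q1 h; rewrite /disk /= cabsM cabs_rC gtr0_norm//.
    by have := cabs_ge0 (quot f 0 1 w); nra.
  have := schwarz_pick hr rD Dz (disk0 R).
  rewrite quot_diag mulr1 -/Q {2}/mob subr0 rmorph0 mul0r subr0 divr1.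
  rewrite /mob conjc_real cabsM cabsV ler_pdivrMr; last first.
    have := @mob_den_gt0 _ r%:C (r%:C * Q); rewrite conjc_real cabs_rC gtr0_norm//.
    by apply => //; apply/ltW; exact: rD.
  rewrite -[X in r%:C * Q - X]mulr1 -mulrBr cabsM cabs_rC gtr0_norm//.
  by rewrite mulrA -rmorphM -expr2.
have z1 : cabs z < 1 := Dz.
have lim : cabs (Q - 1) <= cabs z * cabs (Q - 1).
  apply/ler_addgt0Pr => e e0.
  pose r : R := 1 - Num.min (e / 8) (1 / 2).
  have m1 : Num.min (e / 8) (1 / 2) <= e / 8 by rewrite ge_min lexx.
  have m2 : Num.min (e / 8) (1 / 2) <= 1 / 2 by rewrite ge_min lexx orbT.
  have m3 : 0 < Num.min (e / 8) (1 / 2) by rewrite lt_min; apply/andP; split; lra.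
  have r01 : 0 < r < 1 by apply/andP; rewrite /r; split; lra.
  have := key r r01.
  have hQ : cabs Q <= 1 := q1 z Dz.
  have hc : cabs (1 - (r ^+ 2)%:C * Q) <= cabs (Q - 1) + 2 * (1 - r).
    rewrite (_ : 1 - _ = - (Q - 1) + (1 - r ^+ 2)%:C * Q); last first.
      by rewrite rmorphB rmorph1; ring.
    apply: le_trans (cabsD _ _) _; rewrite cabsN lerD2l cabsM cabs_rC.
    case/andP: r01 => r0 r1; have r2 : 0 <= 1 - r ^+ 2 by nra.
    rewrite ger0_norm//; apply: (@le_trans _ _ (1 - r ^+ 2)); last by nra.
    by rewrite ler_piMr.
  have hQ1 : cabs (Q - 1) <= 2.
    by apply: le_trans (cabsD _ _) _; rewrite cabsN cabs1; lra.
  have hz := cabs_ge0 z; have hQ0 := cabs_ge0 (Q - 1).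
  have hr : 1 - r <= e / 8 by rewrite /r; lra.
  case/andP: r01 => r0 r1.
  move: hc hQ1 hQ0; move: (cabs (Q - 1)) (cabs (1 - _)) => u v; nra.
have Q0 : cabs (Q - 1) = 0.
  by apply/eqP; rewrite eq_le cabs_ge0 andbT; have := cabs_ge0 (Q - 1); nra.
by apply/eqP; rewrite -subr_eq0 -cabs_eq0 Q0.
Qed.

(** Schwarz-Pick for the difference quotient at the centre. The constant is the
    same for all self-maps of the disk, which makes this estimate a substitute
    for the Cauchy estimates. *)
Lemma taylor_disk f z : hol f -> (forall z, D z -> D (f z)) -> D z ->
  cabs (f z - f 0 - derive1 f 0 * z) <= 6 * cabs z ^+ 2.
Proof.
move=> hf fD Dz; set L := derive1 f 0.
pose g w := f w - f 0.
have dg w : D w -> cdiff g w (derive1 f w - 0).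
  by move=> Dw; apply: cdiffB; [exact/derivable_cdiff/hf|exact: cdiff_cst].
have hg : hol g by move=> w /dg/cdiff_derivable.
have g0 : g 0 = 0 by rewrite /g subrr.
have gL : derive1 g 0 = L by rewrite (cdiff_derive1 (dg 0 (disk0 R))) subr0.
have g2 w : D w -> cabs (g w) <= 2.
  move=> Dw; apply: le_trans (cabsD _ _) _; rewrite cabsN.
  by have := fD w Dw; have := fD 0 (disk0 R); rewrite /disk /=; lra.
have hq : hol (quot g 0 L) := hol_quot0 hg (esym gL).
have q2 w : D w -> cabs (quot g 0 L w) <= 2 by rewrite -gL; exact: schwarz_quot.
(* the quotient is bounded by 2, so a third of it maps into the open disk *)
have hq3 : hol (fun w => 3^-1 * quot g 0 L w).
  by move=> w /hq/derivable_cdiff/(cdiffZ 3^-1)/cdiff_derivable.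
have c3 : cabs (3^-1 : R[i]) = 3^-1.
  rewrite cabsV (_ : 3 = (3 : R)%:C) ?cabs_rC ?ger0_norm//.
  by rewrite rmorph_nat.
have q3 w : D w -> D (3^-1 * quot g 0 L w).
  by move=> /q2 h; rewrite /disk /= cabsM c3; lra.
have := schwarz_pick hq3 q3 Dz (disk0 R).
rewrite {2}/mob subr0 rmorph0 mul0r subr0 divr1 => h1.
have h2 := mob_ge (q3 0 (disk0 R)) (q3 z Dz).
rewrite -mulrBr cabsM c3 in h2; rewrite quot_diag in h1 h2.
rewrite (_ : f z - f 0 - L * z = (quot g 0 L z - L) * z); last first.
  by rewrite mulrBl -[X in quot _ _ _ _ * X]subr0 -quotE g0 subr0.
rewrite cabsM expr2 mulrA ler_wpM2r ?cabs_ge0//.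
lra.
Qed.

End Schwarz.

(** * Estimates for functions into the disk *)

Section LocalEstimates.
Variable R : realType.
Implicit Types (a z w : R[i]) (f g h q : R[i] -> R[i]) (M r : R).
Local Notation D := (@disk R).
Local Notation hol := (holomorphic_on D).

Lemma cabs_nat n : cabs (n%:R : R[i]) = n%:R.
Proof. by rewrite -(rmorph_nat (real_complex R)) cabs_rC ger0_norm. Qed.

Definition open_disk a r : set R[i] := [set z | cabs (z - a) < r].

Definition hol_into_disk f a r := forall z, open_disk a r z -> derivable f z 1 /\ D (f z).

Lemma hol_into_disk_sub f a r b s : cabs (b - a) + s <= r -> hol_into_disk f a r -> hol_into_disk f b s.
Proof.
move=> bs h z zb; apply: h; rewrite /open_disk /=.
by apply: le_lt_trans (cabs_tri z b a) _; move: zb; rewrite /open_disk /=; lra.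
Qed.

Section Blowup.
Variables (f : R[i] -> R[i]) (a : R[i]) (r : R).
Hypotheses (r0 : 0 < r) (hf : hol_into_disk f a r).

Let g u := f (a + r%:C * u).

Let inb u : D u -> open_disk a r (a + r%:C * u).
Proof.
rewrite /disk /open_disk /= => u1; rewrite addrC addKr cabsM cabs_rC gtr0_norm//.
by rewrite gtr_pMr.
Qed.

Let dg u : D u -> cdiff g u (derive1 f (a + r%:C * u) * r%:C).
Proof.
move=> Du; have [d _] := hf (inb Du).
have h1 : cdiff (fun u : R[i] => a + r%:C * u) u (0 + r%:C * 1).
  by apply: cdiffD; [exact: cdiff_cst|apply/cdiffZ/cdiff_id].
have := cdiff_comp h1 (derivable_cdiff d).
by rewrite add0r mulr1.
Qed.

Let hg : hol g. Proof. by move=> u /dg/cdiff_derivable. Qed.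
Let gD u : D u -> D (g u). Proof. by move=> /inb/hf[]. Qed.

Let g0 : g 0 = f a. Proof. by rewrite /g mulr0 addr0. Qed.

Let scale z : a + r%:C * ((z - a) / r%:C) = z.
Proof. by rewrite mulrCA mulfV ?mulr1 ?subrKC// -cabs_gt0 cabs_rC gtr0_norm. Qed.

Let cabs_scale z : cabs ((z - a) / r%:C) = cabs (z - a) / r.
Proof. by rewrite cabsM cabsV cabs_rC gtr0_norm. Qed.

Let scaleD z : open_disk a r z -> D ((z - a) / r%:C).
Proof. by rewrite /disk /open_disk /= cabs_scale ltr_pdivrMr// mul1r. Qed.

Lemma schwarz_pick_ball z : open_disk a r z -> cabs (mob (f a) (f z)) <= cabs (z - a) / r.
Proof.
move=> /scaleD Dz; have := schwarz_pick hg gD Dz (disk0 R).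
rewrite g0 /g scale -cabs_scale.
by rewrite {2}/mob subr0 rmorph0 mul0r subr0 divr1.
Qed.

Lemma density_ball : lambda_disk (f a) * cabs (derive1 f a) <= r^-1.
Proof.
have := schwarz_pick_density hg gD (disk0 R).
have e : derive1 g 0 = derive1 f a * r%:C.
  by rewrite (cdiff_derive1 (dg (disk0 R))) mulr0 addr0.
rewrite e g0 cabsM cabs_rC gtr0_norm// /lambda_disk cabs0 expr0n subr0 invr1.
by rewrite mulrA -[X in _ -> _ <= X]div1r ler_pdivlMr.
Qed.

Lemma derive_ball : cabs (derive1 f a) <= r^-1.
Proof.
apply: le_trans density_ball; rewrite ler_peMl ?cabs_ge0// /lambda_disk.
have Dfa : D (f a) by rewrite -g0; apply: gD; exact: disk0.
have := sqr_lt1 (cabs_ge0 (f a)) Dfa => h.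
by rewrite invf_ge1// gerBl sqr_ge0.
Qed.

Lemma taylor_ball z : open_disk a r z ->
  cabs (f z - f a - derive1 f a * (z - a)) <= 6 / r ^+ 2 * cabs (z - a) ^+ 2.
Proof.
move=> /scaleD Dz; have := taylor_disk hg gD Dz.
have e : derive1 g 0 = derive1 f a * r%:C.
  by rewrite (cdiff_derive1 (dg (disk0 R))) mulr0 addr0.
rewrite e g0 {1}/g scale cabs_scale -mulrA [r%:C * _]mulrCA mulfV.
  by rewrite mulr1 expr_div_n mulrA mulrAC.
by rewrite -cabs_gt0 cabs_rC gtr0_norm.
Qed.

End Blowup.

(** Taylor expansions at [a] and at [w], evaluated at [w] and at [2 w - a]:
    the values of [f] cancel. *)
Lemma derive_lip f a w r : 0 < r -> hol_into_disk f a r -> cabs (w - a) < r / 4 ->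
  cabs (derive1 f w - derive1 f a) <= 54 / r ^+ 2 * cabs (w - a).
Proof.
move=> r0 hf wa.
have [->|wna] := eqVneq w a; first by rewrite !subrr cabs0 mulr0.
have c0 : 0 < cabs (w - a) by rewrite cabs_gt0 subr_eq0.
have r20 : 0 < r / 2 by rewrite divr_gt0.
have hw : hol_into_disk f w (r / 2) by apply: hol_into_disk_sub hf; lra.
pose v := w + (w - a).
have vw : v - w = w - a by rewrite /v; ring.
have va : v - a = 2 * (w - a) by rewrite /v; ring.
have c2 : cabs (v - a) = 2 * cabs (w - a).
  by rewrite va cabsM cabs_nat.
have b1 : cabs (w - a) < r / 2 by lra.
have b2 : 2 * cabs (w - a) < r by lra.
have b3 : cabs (w - a) < r by lra.
have t1 := taylor_ball r20 hw (z := v).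
have t2 := taylor_ball r0 hf (z := v).
have t3 := taylor_ball r0 hf (z := w).
rewrite /open_disk /= vw in t1; rewrite /open_disk /= c2 va in t2; rewrite /open_disk /= in t3.
have {}t1 := t1 b1; have {}t2 := t2 b2; have {}t3 := t3 b3.
rewrite -(ler_pM2r c0) -cabsM.
have split3 (A B x y s t : R[i]) : (B - A) * t =
  (x - s - A * (2 * t)) - (y - s - A * t) - (x - y - B * t) by ring.
rewrite (split3 _ _ (f v) (f w) (f a)).
apply: le_trans (cabsD _ _) _; rewrite cabsN.
apply: le_trans (lerD (cabsD _ _) (lexx _)) _; rewrite cabsN.
(* 6 * 4 + 6 + 6 * 4: the increment doubles at [v], the radius is halved at [w] *)
apply: le_trans (lerD (lerD t2 t3) t1) _.
by rewrite le_eqVlt; apply/orP; left; apply/eqP; field; rewrite gt_eqF.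
Qed.

Lemma strict_diff f a r e : 0 < r -> hol_into_disk f a r -> 0 < e -> exists2 d : R, 0 < d &
  forall z w, cabs (z - a) < d -> cabs (w - a) < d ->
    cabs (f z - f w - derive1 f a * (z - w)) <= e * cabs (z - w).
Proof.
move=> r0 hf e0; pose C := 100 / r ^+ 2.
have C0 : 0 < C by rewrite divr_gt0// exprn_gt0.
exists (Num.min (r / 8) (e / (4 * C))).
  by rewrite lt_min !divr_gt0// mulr_gt0.
move=> z w; rewrite !lt_min => /andP[z1 z2] /andP[w1 w2].
have r20 : 0 < r / 2 by rewrite divr_gt0.
have hw : hol_into_disk f w (r / 2) by apply: hol_into_disk_sub hf; lra.
have zw : cabs (z - w) <= cabs (z - a) + cabs (w - a).
  by rewrite [cabs (w - a)]cabsB; exact: cabs_tri.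
have b1 : cabs (z - w) < r / 2 by lra.
have t1 := taylor_ball r20 hw b1.
have t2 : cabs (derive1 f w - derive1 f a) <= 54 / r ^+ 2 * cabs (w - a).
  by apply: derive_lip => //; lra.
have split2 (A B x y t : R[i]) : x - y - A * t = (x - y - B * t) + (B - A) * t by ring.
rewrite (split2 _ (derive1 f w)).
apply: le_trans (cabsD _ _) _; rewrite cabsM.
have n0 := cabs_ge0 (z - w).
have k1 : cabs (f z - f w - derive1 f w * (z - w)) <= C * cabs (z - w) * cabs (z - w).
  apply: le_trans t1 _; rewrite [cabs (z - w) ^+ 2]expr2 mulrA ler_wpM2r// ler_wpM2r//.
  rewrite /C (_ : 6 / (r / 2) ^+ 2 = 24 / r ^+ 2); last by field; rewrite gt_eqF.
  by rewrite ler_pM2r ?invr_gt0 ?exprn_gt0//; lra.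
have k2 : cabs (derive1 f w - derive1 f a) * cabs (z - w) <= C * cabs (w - a) * cabs (z - w).
  apply: ler_wpM2r => //; apply: le_trans t2 _; rewrite ler_wpM2r ?cabs_ge0// /C.
  by rewrite ler_pM2r ?invr_gt0 ?exprn_gt0//; lra.
apply: le_trans (lerD k1 k2) _; rewrite -mulrDl ler_wpM2r// -mulrDr.
rewrite mulrC -ler_pdivlMr//.
have : e / (4 * C) * 3 <= e / C.
  have q0 : 0 < e / C by rewrite divr_gt0.
  rewrite (_ : e / (4 * C) = e / C / 4); first by lra.
  by field; rewrite gt_eqF.
lra.
Qed.

End LocalEstimates.

(** * Limits of holomorphic functions *)

Section UltrafilterLimits.
Variable R : realType.
Implicit Types (a z w : R[i]) (r M : R).
Local Notation D := (@disk R).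

Lemma lim_cabs_le T (F : set_system T) (FF : ProperFilter F) (u : T -> R[i]) l M :
  u @ F --> l -> (\forall t \near F, cabs (u t) <= M) -> cabs l <= M.
Proof.
move=> /cvg_cabsP ul uM; apply/ler_addgt0Pr => e e0.
near F => t.
have h1 : cabs (u t - l) < e by near: t; exact: ul.
have h2 : cabs (u t) <= M by near: t.
by have := cabs_sub l (u t); rewrite cabsB; lra.
Unshelve. all: by end_near.
Qed.

Lemma ultra_lim T (F : set_system T) (FU : UltraFilter F) (u : T -> R[i]) M :
  (\forall t \near F, cabs (u t) <= M) -> exists2 l, cabs l <= M & u @ F --> l.
Proof.
move=> uM; have cK := @compact_closed_disk R M.
have [l [lM cl]] := cK (u @ F) _ uM.
exists l => //; move=> B Bl.
have [//|nB] := in_ultra_setVsetC (u @^-1` B) FU.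
have [w [/= w1 w2]] := cl (~` B) B nB Bl.
by case: w1.
Qed.

(** The uniform remainder estimate [taylor_ball] survives pointwise limits. *)
Lemma limit_hol T (F : set_system T) (FU : UltraFilter F) (f : T -> R[i] -> R[i])
    (g : R[i] -> R[i]) a r : 0 < r -> (\forall t \near F, hol_into_disk (f t) a r) ->
  (forall z, open_disk a r z -> f t z @[t --> F] --> g z) ->
  cdiff g a (derive1 g a) /\ derive1 (f t) a @[t --> F] --> derive1 g a.
Proof.
move=> r0 hf fg.
have [L _ hL] : exists2 L, cabs L <= r^-1 & derive1 (f t) a @[t --> F] --> L.
  by apply: ultra_lim; apply: filterS hf => t /(derive_ball r0).
have a0 : open_disk a r a by rewrite /open_disk /= subrr cabs0.
suff dg : cdiff g a L by rewrite (cdiff_derive1 dg).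
have key z : open_disk a r z -> cabs (g z - g a - L * (z - a)) <= 6 / r ^+ 2 * cabs (z - a) ^+ 2.
  move=> az; apply: (@lim_cabs_le _ F _ (fun t => f t z - f t a - derive1 (f t) a * (z - a))).
    apply: cvgB; first by apply: cvgB; exact: fg.
    by apply: cvgM; [exact: hL|exact: cvg_cst].
  by apply: filterS hf => t /(taylor_ball r0)/(_ _ az).
move=> e e0; pose C := 6 / r ^+ 2.
have C0 : 0 < C by rewrite divr_gt0// exprn_gt0.
exists (Num.min r (e / C)); first by rewrite lt_min r0 divr_gt0.
move=> z; rewrite lt_min => /andP[z1 z2].
apply: le_trans (key z z1) _; rewrite expr2 mulrA ler_wpM2r ?cabs_ge0//.
by rewrite mulrC -ler_pdivlMr// ltW.
Qed.

(** In the limit [|l - m| <= M |1 - m^* l|], whereas these two moduli would be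
    equal if [|l| = 1]. *)
Lemma limit_in_disk T (F : set_system T) (FF : ProperFilter F) (u v : T -> R[i]) l m M :
  u @ F --> l -> v @ F --> m -> D m -> cabs l <= 1 -> M < 1 ->
  (\forall t \near F, D (u t) /\ D (v t) /\ cabs (mob (v t) (u t)) <= M) ->
  D l /\ cabs (mob m l) <= M.
Proof.
move=> ul vm Dm l1 M1 h.
have [t0 [_ [_ hM]]] := filter_ex h.
have M0 := le_trans (cabs_ge0 _) hM.
have cv : (v t)^*%C @[t --> F] --> m^*%C.
  move: vm => /cvg_cabsP vm; apply/cvg_cabsP => e /vm; apply: filterS => t.
  by move=> h'; rewrite (_ : (v t)^*%C - m^*%C = (v t - m)^*%C) ?cabs_conj// rmorphB.
have key : cabs (l - m) <= M * cabs (1 - m^*%C * l).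
  apply/ler_addgt0Pr => e e0.
  have c1 : u t - v t @[t --> F] --> l - m by exact: (cvgB ul vm).
  have c2 : 1 - (v t)^*%C * u t @[t --> F] --> 1 - m^*%C * l.
    have c0 : (v t)^*%C * u t @[t --> F] --> m^*%C * l by exact: (cvgM cv ul).
    by apply: (cvgB _ c0); exact: cvg_cst.
  have e20 : 0 < e / 2 by rewrite divr_gt0.
  near F => t.
  have [Du [Dv hm]] : D (u t) /\ D (v t) /\ cabs (mob (v t) (u t)) <= M by near: t.
  have h1 : cabs (u t - v t - (l - m)) < e / 2 by near: t; move/cvg_cabsP: c1; apply.
  have h2 : cabs (1 - (v t)^*%C * u t - (1 - m^*%C * l)) < e / 2.
    by near: t; move/cvg_cabsP: c2; apply.
  have hm' : cabs (u t - v t) <= M * cabs (1 - (v t)^*%C * u t).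
    move: hm; rewrite /mob cabsM cabsV ler_pdivrMr//.
    by apply: mob_den_gt0 => //; exact: ltW.
  have k1 := cabs_sub (l - m) (u t - v t); rewrite [X in _ <= X]cabsB in k1.
  have k2 := cabs_sub (1 - (v t)^*%C * u t) (1 - m^*%C * l).
  have k3 : M * cabs (1 - (v t)^*%C * u t) <= M * cabs (1 - m^*%C * l) + e / 2 by nra.
  lra.
have dn0 := mob_den_gt0 Dm l1.
have Dl : D l.
  rewrite /disk /= lt_neqAle l1 andbT; apply/eqP => l1'.
  have := mob_core m l; rewrite l1' expr1n subrr mulr0 => /eqP.
  rewrite subr_eq0 eqf_sqr => /orP[/eqP e|/eqP e].
    by move: key; rewrite -e; nra.
  by have := cabs_ge0 (l - m); rewrite -[cabs (l - m)]opprK -e; lra.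
by split=> //; rewrite /mob cabsM cabsV ler_pdivrMr.
Unshelve. all: by end_near.
Qed.

End UltrafilterLimits.

(** * Zeros and openness *)

Section ZerosAndOpenness.
Variable R : realType.
Implicit Types (a z w : R[i]) (f g h q k : R[i] -> R[i]) (M r : R).
Local Notation D := (@disk R).
Local Notation hol := (holomorphic_on D).

Lemma divide_zero f a : hol f -> (forall z, D z -> cabs (f z) <= 1) -> D a ->
  f a = 0 -> exists g, [/\ hol g, forall z, D z -> cabs (g z) <= 1 &
     forall z, D z -> f z = mob a z * g z].
Proof.
move=> hf f1 Da fa; have DNa := diskN Da.
pose h z := f (mob (- a) z).
have hh : hol h := hol_comp_mob DNa hf.
have h0 : h 0 = 0 by rewrite /h mob0 opprK.
have h1 z : D z -> cabs (h z) <= 1 by move=> Dz; apply/f1/mob_disk.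
exists (fun z => quot h 0 (derive1 h 0) (mob a z)); split.
- exact: hol_comp_mob Da (hol_quot0 hh erefl).
- by move=> z Dz; apply: (schwarz_quot hh h0 h1); exact: mob_disk.
- move=> z Dz; have := quotE h 0 (derive1 h 0) (mob a z).
  by rewrite h0 !subr0 mulrC => <-; rewrite /h mobK.
Qed.

(** The zeros are divided out one after the other, and each of them contributes
    a factor of modulus at most [c]. *)
Lemma many_zeros f (s : seq R[i]) (c : R) z : hol f -> (forall z, D z -> cabs (f z) <= 1) ->
  D z -> uniq s -> (forall a, a \in s -> [/\ D a, f a = 0 & cabs (mob a z) <= c]) ->
  cabs (f z) <= c ^+ size s.
Proof.
move=> + + Dz; elim: s f => [|a s IH] f hf f1 /=; first by move=> _ _; exact: f1.
move=> /andP[an us] hs; have [Da fa ca] := hs a (mem_head _ _).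
have [g [hg g1 fg]] := divide_zero hf f1 Da fa.
have := IH g hg g1 us => hgz.
rewrite (fg z Dz) cabsM exprS; apply: ler_pM; rewrite ?cabs_ge0//.
apply: hgz => b bs; have [Db fb cb] := hs b (@mem_behead _ (a :: s) b bs).
split=> //; move: fb; rewrite (fg b Db) => /eqP; rewrite mulf_eq0 => /orP[|/eqP//].
rewrite /mob mulf_eq0 invr_eq0 (negbTE (mob_den_neq0 Da (ltW Db))) orbF subr_eq0 => /eqP ba.
by move: an; rewrite -ba bs.
Qed.

Lemma expr_small (c e : R) : 0 <= c < 1 -> 0 < e -> exists n, c ^+ n < e.
Proof.
move=> /andP[c0 c1] e0.
have : (fun n => c ^+ n) @ \oo --> (0 : R) by apply: cvg_expr; rewrite ger0_norm.
move=> /cvgrPdist_lt /(_ e e0) [n _ hn]; exists n.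
by have := hn n (leqnn n); rewrite /= sub0r normrN ger0_norm// exprn_ge0.
Qed.

(** Zeros on all small circles are infinitely many zeros in a compact set, so
    [f z] is bounded by all powers of some [c < 1]. *)
Lemma zeros_on_circles f : hol f -> (forall z, D z -> cabs (f z) <= 1) ->
  (forall r, 0 < r < 1 / 2 -> exists2 a, cabs a = r & f a = 0) ->
  forall z, D z -> f z = 0.
Proof.
move=> hf f1 hz z Dz.
have rk (k : nat) : 0 < (k.+3%:R : R)^-1 < 1 / 2.
  rewrite invr_gt0 ltr0n /= div1r ltf_pV2 ?posrE// ?ltr0n//.
  by rewrite ltr_nat.
pose a (k : nat) := xget 0 [set w | cabs w = (k.+3%:R : R)^-1 /\ f w = 0].
have aP (k : nat) : cabs (a k) = (k.+3%:R : R)^-1 /\ f (a k) = 0.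
  rewrite /a; case: xgetP => [w -> //|/= hn].
  by have [w w1 w2] := hz _ (rk k); case: (hn w).
have a12 (k : nat) : cabs (a k) < 1 / 2 by rewrite (aP k).1; case/andP: (rk k).
have aD (k : nat) : D (a k) by rewrite /disk /=; have := a12 k; lra.
have z2 := sqr_lt1 (cabs_ge0 z) Dz.
pose c2 : R := 1 - 3 / 16 * (1 - cabs z ^+ 2).
have c20 : 0 < c2 by rewrite /c2; have := sqr_ge0 (cabs z); lra.
have c21 : c2 < 1 by rewrite /c2; lra.
have cs : Num.sqrt c2 ^+ 2 = c2 by rewrite sqr_sqrtr// ltW.
have cb (k : nat) : cabs (mob (a k) z) <= Num.sqrt c2.
  rewrite -(@ler_pXn2r _ 2) ?nnegrE ?cabs_ge0 ?sqrtr_ge0// cs.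
  have e := mob_sq (aD k) (ltW Dz).
  rewrite -lerN2 -(lerD2l 1) e /c2 opprB subrKC.
  have dl := mob_den_le (a k) z; have dg := mob_den_gt0 (aD k) (ltW Dz).
  have ha := a12 k; have ha0 := cabs_ge0 (a k); have z1 : cabs z < 1 := Dz.
  have hz0 := cabs_ge0 z.
  have d2 : cabs (1 - (a k)^*%C * z) <= 2 by nra.
  rewrite ler_pdivlMr ?exprn_gt0//.
  have d4 : cabs (1 - (a k)^*%C * z) ^+ 2 <= 4 by nra.
  have a4 : 3 / 4 <= 1 - cabs (a k) ^+ 2 by nra.
  nra.
have key n : cabs (f z) <= Num.sqrt c2 ^+ n.
  have us : uniq (map a (iota 0 n)).
    rewrite map_inj_uniq ?iota_uniq// => i j aij.
    have := (aP i).1; rewrite aij (aP j).1 => /invr_inj/eqP.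
    by rewrite eqr_nat => /eqP [->].
  have := many_zeros hf f1 Dz us; rewrite size_map size_iota; apply.
  by move=> b /mapP[k _ ->]; split; [exact: aD|exact: (aP k).2|exact: cb].
apply/eqP; rewrite -cabs_eq0 eq_le cabs_ge0 andbT leNgt; apply/negP => fz.
have [|n hn] := expr_small (c := Num.sqrt c2) _ fz.
  by rewrite sqrtr_ge0; nra.
by have := key n; rewrite leNgt hn.
Qed.

(** Minimum modulus argument: if [f - w] had no zero inside the circle, then
    [1 / (f - w)] would be larger at the centre than on the circle. *)
Lemma covers_center f r : hol f -> 0 < r < 1 -> (forall z, cabs z = r -> f z != f 0) ->
  exists2 d, 0 < d & forall w, cabs (w - f 0) < d -> exists2 z, cabs z <= r & f z = w.
Proof.
move=> hf /andP[r0 r1] hr.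
have inD z : cabs z <= r -> D z by move=> zr; exact: le_lt_trans r1.
have [|d d0 hd] := compact_small (P := fun e z => cabs z = r -> 2 * e <= cabs (f z - f 0))
    (@compact_closed_disk R r).
  move=> z /= zr.
  have [zr'|zr'] := eqVneq (cabs z) r; last first.
    have zr0 : 0 < r - cabs z by rewrite subr_gt0 lt_neqAle zr' zr.
    exists (r - cabs z) => // e w _ wz wr.
    by have := cabs_sub w z; rewrite wr; lra.
  have fz : 0 < cabs (f z - f 0) by rewrite cabs_gt0 subr_eq0 hr.
  have fz4 : 0 < cabs (f z - f 0) / 4 by rewrite divr_gt0.
  have [d1 d10 hd1] := (cont_cabsP _ _).1 (hol_cont hf (inD z zr)) _ fz4.
  exists (Num.min d1 (cabs (f z - f 0) / 4)); first by rewrite lt_min d10.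
  move=> e w /andP[e0]; rewrite !lt_min => /andP[_ e2] /andP[w1 _] _.
  have := hd1 w w1; have := cabs_tri (f z) (f w) (f 0); rewrite [cabs (f z - f w)]cabsB; lra.
have d20 : 0 < d / 2 by rewrite divr_gt0.
have {}hd z : cabs z = r -> d <= cabs (f z - f 0).
  move=> zr; have e2 : 0 < d / 2 < d by apply/andP; split; lra.
  have zr' : cabs z <= r by rewrite zr.
  by have := hd _ e2 z zr' zr; lra.
exists (d / 2) => // w wd; apply: contrapT => nw.
have fw z : cabs z <= r -> f z - w != 0.
  by move=> zr; rewrite subr_eq0; apply/eqP => fzw; apply: nw; exists z.
have dg z : cabs z <= r -> exists L, cdiff (fun z => (f z - w)^-1) z L.
  move=> zr; eexists; apply: (cdiffV (f := fun z => f z - w) (fw z zr)).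
  apply: cdiffB; last exact: cdiff_cst.
  exact: derivable_cdiff (hf _ (inD z zr)).
have f0w := fw 0; rewrite cabs0 in f0w; have {}f0w := f0w (ltW r0).
have : cabs (f 0 - w)^-1 <= (d / 2)^-1.
  apply: (mean_bound (f := fun z => (f z - w)^-1) r0).
  - by move=> z /dg[L]; exact: cdiff_cont.
  - by move=> z /andP[_ /ltW/dg[L]]; exact: cdiff_derivable.
  - move=> z zr; rewrite cabsV lef_pV2 ?posrE// ?cabs_gt0 ?fw ?zr//.
    have := hd z zr; have := cabs_tri (f z) w (f 0); lra.
rewrite cabsV lef_pV2 ?posrE// ?cabs_gt0// cabsB; lra.
Qed.

(** By [zeros_on_circles] there is a small circle on which [f] avoids [f 0]. *)
Lemma open_at0 f : hol f -> (forall z, D z -> D (f z)) ->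
  (exists2 z, D z & f z != f 0) ->
  exists2 d, 0 < d & forall w, cabs (w - f 0) < d -> exists2 z, D z & f z = w.
Proof.
move=> hf fD [z0 Dz0 fz0].
have [hz|/existsNP[r /not_implyP[r12 nr]]] := pselect (forall r, 0 < r < 1 / 2 ->
    exists2 a, cabs a = r & mob (f 0) (f a) = 0).
  have m1 z : D z -> cabs (mob (f 0) (f z)) <= 1.
    by move=> Dz; apply/ltW/mob_disk; [apply/fD/disk0|exact: fD].
  have := zeros_on_circles (hol_mob_comp (fD _ (disk0 R)) hf fD) m1 hz Dz0.
  move=> /eqP; rewrite mulf_eq0 invr_eq0 subr_eq0 (negbTE fz0) /=.
  by rewrite (negbTE (mob_den_neq0 (fD _ (disk0 R)) (ltW (fD _ Dz0)))).
have r01 : 0 < r < 1 by apply/andP; case/andP: r12; split; lra.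
have [|d d0 hd] := covers_center hf r01.
  move=> z zr; apply/eqP => e; apply: nr; exists z => //.
  by rewrite e mobxx.
exists d => // w /hd[z zr fz]; exists z => //; rewrite /disk /=.
by case/andP: r01 => _; apply: le_lt_trans.
Qed.

Lemma open_at f a : hol f -> (forall z, D z -> D (f z)) -> D a ->
  (exists2 z, D z & f z != f a) ->
  exists2 d, 0 < d & forall w, cabs (w - f a) < d -> exists2 z, D z & f z = w.
Proof.
move=> hf fD Da [z Dz fz]; have DNa := diskN Da.
have := @open_at0 (fun z => f (mob (- a) z)) (hol_comp_mob DNa hf).
rewrite mob0 opprK => h.
have [||d d0 hd] := h.
- by move=> u Du; apply/fD/mob_disk.
- by exists (mob a z); [exact: mob_disk|rewrite mobK].
exists d => // w /hd[u Du fu]; exists (mob (- a) u) => //; exact: mob_disk.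
Qed.

Lemma injective_covers f a r e : 0 < r -> hol_into_disk f a r -> 0 < e ->
  (forall z, open_disk a r z -> f z = f a -> z = a) ->
  exists2 d, 0 < d & forall w, cabs (w - f a) < d -> exists2 z, cabs (z - a) < e /\ open_disk a r z & f z = w.
Proof.
move=> r0 hf e0 inj.
pose s := Num.min r e.
have s0 : 0 < s by rewrite lt_min r0.
have sr : s <= r by rewrite ge_min lexx.
have se : s <= e by rewrite ge_min lexx orbT.
have inb u : D u -> open_disk a r (a + s%:C * u).
  rewrite /disk /open_disk /= => u1; rewrite addrC addKr cabsM cabs_rC gtr0_norm//.
  by apply: lt_le_trans sr; rewrite gtr_pMr.
have hg : hol (fun u => f (a + s%:C * u)).
  move=> u Du; have [d _] := hf _ (inb u Du).
  have h1 : cdiff (fun u : R[i] => a + s%:C * u) u (0 + s%:C * 1).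
    by apply: cdiffD; [exact: cdiff_cst|apply/cdiffZ/cdiff_id].
  exact: cdiff_derivable (cdiff_comp h1 (derivable_cdiff d)).
have h12 : 0 < (1 / 2 : R) < 1 by apply/andP; split; lra.
have := covers_center hg h12; rewrite mulr0 addr0 => h.
have [|d d0 hd] := h.
  move=> u u12; apply/eqP => fe.
  have Du : D u by rewrite /disk /= u12; lra.
  have := inj _ (inb u Du) fe => /eqP; rewrite -subr_eq0 addrC addKr mulf_eq0.
  rewrite -!cabs_eq0 cabs_rC u12 gtr0_norm// gt_eqF//= => /eqP; lra.
exists d => // w /hd[u u12 fu].
have Du : D u by rewrite /disk /=; lra.
exists (a + s%:C * u) => //; split; last exact: inb.
rewrite addrC addKr cabsM cabs_rC gtr0_norm//.
by apply: lt_le_trans se; rewrite gtr_pMr.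
Qed.

End ZerosAndOpenness.

(** * Bijective self-maps of the disk *)

Section DiskAutomorphisms.
Variable R : realType.
Implicit Types (a z w : R[i]) (f g h q k : R[i] -> R[i]) (M r : R).
Local Notation D := (@disk R).
Local Notation hol := (holomorphic_on D).

Definition disk_auto k := [/\ hol k, forall z, D z -> D (k z),
  {in D &, injective k} & forall w, D w -> exists2 z, D z & k z = w].

(** By [injective_covers] the inverse is continuous, so it maps a closed disk to
    a compact set. *)
Lemma disk_auto_proper k (c : R) : disk_auto k -> c < 1 ->
  exists2 s, s < 1 & forall z, D z -> cabs (k z) <= c -> cabs z <= s.
Proof.
move=> [hk kD kinj ksurj] c1.
have [|d d0 hd] := compact_small (P := fun e w => forall z, D z -> k z = w -> cabs z <= 1 - e)
    (@compact_closed_disk R c).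
  move=> w /= wc; have [z0 Dz0 kz0] := ksurj w (le_lt_trans wc c1).
  have z01 : cabs z0 < 1 := Dz0.
  have r0 : 0 < 1 - cabs z0 by rewrite subr_gt0.
  have sub z : open_disk z0 (1 - cabs z0) z -> D z.
    by rewrite /open_disk /disk /= => h; have := cabs_sub z z0; lra.
  have hb : hol_into_disk k z0 (1 - cabs z0).
    by move=> z /sub Dz; split; [exact: hk|exact: kD].
  have e0 : 0 < (1 - cabs z0) / 2 by rewrite divr_gt0.
  have [|d d0 hd] := injective_covers r0 hb e0.
    by move=> z /sub Dz; apply: kinj; rewrite inE.
  exists (Num.min d ((1 - cabs z0) / 2)); first by rewrite lt_min d0.
  move=> e w' /andP[e1]; rewrite !lt_min -kz0 => /andP[_ e2] /andP[w'1 _] z Dz kz.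
  have [z' [z'1 /sub Dz'] kz'] := hd w' w'1.
  have -> : z = z' by apply: kinj; rewrite ?inE// kz kz'.
  by have := cabs_sub z' z0; lra.
exists (1 - d / 2); first by lra.
move=> z Dz kz; apply: (hd (d / 2) _ (k z)) => //; lra.
Qed.

(** Either [k z / z] does not vanish at [0], and then its inverse is bounded by
    [1] because [k] is proper; or [k] vanishes to second order. *)
Lemma disk_auto_fix0 k : disk_auto k -> k 0 = 0 ->
  (cabs (derive1 k 0) = 1 /\ forall z, D z -> cabs (k z) = cabs z) \/
  (forall z, D z -> cabs (k z) <= cabs z ^+ 2).
Proof.
move=> hk k0; have [hk1 kD kinj ksurj] := hk.
have hq := hol_quot0 hk1 erefl; set L := derive1 k 0 in hq *.
have q1 z : D z -> cabs (quot k 0 L z) <= 1.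
  by apply: schwarz_quot => // u Du; exact/ltW/kD.
have kq z : k z = quot k 0 L z * z by have := quotE k 0 L z; rewrite k0 !subr0.
have [L0|L0] := eqVneq L 0.
  right => z Dz; rewrite kq cabsM expr2 ler_wpM2r ?cabs_ge0//.
  by apply: (schwarz hq _ q1).1 => //; rewrite quot_diag.
left.
have qn z : D z -> quot k 0 L z != 0.
  move=> Dz; have [->|z0] := eqVneq z 0; first by rewrite quot_diag.
  apply: contraNneq z0 => qz; apply/eqP; apply: kinj; rewrite ?inE//; first exact: disk0.
  by rewrite kq qz mul0r k0.
have hV : hol (fun z => (quot k 0 L z)^-1).
  move=> z Dz; exact: cdiff_derivable (cdiffV (qn z Dz) (derivable_cdiff (hq z Dz))).
have V1 z : D z -> cabs (quot k 0 L z)^-1 <= 1.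
  apply: max_principle hV _ z => e e0.
  have c1 : (1 + e)^-1 < 1 by rewrite invf_lt1; lra.
  have [s s1 hs] := disk_auto_proper hk c1.
  exists (Num.max s 0); first by rewrite gt_max s1 ltr01.
  move=> z /andP[z1 z2]; have Dz : D z := z2.
  have zs : s < cabs z by apply: le_lt_trans z1; rewrite le_max lexx.
  have z0 : 0 < cabs z by apply: le_lt_trans z1; rewrite le_max lexx orbT.
  have kz : (1 + e)^-1 < cabs (k z).
    by rewrite ltNge; apply/negP => /(hs z Dz); rewrite leNgt zs.
  rewrite -[1 + e]invrK cabsV lef_pV2 ?posrE ?invr_gt0 ?cabs_gt0 ?qn//; last lra.
  apply: le_trans (ltW kz) _; rewrite kq cabsM ler_piMr ?cabs_ge0// ltW//.
have qE z : D z -> cabs (quot k 0 L z) = 1.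
  move=> Dz; apply/eqP; rewrite eq_le q1//=; have := V1 z Dz.
  by rewrite cabsV invf_le1// cabs_gt0 qn.
split; first by have := qE 0 (disk0 R); rewrite quot_diag.
by move=> z Dz; rewrite kq cabsM qE// mul1r.
Qed.

Lemma recenter_auto k a : disk_auto k -> D a -> disk_auto (recenter k a).
Proof.
move=> [hk kD kinj ksurj] Da; have DNa := diskN Da.
split.
- exact: recenter_hol.
- by move=> z; exact: recenter_disk.
- move=> z w; rewrite !inE => Dz Dw /(congr1 (mob (- k a))).
  rewrite !mobK; try by [apply: kD|apply/kD/mob_disk].
  move=> /kinj; rewrite !inE => h.
  have /(congr1 (mob a)) := h (mob_disk DNa Dz) (mob_disk DNa Dw).
  by rewrite !mobNK.
- move=> w Dw; have [z Dz kz] := ksurj _ (mob_disk (diskN (kD a Da)) Dw).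
  exists (mob a z); first exact: mob_disk.
  by rewrite recenter_mob// kz mobNK//; exact: kD.
Qed.

(** In [n] steps a quadratic modulus of continuity accumulates only [C / n]. *)
Lemma subdivide_const k (C : R) z : 0 <= C ->
  (forall t s : R, 0 <= t <= 1 -> 0 <= s <= 1 ->
     cabs (k (t%:C * z) - k (s%:C * z)) <= C * (t - s) ^+ 2) -> k z = k 0.
Proof.
move=> C0 h; apply: eq_of_cabs_le => e e0.
have [n hn] : exists n : nat, C / n.+1%:R < e.
  exists (Num.bound `|C / e|).
  rewrite ltr_pdivrMr ?ltr0n// mulrC -ltr_pdivrMr//.
  apply: le_lt_trans (ler_norm _) _; apply: lt_trans (archi_boundP _) _ => //.
  by rewrite ltr_nat.
have N0 : 0 < n.+1%:R :> R by rewrite ltr0n.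
pose t (i : nat) : R := i%:R / n.+1%:R.
have t01 i : (i <= n.+1)%N -> 0 <= t i <= 1.
  move=> it; rewrite divr_ge0//= ler_pdivrMr// mul1r ler_nat//.
have e1 : k z = k ((t n.+1)%:C * z) by rewrite /t divff ?mul1r// gt_eqF.
have e2 : k 0 = k ((t 0%N)%:C * z) by rewrite /t !mul0r.
rewrite e1 e2 -(telescope_sumr (fun i => k ((t i)%:C * z)) (leq0n n.+1)).
apply: le_trans (cabs_sum _ _) _.
apply: (@le_trans _ _ (\sum_(0 <= i < n.+1) C / n.+1%:R ^+ 2)).
  apply: ler_sum_nat => i /andP[_ ilt].
  apply: le_trans (h _ _ (t01 _ ilt) (t01 _ (ltnW ilt))) _.
  rewrite /t -mulrBl -natrB// subSnn mul1r exprVn//.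
rewrite sumr_const_nat subn0 (_ : _ *+ n.+1 = C / n.+1%:R); first exact: ltW.
by rewrite -[LHS]mulr_natr; field; rewrite addrC natr1 gt_eqF.
Qed.

Lemma disk_auto_isometry k a : disk_auto k -> D a ->
  lambda_disk (k a) * cabs (derive1 k a) = lambda_disk a.
Proof.
move=> hk Da; have [hk1 kD kinj ksurj] := hk.
suff : cabs (derive1 (recenter k a) 0) = 1.
  move=> h; rewrite (recenter_derive hk1 kD Da) in h.
  exact: divr1_eq h.
have dich b : D b -> (cabs (derive1 (recenter k b) 0) = 1 /\
     forall z, D z -> cabs (mob (k b) (k z)) = cabs (mob b z)) \/
   (forall z, D z -> cabs (mob (k b) (k z)) <= cabs (mob b z) ^+ 2).
  move=> Db; have [[h1 h2]|h] := disk_auto_fix0 (recenter_auto hk Db) (recenter0 k b).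
    by left; split=> // z Dz; rewrite -(recenter_mob k Db Dz) h2//; exact: mob_disk.
  by right => z Dz; rewrite -(recenter_mob k Db Dz) h//; exact: mob_disk.
have [[//]|bad] := dich a Da.
(* degeneracy at one point spreads to all of them, and makes [k] constant *)
have allbad b : D b -> forall z, D z -> cabs (mob (k b) (k z)) <= cabs (mob b z) ^+ 2.
  move=> Db; have [ba|ba] := eqVneq b a; first by rewrite ba.
  have [[_ good]|//] := dich b Db.
  exfalso; have := bad b Db; rewrite mob_sym good// mob_sym.
  have m0 : 0 < cabs (mob a b).
    by rewrite cabs_gt0 mulf_neq0 ?subr_eq0// invr_eq0 mob_den_neq0// ltW.
  have := mob_disk Da Db; rewrite /disk /=; nra.
have h12 : cabs ((1 / 2)%:C : R[i]) = 1 / 2 by rewrite cabs_rC ger0_norm; lra.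
have D12 : D (1 / 2)%:C by rewrite /disk /= h12; lra.
suff : k (1 / 2)%:C = k 0.
  move=> /kinj; rewrite !inE => /(_ D12 (disk0 R)) /(congr1 (@cabs R)).
  by rewrite h12 cabs0; lra.
apply: (@subdivide_const k 2) => // t s /andP[t0 t1] /andP[s0 s1].
have inD u : 0 <= u -> u <= 1 -> cabs (u%:C * (1 / 2)%:C) = u / 2 /\ D (u%:C * (1 / 2)%:C).
  move=> u0 u1; have e : cabs (u%:C * (1 / 2)%:C) = u / 2.
    by rewrite cabsM h12 cabs_rC ger0_norm// mul1r.
  by split=> //; rewrite /disk /= e; lra.
have [ct Dt] := inD t t0 t1; have [cs Ds] := inD s s0 s1.
apply: le_trans (mob_ge (kD _ Ds) (kD _ Dt)) _; rewrite ler_pM2l//.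
apply: le_trans (allbad _ Ds _ Dt) _.
rewrite -[X in _ <= X](@real_normK _ (t - s)) ?num_real//.
rewrite ler_pXn2r ?nnegrE ?cabs_ge0//.
apply: le_trans (mob_le Ds Dt) _; rewrite cs -mulrBl cabsM -rmorphB cabs_rC h12.
rewrite ler_pdivrMr; last by lra.
by rewrite ler_wpM2l//; lra.
Qed.

End DiskAutomorphisms.

(** * Partitions of the unit interval *)

Section Partitions.
Variable R : realType.
Implicit Types (x y : R).

Lemma unit_itvE x : unit_itv x <-> 0 <= x <= 1.
Proof. by rewrite /unit_itv /= in_itv. Qed.

Lemma itv_partition_le (a b : R) (s : seq R) k : itv_partition a b s -> (k < size s)%N ->
  a <= nth 0 (a :: s) k /\ nth 0 s k <= b.
Proof.
elim: s a k => [//|c s IH] a k [/= /andP[ac cs] /eqP lb].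
have pt : itv_partition c b s by split=> //; apply/eqP.
have cb : c <= b.
  case: s cs lb pt IH => [/= _ -> //|d s cs lb pt IH].
  have [h1 h2] := IH c 0%N pt isT; apply: le_trans h2.
  by move: cs => /= /andP[/ltW].
case: k => [|k] /= ks; first by rewrite lexx.
have [h1 h2] := IH c k pt ks; split=> //.
by apply: le_trans (ltW ac) h1.
Qed.

Lemma itv_partition_step (s : seq R) k : itv_partition 0 1 s -> (k < size s)%N ->
  [/\ unit_itv (nth 0 (0 :: s) k), unit_itv (nth 0 s k) &
      nth 0 (0 :: s) k < nth 0 s k].
Proof.
move=> h ks; have [h1 h2] := itv_partition_le h ks.
have h3 : nth 0 (0 :: s) k < nth 0 s k by case: h => /(pathP 0) + _; exact.
have l1 := le_trans h1 (ltW h3); have l2 := le_trans (ltW h3) h2.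
by split=> //; apply/unit_itvE; rewrite ?h1 ?h2 ?l1 ?l2.
Qed.

Lemma partition_telescope (V : zmodType) (u : R -> V) (s : seq R) : itv_partition 0 1 s ->
  \sum_(0 <= k < size s) (u (nth 0 s k) - u (nth 0 (0 :: s) k)) = u 1 - u 0.
Proof.
move=> [_ /eqP ls].
rewrite (telescope_sumr (fun k => u (nth 0 (0 :: s) k)) (leq0n (size s))) /=.
congr (u _ - _); rewrite -[RHS]ls; case: s {ls} => [//|c s] /=.
by rewrite (last_nth 0).
Qed.

Lemma fine_partition (d : R) : 0 < d -> exists2 s, itv_partition 0 1 s &
  forall k, (k < size s)%N -> nth 0 s k - nth 0 (0 :: s) k < d.
Proof.
move=> d0.
have [n hn] : exists n : nat, n.+1%:R^-1 < d.
  exists (Num.bound `|d^-1|); rewrite invf_plt ?posrE ?ltr0n//.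
  apply: le_lt_trans (ler_norm _) _; apply: lt_trans (archi_boundP _) _ => //.
  by rewrite ltr_nat.
have N0 : 0 < n.+1%:R :> R by rewrite ltr0n.
pose s : seq R := mkseq (fun k => k.+1%:R / n.+1%:R) n.+1.
have ss : size s = n.+1 by rewrite size_mkseq.
have sn k : (k < n.+1)%N -> nth 0 s k = k.+1%:R / n.+1%:R by move=> kn; rewrite nth_mkseq.
have s0 k : (k < n.+1)%N -> nth 0 (0 :: s) k = k%:R / n.+1%:R.
  case: k => [|k] kn; first by rewrite mul0r.
  by rewrite -[LHS]/(nth 0 s k) sn// ltnW.
have st k : (k < n.+1)%N -> nth 0 s k - nth 0 (0 :: s) k = n.+1%:R^-1.
  by move=> kn; rewrite sn// s0// -mulrBl -natrB// subSnn mul1r.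
exists s; last by move=> k; rewrite ss => /st ->.
split.
- apply/(pathP 0) => k; rewrite ss => kn.
  by rewrite -subr_gt0 st// invr_gt0.
- apply/eqP; rewrite (last_nth 0) ss -[LHS]/(nth 0 s n) sn// divff// gt_eqF//.
Qed.

(** A Lebesgue number, for conditions on triples of nearby parameters. *)
Lemma unit_itv_uniform (P : R -> R -> R -> Prop) :
  (forall x0, unit_itv x0 -> exists2 d, 0 < d & forall s t x,
     unit_itv s -> unit_itv t -> unit_itv x ->
     `|s - x0| < d -> `|t - x0| < d -> `|x - x0| < d -> P s t x) ->
  exists2 d, 0 < d & forall s t x, unit_itv s -> unit_itv t -> unit_itv x ->
     `|s - x| < d -> `|t - x| < d -> P s t x.
Proof.
move=> h.
have cK : compact (@unit_itv R) by exact: segment_compact.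
have := proj1 (compact_near_coveringP _) cK R (0^'+)
  (fun e x => unit_itv x -> forall s t, unit_itv s -> unit_itv t ->
     `|s - x| < e -> `|t - x| < e -> P s t x) (at_right_proper_filter 0).
case.
  move=> x0 /h[d d0 hd]; have d20 : 0 < d / 2 by rewrite divr_gt0.
  exists ([set x | `|x - x0| < d / 2], [set e | 0 < e < d / 2]).
    split; first by apply/nbhs_realP; exists (d / 2).
    by near=> e; apply/andP; split; near: e; [exact: nbhs_right_gt|exact: nbhs_right_lt].
  move=> [x e] /= [hx /andP[e0 ed]] ux s t us ut sx tx.
  have tri y : `|y - x| < e -> `|y - x0| < d.
    move=> yx; apply: le_lt_trans (ler_distD x _ _) _; lra.
  by apply: hd => //; [exact: tri|exact: tri|lra].
move=> d /= d0 hd; exists (d / 2); first by rewrite divr_gt0.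
move=> s t x us ut ux; apply: (hd (d / 2)) => //=; last lra.
by rewrite sub0r normrN gtr0_norm; lra.
Unshelve. all: by end_near.
Qed.

Lemma within_unit_itvP (g : R -> R[i]) : {within @unit_itv R, continuous g} <->
  forall x, unit_itv x -> forall e : R, 0 < e -> exists2 d, 0 < d &
    forall y, unit_itv y -> `|y - x| < d -> cabs (g y - g x) < e.
Proof.
split.
- move=> /subspace_continuousP h x ux e e0.
  have h' : g y @[y --> within (@unit_itv R) (nbhs x)] --> g x := h x ux.
  move: h' => /cvg_cabsP/(_ e e0) /nbhs_realP[d d0 hd].
  by exists d => // y uy yx; exact: hd.
- move=> h; apply/subspace_continuousP => x ux; apply/cvg_cabsP => e e0.
  have [d d0 hd] := h x ux e e0.
  by apply/nbhs_realP; exists d => // y yx uy; exact: hd.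
Qed.

End Partitions.

(** * Integrals along curves under holomorphic maps *)

Section ArcIntegralTransfer.
Variable R : realType.
Implicit Types (z w : R[i]) (r : R).
Local Notation D := (@disk R).

Lemma derive_cont (f : R[i] -> R[i]) a r : 0 < r -> hol_into_disk f a r ->
  {for a, continuous (derive1 f)}.
Proof.
move=> r0 hf; apply/cont_cabsP => e e0; pose C := 54 / r ^+ 2.
have C0 : 0 < C by rewrite divr_gt0// exprn_gt0.
exists (Num.min (r / 4) (e / C)); first by rewrite lt_min; apply/andP; split; rewrite divr_gt0.
move=> w; rewrite lt_min => /andP[w1 w2].
apply: le_lt_trans (derive_lip r0 hf w1) _.
by rewrite mulrC -ltr_pdivlMr.
Qed.

Variables (U V : set R[i]) (f : R[i] -> R[i]) (rho sigma : R[i] -> R).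
Hypotheses (holU : forall z, U z -> exists2 r, 0 < r & hol_into_disk f z r)
  (fUV : set_fun U V f) (sigma_ge0 : forall z, U z -> 0 <= sigma (f z))
  (sigma_cont : forall z, U z -> {for z, continuous (fun w => sigma (f w))})
  (rhoE : forall z, U z -> sigma (f z) * cabs (derive1 f z) = rho z).

Lemma image_curve a b g : curve_in U a b g -> curve_in V (f a) (f b) (f \o g).
Proof.
move=> [/within_unit_itvP cg Ug g0 g1]; split.
- apply/within_unit_itvP => x ux e e0.
  have [r r0 /(_ (g x))[]] := holU (Ug x ux); first by rewrite /open_disk /= subrr cabs0.
  move=> /derivable_cont/cont_cabsP/(_ _ e0)[d d0 hd] _.
  have [d1 d10 hd1] := cg x ux d d0.
  by exists d1 => // y uy yx; apply/hd/hd1.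
- by move=> x /Ug/fUV.
- by rewrite /= g0.
- by rewrite /= g1.
Qed.

(** A partition may have long steps, and points of the curve may be close
    although their parameters are not: the estimate is made in the plane. *)
Lemma image_lipschitz a b g : curve_in U a b g -> exists2 K : R, 0 < K &
  forall s t, unit_itv s -> unit_itv t -> cabs (f (g t) - f (g s)) <= K * cabs (g t - g s).
Proof.
move=> [cg Ug _ _].
have cK : compact (g @` @unit_itv R).
  by apply: continuous_compact => //; exact: segment_compact.
have [|d d0 hd] := compact_small (P := fun e z => forall w, cabs (w - z) < e ->
    cabs (f w - f z) <= e^-1 * cabs (w - z)) cK.
  move=> _ [x /Ug Ux <-]; have [r r0 hr] := holU Ux.
  have [d d0 hd] := strict_diff r0 hr ltr01.
  pose k := cabs (derive1 f (g x)) + 1.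
  have k0 : 0 < k by rewrite /k; have := cabs_ge0 (derive1 f (g x)); lra.
  exists (Num.min (d / 2) k^-1); first by rewrite lt_min divr_gt0// invr_gt0.
  move=> e z; rewrite !lt_min => /andP[e0 /andP[ed ek]] /andP[zd _] w wz.
  have wd : cabs (w - g x) < d.
    by apply: le_lt_trans (cabs_tri _ z _) _; lra.
  have := hd w z wd ltac:(lra); rewrite mul1r => h.
  have kE : k <= e^-1 by rewrite -[k]invrK lef_pV2 ?posrE ?invr_gt0// ltW.
  apply: (@le_trans _ _ (k * cabs (w - z))); last by rewrite ler_wpM2r ?cabs_ge0.
  have := cabs_sub (f w - f z) (derive1 f (g x) * (w - z)).
  rewrite cabsM /k; move: h; move: (cabs (f w - f z - _)) (cabs (f w - f z)) => p q; lra.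
have d20 : 0 < d / 2 by rewrite divr_gt0.
have e2 : 0 < d / 2 < d by apply/andP; split; lra.
exists (2 / (d / 2)); first by rewrite divr_gt0.
move=> s t us ut.
have Kt : (g @` @unit_itv R) (g s) by exists s.
have [lt|ge] := ltP (cabs (g t - g s)) (d / 2).
  apply: le_trans (hd _ e2 _ Kt _ lt) _; rewrite ler_wpM2r ?cabs_ge0//.
  by rewrite ler_peMl ?invr_ge0 ?ltW//; lra.
have Df x : unit_itv x -> cabs (f (g x)) < 1.
  move=> ux; have [r r0 /(_ (g x))[]] := holU (Ug x ux); last by [].
  by rewrite /open_disk /= subrr cabs0.
apply: (@le_trans _ _ 2).
  apply: le_trans (cabsD _ _) _; rewrite cabsN.
  by have := Df t ut; have := Df s us; lra.
by rewrite mulrAC ler_pdivlMr// ler_pM2l.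
Qed.

Lemma image_rectifiable a b g : curve_in U a b g -> rectifiable g -> rectifiable (f \o g).
Proof.
move=> cu [M hM]; have [K K0 hK] := image_lipschitz cu.
exists (K * M) => s ps; apply: (@le_trans _ _ (K * polygon_length g s)).
  rewrite /polygon_length big_distrr /= !big_nat; apply: ler_sum => k ks.
  by have [u1 u2 _] := itv_partition_step ps ks; exact: hK.
by rewrite ler_pM2l// hM.
Qed.

(** Strict differentiability makes the two Riemann sums agree up to a small
    multiple of the length of the curve. *)
Lemma image_arc_integral a b g I : curve_in U a b g -> rectifiable g ->
  is_arc_integral rho g I -> is_arc_integral sigma (f \o g) I.
Proof.
move=> cu [M hM] hI e e0; have [/within_unit_itvP cg Ug _ _] := cu.
have [C C0 hC] : exists2 C, 0 < C & forall x, unit_itv x -> sigma (f (g x)) <= C.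
  have cK : compact (g @` @unit_itv R).
    by apply: continuous_compact; [case: cu|exact: segment_compact].
  have [|d d0 hd] := compact_small (P := fun e z => sigma (f z) <= e^-1) cK.
    move=> _ [x /Ug Ux <-].
    have c1 := sigma_cont Ux; have s0 := sigma_ge0 Ux.
    have /nbhs_cabsP[d d0 hd] := (@cvgrPdist_lt _ _ _ (nbhs (g x)) (nbhs_filter _) _ _).1 c1 1 ltr01.
    have k0 : 0 < sigma (f (g x)) + 1 by lra.
    exists (Num.min d (sigma (f (g x)) + 1)^-1); first by rewrite lt_min d0 invr_gt0.
    move=> e' w /andP[e1]; rewrite !lt_min => /andP[_ e2] /andP[wd _].
    have h1 : sigma (f (g x)) + 1 <= e'^-1 by rewrite -[_ + 1]invrK lef_pV2 ?posrE ?invr_gt0// ltW.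
    apply: le_trans h1; have := hd w wd; rewrite ltr_norml => /andP[]; lra.
  exists (d / 2)^-1; first by rewrite invr_gt0 divr_gt0.
  move=> x ux; apply: hd; last by exists x.
  by apply/andP; split; lra.
have L0 : 0 < `|M| + 1 by have := normr_ge0 M; lra.
pose e' := e / (2 * C * (`|M| + 1)).
have e'0 : 0 < e' by rewrite divr_gt0// !mulr_gt0.
have [d1 d10 hd1] : exists2 d, 0 < d & forall s t x, unit_itv s -> unit_itv t -> unit_itv x ->
    `|s - x| < d -> `|t - x| < d ->
    `|cabs (f (g t) - f (g s)) - cabs (derive1 f (g x)) * cabs (g t - g s)| <= e' * cabs (g t - g s).
  apply: unit_itv_uniform => x0 ux0; have [r r0 hr] := holU (Ug x0 ux0).
  have e'20 : 0 < e' / 2 by rewrite divr_gt0.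
  have [d d0 hd] := strict_diff r0 hr e'20.
  have [d2 d20 hd2] := (cont_cabsP _ _).1 (derive_cont r0 hr) _ e'20.
  have [d3 d30 hd3] := cg x0 ux0 (Num.min d d2) ltac:(by rewrite lt_min d0).
  exists d3 => // s t x us ut ux sx tx xx.
  have := hd3 s us sx; rewrite lt_min => /andP[s1 _].
  have := hd3 t ut tx; rewrite lt_min => /andP[t1 _].
  have := hd3 x ux xx; rewrite lt_min => /andP[_ x2].
  have k1 := hd _ _ t1 s1; have k2 := hd2 _ x2.
  have k3 := cabs_subl (f (g t) - f (g s)) (derive1 f (g x0) * (g t - g s)).
  have k4 := cabs_subl (derive1 f (g x)) (derive1 f (g x0)).
  rewrite cabsM in k3; have n0 := cabs_ge0 (g t - g s).
  have split2 (p q q' n : R) : p - q * n = (p - q' * n) - (q - q') * n by ring.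
  rewrite (split2 _ _ (cabs (derive1 f (g x0)))).
  apply: le_trans (ler_normB _ _) _; rewrite normrM (ger0_norm n0).
  rewrite [X in _ <= X * _]splitr mulrDl; apply: lerD; first exact: le_trans k3 k1.
  by rewrite ler_wpM2r// ltW// (le_lt_trans k4).
have e20 : 0 < e / 2 by rewrite divr_gt0.
have [d2 d20 hd2] := hI _ e20.
exists (Num.min d1 d2); first by rewrite lt_min d10.
move=> s xi ps hs.
have h2 : `|arc_riemann_sum rho g s xi - I| < e / 2.
  apply: hd2 => // k ks; have [p ->] := hs k ks; split=> //.
  by move: p; rewrite lt_min => /andP[].
have h1 : `|arc_riemann_sum sigma (f \o g) s xi - arc_riemann_sum rho g s xi| <= e / 2.
  rewrite /arc_riemann_sum -sumrB.
  apply: le_trans (ler_norm_sum _ _ _) _.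
  apply: (@le_trans _ _ (\sum_(0 <= k < size s) C * e' * cabs (g (nth 0 s k) - g (nth 0 (0 :: s) k)))).
    rewrite !big_nat; apply: ler_sum => k ks.
    have [p1 /andP[x1 x2]] := hs k ks; move: p1; rewrite lt_min => /andP[p1 _].
    have [u1 u2 u12] := itv_partition_step ps ks.
    have ux : unit_itv (xi k).
      move: u1 u2 => /unit_itvE/andP[a1 a2] /unit_itvE/andP[b1 b2].
      by apply/unit_itvE; rewrite (le_trans a1 x1) (le_trans x2 b2).
    rewrite -(rhoE (Ug _ ux)) /= -mulrA -mulrBr normrM (ger0_norm (sigma_ge0 (Ug _ ux))) -mulrA.
    apply: ler_pM => //; [exact: sigma_ge0 (Ug _ ux)|exact: hC|].
    by apply: hd1 => //; rewrite ltr_norml; apply/andP; split; lra.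
  rewrite -big_distrr /= -/(polygon_length g s).
  have := hM s ps; have := ler_norm M => m1 m2.
  have Ce : 0 < C * e' by rewrite mulr_gt0.
  apply: (@le_trans _ _ (C * e' * (`|M| + 1))); first by rewrite ler_pM2l//; lra.
  by rewrite le_eqVlt; apply/orP; left; apply/eqP; rewrite /e'; field; rewrite !gt_eqF.
rewrite -(subrK (arc_riemann_sum rho g s xi) (arc_riemann_sum sigma _ _ _)) -addrA.
by apply: le_lt_trans (ler_normD _ _) _; lra.
Qed.

End ArcIntegralTransfer.

(** * The hyperbolic distance of the disk *)

Section DensityDistance.
Variable R : realType.
Implicit Types (a b z w : R[i]).
Local Notation D := (@disk R).

(** The two maps exchange the admissible curves and preserve their integrals,
    so that the two infima are taken over the same set. *)
Lemma density_dist_transfer (U V : set R[i]) (f h : R[i] -> R[i])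
    (rho sigma : R[i] -> R) a b :
  (forall z, U z -> exists2 r : R, 0 < r & hol_into_disk f z r) ->
  (forall z, V z -> exists2 r : R, 0 < r & hol_into_disk h z r) ->
  set_fun U V f -> set_fun V U h -> (forall z, U z -> h (f z) = z) ->
  (forall z, U z -> 0 <= rho z) -> (forall z, V z -> 0 <= sigma z) ->
  (forall z, U z -> {for z, continuous rho}) ->
  (forall z, V z -> {for z, continuous sigma}) ->
  (forall z, U z -> sigma (f z) * cabs (derive1 f z) = rho z) ->
  (forall z, V z -> rho (h z) * cabs (derive1 h z) = sigma z) ->
  U a -> U b -> density_dist U rho a b = density_dist V sigma (f a) (f b).
Proof.
move=> hf hh fUV hVU fK rho0 sigma0 crho csigma eqf eqh Ua Ub.
have cont (W : set R[i]) k z : (forall z, W z -> exists2 r : R, 0 < r & hol_into_disk k z r) ->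
    W z -> {for z, continuous k}.
  move=> hk Wz; have [r r0 /(_ z)[]] := hk z Wz; first by rewrite /open_disk /= subrr cabs0.
  by move/derivable_cont.
rewrite /density_dist; congr inf; apply/seteqP; split => I [g [cg rg Ig]].
- exists (f \o g); split.
  + exact: image_curve hf fUV _ _ _ cg.
  + exact: image_rectifiable hf _ _ _ cg rg.
  + apply: (image_arc_integral hf _ _ eqf cg rg Ig) => z Uz; first exact/sigma0/fUV.
    by apply: (contcomp (cont _ _ _ hf Uz)); exact/csigma/fUV.
- exists (h \o g); split.
  + by rewrite -[a]fK// -[b]fK//; exact: image_curve hh hVU _ _ _ cg.
  + exact: image_rectifiable hh _ _ _ cg rg.
  + apply: (image_arc_integral hh _ _ eqh cg rg Ig) => z Vz; first exact/rho0/hVU.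
    by apply: (contcomp (cont _ _ _ hh Vz)); exact/crho/hVU.
Qed.

Lemma lambda_disk_cont z : D z -> {for z, continuous (@lambda_disk R)}.
Proof.
move=> Dz; apply: (@cvgV _ _ _ (nbhs_filter z)).
  by rewrite gt_eqF// sqr_lt1// cabs_ge0.
apply: (@cvgB _ _ _ _ (nbhs_filter z)); first exact: (@cvg_cst _ _ _ _ (nbhs_filter z)).
rewrite expr2; under eq_fun do rewrite expr2.
by apply: (@cvgM _ _ _ (nbhs_filter z)); exact: cont_cabs.
Qed.

Lemma disk_ball z : D z -> exists2 r : R, 0 < r & forall w, open_disk z r w -> D w.
Proof.
rewrite /disk /= => z1; exists (1 - cabs z); first by rewrite subr_gt0.
by move=> w; rewrite /open_disk /= => wz; have := cabs_sub w z; lra.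
Qed.

Lemma self_map_hol_into_disk (f : R[i] -> R[i]) z : holomorphic_on D f -> (forall z, D z -> D (f z)) ->
  D z -> exists2 r : R, 0 < r & hol_into_disk f z r.
Proof.
move=> hf fD /disk_ball[r r0 hr]; exists r => // w /hr Dw.
by split; [exact: hf|exact: fD].
Qed.

Lemma mob_hol a : D a -> holomorphic_on D (mob a).
Proof. by move=> Da z Dz; exact: cdiff_derivable (cdiff_mob Da Dz). Qed.

Lemma mob_auto a : D a -> disk_auto (mob a).
Proof.
move=> Da; split.
- exact: mob_hol.
- by move=> z; exact: mob_disk.
- move=> z w; rewrite !inE => Dz Dw /(congr1 (mob (- a))).
  by rewrite !mobK.
- by move=> w Dw; exists (mob (- a) w); [apply: mob_disk => //; exact: diskN|rewrite mobNK].
Qed.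

Lemma hyp_dist_disk_mob a b : D a -> D b ->
  hyp_dist_disk a b = hyp_dist_disk 0 (mob a b).
Proof.
move=> Da Db; rewrite -[X in _ = hyp_dist_disk X _](mobxx a).
have DNa := diskN Da.
have iso c z : D c -> D z -> lambda_disk (mob c z) * cabs (derive1 (mob c) z) = lambda_disk z.
  by move=> Dc; exact: disk_auto_isometry (mob_auto Dc).
apply: (density_dist_transfer (h := mob (- a))) => //.
- by move=> z; apply: self_map_hol_into_disk; [exact: mob_hol|move=> u; exact: mob_disk].
- by move=> z; apply: self_map_hol_into_disk; [exact: mob_hol|move=> u; exact: mob_disk].
- by move=> z; exact: mob_disk.
- by move=> z; exact: mob_disk.
- by move=> z; exact: mobK.
- by move=> z /lambda_disk_gt0/ltW.
- by move=> z /lambda_disk_gt0/ltW.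
- exact: lambda_disk_cont.
- exact: lambda_disk_cont.
- by move=> z; exact: iso.
- by move=> z; exact: iso.
Qed.

Definition artanh (x : R) : R := (ln (1 + x) - ln (1 - x)) / 2.

Lemma artanh0 : artanh 0 = 0.
Proof. by rewrite /artanh addr0 subr0 subrr mul0r. Qed.

Lemma is_derive_artanh (x : R) : -1 < x < 1 -> is_derive x 1 artanh (1 - x ^+ 2)^-1.
Proof.
move=> /andP[x0 x1].
have p1 : 0 < 1 + x by lra.
have p2 : 0 < 1 - x by lra.
have l1 : is_derive (1 + x) 1 (@ln R) (1 + x)^-1 := is_derive1_ln p1.
have l2 : is_derive (1 - x) 1 (@ln R) (1 - x)^-1 := is_derive1_ln p2.
have -> : artanh = (fun y => 2^-1 *: (ln (1 + y) - ln (1 - y))).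
  by apply/funext => y; rewrite /artanh mulrC.
have d1 : is_derive x (1 : R) (fun y : R => 1 + y) 1.
  by have := is_deriveD (is_derive_cst (1 : R) x 1) (is_derive_id x (1 : R)); rewrite add0r.
have d2 : is_derive x (1 : R) (fun y : R => 1 - y) (-1).
  by have := is_deriveB (is_derive_cst (1 : R) x 1) (is_derive_id x (1 : R)); rewrite sub0r.
have e1 := @is_derive1_comp R (@ln R) (fun y => 1 + y) x _ _ l1 d1.
have e2 := @is_derive1_comp R (@ln R) (fun y => 1 - y) x _ _ l2 d2.
have e3 : is_derive x (1 : R) (fun y => 2^-1 *: (ln (1 + y) - ln (1 - y)))
   (2^-1 *: ((1 + x)^-1 * 1 - (1 - x)^-1 * -1)).
  by apply: is_deriveZ; apply: is_deriveB.
apply: is_derive_eq e3 _; rewrite -[_ *: _]/(_ * _).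
have p3 : 0 < 1 - x ^+ 2 by nra.
by field; rewrite !gt_eqF.
Qed.

Lemma artanh_cont (x : R) : -1 < x < 1 -> {for x, continuous artanh}.
Proof.
move=> /is_derive_artanh[d _].
by apply: differentiable_continuous; apply/derivable1_diffP.
Qed.

Lemma artanh_strict (x0 e : R) : 0 <= x0 < 1 -> 0 < e -> exists2 d : R, 0 < d &
  forall u v, `|u - x0| < d -> `|v - x0| < d ->
   `|artanh v - artanh u - (1 - x0 ^+ 2)^-1 * (v - u)| <= e * `|v - u|.
Proof.
move=> /andP[x00 x01] e0.
have c : {for x0, continuous (fun x : R => (1 - x ^+ 2)^-1)}.
  apply: cvgV; first by rewrite gt_eqF// sqr_lt1.
  by apply: cvgB; [exact: cvg_cst|exact: exprn_continuous].
have /nbhs_realP[d d0 hd] := (@cvgrPdist_lt _ _ _ (nbhs x0) (nbhs_filter _) _ _).1 c e e0.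
exists (Num.min d (1 - x0)); first by rewrite lt_min d0 subr_gt0.
have half u v : u <= v -> `|u - x0| < Num.min d (1 - x0) -> `|v - x0| < Num.min d (1 - x0) ->
   `|artanh v - artanh u - (1 - x0 ^+ 2)^-1 * (v - u)| <= e * `|v - u|.
  move=> uv; rewrite !lt_min !ltr_norml => /andP[/andP[u1 u2] /andP[u3 u4]].
  move=> /andP[/andP[v1 v2] /andP[v3 v4]].
  have inI y : u <= y <= v -> -1 < y < 1 /\ `|y - x0| < d.
    move=> /andP[uy yv]; split; first by apply/andP; split; lra.
    by rewrite ltr_norml; apply/andP; split; lra.
  have [||y yI ->] := @MVT_segment R artanh (fun y => (1 - y ^+ 2)^-1) u v uv.
  - move=> y; rewrite in_itv /= => /andP[uy yv].
    by apply: is_derive_artanh; have [] := inI y; rewrite ?ltW.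
  - apply: continuous_in_subspaceT => y; rewrite inE /= in_itv /= => /inI[h _].
    exact: artanh_cont.
  - move: yI; rewrite in_itv /= => /inI[_ yd].
    rewrite -mulrBl normrM ler_wpM2r// ltW// distrC; exact: hd.
move=> u v ud vd; have [uv|vu] := leP u v; first exact: half.
have := half v u (ltW vu) vd ud.
rewrite -[artanh u - artanh v]opprB -[u - v]opprB mulrN -opprD !normrN.
by [].
Qed.

(** Along any curve the integral dominates the increments of [artanh] of the
    modulus, with equality on a ray. *)
Lemma hyp_dist_disk0 w : D w -> hyp_dist_disk 0 w = artanh (cabs w).
Proof.
move=> Dw; have w1 : cabs w < 1 := Dw; have w0 := cabs_ge0 w.
set S := [set I | exists g, [/\ curve_in D 0 w g, rectifiable g &
                             is_arc_integral (@lambda_disk R) g I]].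
have low I : S I -> artanh (cabs w) <= I.
  move=> [g [[/within_unit_itvP cg Dg g0 g1] [M hM] hI]].
  apply/ler_addgt0Pr => e e0.
  have L0 : 0 < `|M| + 1 by have := normr_ge0 M; lra.
  pose e' := e / (2 * (`|M| + 1)).
  have e'0 : 0 < e' by rewrite divr_gt0// mulr_gt0.
  have e'20 : 0 < e' / 2 by rewrite divr_gt0.
  have [d1 d10 hd1] : exists2 d, 0 < d & forall s t x, unit_itv s -> unit_itv t -> unit_itv x ->
     `|s - x| < d -> `|t - x| < d ->
     artanh (cabs (g t)) - artanh (cabs (g s)) <=
       lambda_disk (g x) * cabs (g t - g s) + e' * cabs (g t - g s).
    apply: unit_itv_uniform => x0 ux0; have Dx0 : cabs (g x0) < 1 := Dg x0 ux0.
    have h01 : 0 <= cabs (g x0) < 1 by rewrite cabs_ge0.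
    have [d d0 hd] := artanh_strict h01 e'20.
    have /nbhs_cabsP[d2 d20 hd2] := (@cvgrPdist_lt _ _ _ (nbhs (g x0)) (nbhs_filter _) _ _).1
      (lambda_disk_cont Dx0) _ e'20.
    have [d3 d30 hd3] := cg x0 ux0 (Num.min d d2) ltac:(by rewrite lt_min d0).
    exists d3 => // s t x us ut ux sx tx xx.
    have := hd3 s us sx; rewrite lt_min => /andP[s1 _].
    have := hd3 t ut tx; rewrite lt_min => /andP[t1 _].
    have := hd3 x ux xx; rewrite lt_min => /andP[_ x2].
    have k1 := hd _ _ (le_lt_trans (cabs_subl _ _) s1) (le_lt_trans (cabs_subl _ _) t1).
    have k2 := hd2 _ x2.
    have k3 := cabs_subl (g t) (g s).
    have l0 := lambda_disk_gt0 Dx0.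
    rewrite -/(lambda_disk (g x0)) in k1.
    set l := lambda_disk (g x0) in k1 k2 l0 *.
    set lx := lambda_disk (g x) in k2 *.
    set n := cabs (g t - g s) in k3 *.
    set p := artanh (cabs (g t)) in k1 *; set q := artanh (cabs (g s)) in k1 *.
    move: k1 k3; set m := cabs (g t) - cabs (g s) => k1 k3.
    have a1 := le_trans (ler_norm _) k1.
    have a2 := ler_norm m.
    move: k2; rewrite ltr_norml => /andP[_ k2].
    have n0 : 0 <= n by exact: cabs_ge0.
    have b1 : l * m <= l * n by rewrite ler_pM2l//; lra.
    have b2 : e' / 2 * `|m| <= e' / 2 * n by rewrite ler_pM2l.
    have b3 : l * n <= (lx + e' / 2) * n by rewrite ler_wpM2r//; lra.
    rewrite mulrDl in b3; lra.
  have e20 : 0 < e / 2 by rewrite divr_gt0.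
  have [d2 d20 hd2] := hI _ e20.
  have [s ps hs] := @fine_partition R (Num.min d1 d2) ltac:(by rewrite lt_min d10).
  pose xi k := nth 0 (0 :: s) k.
  have hI' : `|arc_riemann_sum (@lambda_disk R) g s xi - I| < e / 2.
    apply: hd2 => // k ks; have := hs k ks; rewrite lt_min => /andP[_ ->].
    by have [_ _ h] := itv_partition_step ps ks; rewrite /xi lexx ltW.
  have tel := partition_telescope (fun x => artanh (cabs (g x))) ps.
  rewrite g0 g1 cabs0 artanh0 subr0 in tel.
  have : artanh (cabs w) <= arc_riemann_sum (@lambda_disk R) g s xi + e' * polygon_length g s.
    rewrite -tel /arc_riemann_sum /polygon_length big_distrr -big_split /= !big_nat.
    apply: ler_sum => k ks.
    have [u1 u2 u12] := itv_partition_step ps ks.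
    apply: hd1 => //; first by rewrite subrr normr0.
    have := hs k ks; rewrite lt_min => /andP[h _].
    by rewrite gtr0_norm// subr_gt0.
  have h3 : e' * polygon_length g s <= e / 2.
    apply: (@le_trans _ _ (e' * (`|M| + 1))).
      by rewrite ler_pM2l//; have := hM s ps; have := ler_norm M; lra.
    by rewrite le_eqVlt; apply/orP; left; apply/eqP; rewrite /e'; field; rewrite gt_eqF.
  move: hI'; rewrite ltr_norml => /andP[_ h4]; lra.
have att : S (artanh (cabs w)).
  exists (fun t => t%:C * w).
  have cE t : unit_itv t -> cabs (t%:C * w) = t * cabs w.
    by move=> /unit_itvE/andP[t0 _]; rewrite cabsM cabs_rC ger0_norm.
  have Dt t : unit_itv t -> D (t%:C * w).
    move=> ut; rewrite /disk /= cE//; move: ut => /unit_itvE/andP[t0 t1]; nra.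
  have dE s t : s <= t -> cabs (t%:C * w - s%:C * w) = (t - s) * cabs w.
    by move=> st; rewrite -mulrBl -rmorphB cabsM cabs_rC ger0_norm// subr_ge0.
  have cg t : {for t, continuous (fun t : R => t%:C * w)}.
    by apply: contM; [exact: cont_rC|exact: cont_cst].
  split.
  + split.
    * by apply: continuous_subspaceT => t; exact: cg.
    * by move=> t; exact: Dt.
    * by rewrite mul0r.
    * by rewrite mul1r.
  + exists (cabs w) => s ps; rewrite /polygon_length.
    have tel := partition_telescope (fun x => x * cabs w) ps.
    rewrite mul0r mul1r subr0 in tel; rewrite -tel le_eqVlt; apply/orP; left.
    apply/eqP; rewrite !big_nat; apply: eq_bigr => k ks.
    by have [_ _ h] := itv_partition_step ps ks; rewrite dE ?mulrBl// ltW.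
  + move=> e e0.
    have e40 : 0 < e / 4 by rewrite divr_gt0.
    have [d d0 hd] : exists2 d, 0 < d & forall s t x, unit_itv s -> unit_itv t -> unit_itv x ->
       `|s - x| < d -> `|t - x| < d ->
       s <= t -> `|lambda_disk (x%:C * w) * cabs (t%:C * w - s%:C * w) -
          (artanh (t * cabs w) - artanh (s * cabs w))| <= e / 2 * (t - s).
      apply: unit_itv_uniform => x0 ux0.
      have Dx0 := Dt _ ux0.
      have h01 : 0 <= x0 * cabs w < 1 by rewrite -cE// cabs_ge0.
      have [d d0 hd] := artanh_strict h01 e40.
      have cl : {for x0, continuous (fun t : R => lambda_disk (t%:C * w))}.
        by apply: (contcomp (cg x0)); exact: lambda_disk_cont.
      have /nbhs_realP[d2 d20 hd2] := (@cvgrPdist_lt _ _ _ (nbhs x0) (nbhs_filter _) _ _).1 cl _ e40.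
      exists (Num.min d d2); first by rewrite lt_min d0.
      move=> s t x us ut ux; rewrite !lt_min => /andP[s1 _] /andP[t1 _] /andP[_ x2] st.
      have cw y : `|y - x0| < d -> `|y * cabs w - x0 * cabs w| < d.
        move=> yd; rewrite -mulrBl normrM (ger0_norm w0).
        by have := normr_ge0 (y - x0); nra.
      have k1 := hd _ _ (cw s s1) (cw t t1); have k2 := hd2 x x2.
      have lE : (1 - (x0 * cabs w) ^+ 2)^-1 = lambda_disk (x0%:C * w).
        by rewrite /lambda_disk cE.
      rewrite lE -(mulrBl (cabs w) t s) in k1; rewrite dE//.
      set l0 := lambda_disk (x0%:C * w) in k1 k2.
      set lx := lambda_disk (x%:C * w) in k2 *.
      move: k1; set P := artanh (t * cabs w) - artanh (s * cabs w) => k1.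
      have n0 : 0 <= (t - s) * cabs w by rewrite mulr_ge0// subr_ge0.
      rewrite (ger0_norm n0) in k1.
      have split2 : lx * ((t - s) * cabs w) - P =
        (lx - l0) * ((t - s) * cabs w) - (P - l0 * ((t - s) * cabs w)) by ring.
      rewrite split2; apply: le_trans (ler_normB _ _) _.
      rewrite normrM (ger0_norm n0).
      have n1 : (t - s) * cabs w <= t - s by rewrite ler_piMr ?subr_ge0// ltW.
      have b1 : `|lx - l0| * ((t - s) * cabs w) <= e / 4 * (t - s).
        by apply: ler_pM => //; rewrite distrC ltW.
      have b2 : e / 4 * ((t - s) * cabs w) <= e / 4 * (t - s) by rewrite ler_pM2l.
      lra.
    exists d => // s xi ps hs.
    have tel := partition_telescope (fun x => artanh (x * cabs w)) ps.
    rewrite mul0r mul1r artanh0 subr0 in tel.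
    rewrite -tel /arc_riemann_sum -sumrB.
    apply: le_lt_trans (ler_norm_sum _ _ _) _.
    apply: (@le_lt_trans _ _ (\sum_(0 <= k < size s) e / 2 * (nth 0 s k - nth 0 (0 :: s) k))).
      rewrite !big_nat; apply: ler_sum => k ks.
      have [p1 /andP[x1 x2]] := hs k ks.
      have [u1 u2 u12] := itv_partition_step ps ks.
      have ux : unit_itv (xi k).
        move: u1 u2 => /unit_itvE/andP[a1 a2] /unit_itvE/andP[b1 b2].
        by apply/unit_itvE; rewrite (le_trans a1 x1) (le_trans x2 b2).
      by apply: hd => //; [rewrite ltr_norml; apply/andP; split; lra|
        rewrite ltr_norml; apply/andP; split; lra|exact: ltW].
    rewrite -big_distrr /= (partition_telescope id ps) subr0 mulr1; lra.
rewrite /hyp_dist_disk /density_dist -/S; apply/eqP; rewrite eq_le; apply/andP; split.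
  by apply: ge_inf => //; exists (artanh (cabs w)) => I; exact: low.
by apply: lb_le_inf; [exists (artanh (cabs w))|move=> I; exact: low].
Qed.

End DensityDistance.

(** * The backward flow on a petal *)

Section LimitTools.
Variable R : realType.
Implicit Types (a z w : R[i]).
Local Notation D := (@disk R).

Lemma lim_eq T (F : set_system T) (FF : ProperFilter F) (u v : T -> R[i]) (l m : R[i]) :
  u @ F --> l -> v @ F --> m -> (\forall t \near F, u t = v t) -> l = m.
Proof.
move=> ul vm uv; apply: eq_of_cabs_le => e e0.
apply: (@lim_cabs_le _ _ F FF (fun t => u t - v t)); first exact: (cvgB ul vm).
by apply: filterS uv => t ->; rewrite subrr cabs0 ltW.
Qed.

Lemma mob0l z : mob 0 z = z.
Proof. by rewrite /mob subr0 rmorph0 mul0r subr0 divr1. Qed.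

Lemma mob_mob a z w : D a -> D z -> D w ->
  cabs (mob (mob a w) (mob a z)) = cabs (mob w z).
Proof.
move=> Da Dz Dw; have DNa := diskN Da; apply/eqP; rewrite eq_le; apply/andP; split.
  by apply: schwarz_pick => //; [exact: mob_hol|move=> u; exact: mob_disk].
have := schwarz_pick (mob_hol DNa) (fun u => mob_disk DNa) (mob_disk Da Dz) (mob_disk Da Dw).
by rewrite !mobK.
Qed.

Lemma mob_derive_center a : D a -> cabs (derive1 (mob a) a) = lambda_disk a.
Proof.
move=> Da; have := disk_auto_isometry (mob_auto Da) Da.
by rewrite mobxx {1}/lambda_disk cabs0 expr0n subr0 invr1 mul1r.
Qed.

(** A monotone function converges at infinity as soon as it does so along one
    finer filter. *)
Lemma monotone_ultra (F : set_system R) (FF : ProperFilter F) (u : R -> R) (l : R) :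
  (forall s, F [set t | s <= t]) ->
  (forall s t, 0 <= s -> s <= t -> u s <= u t) ->
  (forall e, 0 < e -> \forall t \near F, `|u t - l| < e) ->
  forall e, 0 < e -> exists2 s, 0 <= s & forall t, s <= t -> `|u t - l| < e.
Proof.
move=> Fge um ul e e0.
have [s [su s0]] := filter_ex (filterI (ul e e0) (Fge 0)).
have ub t : 0 <= t -> u t <= l.
  move=> t0; apply/ler_addgt0Pr => d d0.
  have [r [ru rt]] := filter_ex (filterI (ul d d0) (Fge t)).
  move: ru; rewrite /= ltr_norml => /andP[_ ru].
  by apply: le_trans (um _ _ t0 rt) _; lra.
exists s => // t st; have t0 := le_trans s0 st.
move: su; rewrite /= !ltr_norml => /andP[su _].
by have := um _ _ s0 st; have := ub t t0; move=> h1 h2; apply/andP; split; lra.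
Qed.

End LimitTools.

Section Petal.
Variables (R : realType) (phi : R -> R[i] -> R[i]) (Delta : set R[i]).
Hypotheses (hsg : semigroup phi) (hpet : petal phi Delta).
Local Notation D := (@disk R).
Local Notation W := (backward_invariant_set phi).

Definition backflow (t : R) := petal_flow phi Delta (- t).

Lemma petal_interior z : Delta z -> interior W z.
Proof. by have [z0 _ ->] := petal_component hpet; exact: connected_component_sub. Qed.

Lemma petal_W z : Delta z -> W z.
Proof. by move/petal_interior; exact: interior_subset. Qed.

Lemma petal_disk z : Delta z -> D z.
Proof.
move=> /petal_W /(_ 0) []; first by rewrite /= lexx.
by move=> w Dw <-; rewrite (semigroup_id hsg Dw).
Qed.

Lemma petal_path (g : R -> R[i]) z w : Delta z -> g 0 = z -> g 1 = w ->
  (forall t, 0 <= t <= 1 -> {for t, continuous g} /\ interior W (g t)) -> Delta w.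
Proof.
move=> Dz g0 g1 hg.
have [z1 _ DE] := petal_component hpet.
have e : connected_component (interior W) z1 = connected_component (interior W) z.
  by apply: same_connected_component; rewrite -DE.
rewrite DE e; apply: (@connected_component_max _ _ (g @` `[0, 1])).
- by exists 0 => //; rewrite /= in_itv /= lexx ler01.
- by move=> _ [t + <-]; rewrite /= in_itv /= => /hg[].
- apply: connected_continuous_connected; first exact: segment_connected.
  by apply: continuous_in_subspaceT => t; rewrite inE /= in_itv /= => /hg[].
- by exists 1 => //; rewrite /= in_itv /= lexx ler01.
Qed.

Lemma petal_open z : Delta z -> exists2 r : R, 0 < r & forall w, open_disk z r w -> Delta w.
Proof.
move=> Dz; have /nbhs_interior/nbhs_cabsP[r r0 hr] := petal_interior Dz.
exists r => // w wz.
apply: (petal_path (g := fun t : R => z + t%:C * (w - z)) Dz); first by rewrite mul0r addr0.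
  by rewrite mul1r subrKC.
move=> t /andP[t0 t1]; split.
  apply: contD; first exact: cont_cst.
  by apply: contM; [exact: cont_rC|exact: cont_cst].
apply: hr; rewrite addrC addKr cabsM cabs_rC ger0_norm//.
by apply: le_lt_trans wz; rewrite ler_piMl ?cabs_ge0.
Qed.

Lemma backflow_petal t z : Delta z -> Delta (backflow t z).
Proof. by move: z; have [_ [h _ _]] := petal_automorphism hpet (- t); exact: h. Qed.

Lemma backflow_disk t z : Delta z -> D (backflow t z).
Proof. by move/(backflow_petal t)/petal_disk. Qed.

Lemma backflow_hol t : holomorphic_on Delta (backflow t).
Proof. by have [] := petal_automorphism hpet (- t). Qed.

Lemma backflow_hol_into_disk t z r : (forall w, open_disk z r w -> Delta w) -> hol_into_disk (backflow t) z r.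
Proof. by move=> h w /h Dw; split; [exact: backflow_hol|exact: backflow_disk]. Qed.

Lemma backflow_phi s t z : 0 <= s -> s <= t -> Delta z -> backflow s z = phi (t - s) (backflow t z).
Proof.
move=> s0 st Dz; have := petal_group hpet (t - s) (- t) Dz.
rewrite (_ : t - s - t = - s); last by ring.
by rewrite -/(backflow s) -/(backflow t) => ->; rewrite {1}/petal_flow subr_ge0 st.
Qed.

Lemma phi_backflow t z : 0 <= t -> Delta z -> phi t (backflow t z) = z.
Proof.
move=> t0 Dz; have := backflow_phi (lexx 0) t0 Dz; rewrite subr0 => <-.
by rewrite /backflow oppr0 /petal_flow lexx (semigroup_id hsg (petal_disk Dz)).
Qed.

Lemma phi_disk t : 0 <= t -> forall z, D z -> D (phi t z).
Proof. by move=> t0 z; exact: semigroup_maps hsg t t0 z. Qed.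

Lemma phi_hol t : 0 <= t -> holomorphic_on D (phi t).
Proof. exact: semigroup_holo hsg t. Qed.

Lemma backflow_pseudo_mono z w s t : Delta z -> Delta w -> 0 <= s -> s <= t ->
  cabs (mob (backflow s z) (backflow s w)) <= cabs (mob (backflow t z) (backflow t w)).
Proof.
move=> Dz Dw s0 st; rewrite (backflow_phi s0 st Dz) (backflow_phi s0 st Dw).
have ts0 : 0 <= t - s by rewrite subr_ge0.
by apply: schwarz_pick (phi_hol ts0) (phi_disk ts0) _ _; exact: backflow_disk.
Qed.

Definition flow_density t z := lambda_disk (backflow t z) * cabs (derive1 (backflow t) z).

Lemma flow_density_mono z s t : Delta z -> 0 <= s -> s <= t ->
  flow_density s z <= flow_density t z.
Proof.
move=> Dz s0 st; have ts0 : 0 <= t - s by rewrite subr_ge0.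
have [r r0 hr] := petal_open Dz.
have Dt := backflow_disk t Dz.
have h1 := derivable_cdiff (backflow_hol (t := t) Dz).
have h2 := derivable_cdiff (phi_hol ts0 Dt).
have h3 : cdiff (backflow s) z (derive1 (phi (t - s)) (backflow t z) * derive1 (backflow t) z).
  apply: cdiff_near r0 _ (cdiff_comp h1 h2) => w /hr Dw.
  by rewrite -backflow_phi.
rewrite /flow_density (cdiff_derive1 h3) cabsM mulrA ler_wpM2r ?cabs_ge0//.
rewrite (backflow_phi s0 st Dz).
exact: schwarz_pick_density (phi_hol ts0) (phi_disk ts0) Dt.
Qed.

Section Uniformization.
Variable z0 : R[i].
Hypothesis Dz0 : Delta z0.

Let b t := backflow t z0.
Let Ft t z := mob (b t) (backflow t z).
Let Gt t w := phi t (mob (- b t) w).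

Let Db t : D (b t). Proof. exact: backflow_disk. Qed.
Let DNb t : D (- b t). Proof. exact: diskN. Qed.

Let Gt_hol t : 0 <= t -> holomorphic_on D (Gt t).
Proof. by move=> t0; apply: hol_comp_mob => //; exact: phi_hol. Qed.

Let Gt_disk t z : 0 <= t -> D z -> D (Gt t z).
Proof. by move=> t0 Dz; apply: phi_disk => //; exact: mob_disk. Qed.

Let Gt0 t : 0 <= t -> Gt t 0 = z0.
Proof. by move=> t0; rewrite /Gt mob0 opprK phi_backflow. Qed.

Let Ft_disk t z : Delta z -> D (Ft t z).
Proof. by move=> Dz; apply: mob_disk => //; exact: backflow_disk. Qed.

Let Ft_hol_into_disk t z r : (forall w, open_disk z r w -> Delta w) -> hol_into_disk (Ft t) z r.
Proof.
move=> h w /h Dw; split; last exact: Ft_disk.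
have h1 := derivable_cdiff (backflow_hol (t := t) Dw).
exact: cdiff_derivable (cdiff_comp h1 (cdiff_mob (Db t) (backflow_disk t Dw))).
Qed.

Let GtFt t z : 0 <= t -> Delta z -> Gt t (Ft t z) = z.
Proof. by move=> t0 Dz; rewrite /Gt /Ft mobK ?phi_backflow//; exact: backflow_disk. Qed.

Let Ft_pseudo t z w : Delta z -> Delta w ->
  cabs (mob (Ft t z) (Ft t w)) = cabs (mob (backflow t z) (backflow t w)).
Proof. by move=> Dz Dw; apply: mob_mob => //; exact: backflow_disk. Qed.

Let Ft_derive t : cabs (derive1 (Ft t) z0) = flow_density t z0.
Proof.
have h1 := derivable_cdiff (backflow_hol (t := t) Dz0).
have h2 : cdiff (mob (b t)) (backflow t z0) (derive1 (mob (b t)) (backflow t z0)).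
  exact: derivable_cdiff (mob_hol (Db t) (backflow_disk t Dz0)).
rewrite (cdiff_derive1 (cdiff_comp h1 h2)) cabsM /flow_density.
congr (_ * _); exact: mob_derive_center (Db t).
Qed.

(** With [b t = backflow t z0], the maps [Ft t = mob (b t) \o backflow t] of the
    petal into the disk and the self-maps [Gt t = phi t \o mob (- b t)] of the
    disk satisfy [Gt t \o Ft t = id] and [Gt t 0 = z0]. They converge along an
    ultrafilter, to [F] and [G]. Every [phi s] can be factored out of [G], so
    [G] takes its values in the backward invariant set; being open, it maps the
    disk into the petal. There [G \o F = id] by continuity, and [F \o G = id] by
    the equality case of the Schwarz lemma. *)
Theorem petal_uniformization : exists F G : R[i] -> R[i],
  [/\ [/\ holomorphic_on Delta F, holomorphic_on D G, set_fun Delta D F & set_fun D Delta G],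
      forall z, Delta z -> G (F z) = z, forall w, D w -> F (G w) = w, F z0 = 0 &
      (forall e : R, 0 < e -> exists2 s, 0 <= s & forall t, s <= t ->
         `|flow_density t z0 - cabs (derive1 F z0)| < e) /\
      (forall w, Delta w -> forall e : R, 0 < e -> exists2 s, 0 <= s & forall t, s <= t ->
         `|cabs (mob (backflow t z0) (backflow t w)) - cabs (F w)| < e)].
Proof.
have [U [UU Uoo]] := @ultraFilterLemma R (nbhs +oo%R) _.
have Uge s : U [set t | s <= t] by apply: Uoo; exact: nbhs_pinfty_ge (num_real s).
have /choice[F hF] : forall z, exists l : R[i], Delta z ->
    cabs l <= 1 /\ Ft t z @[t --> U] --> l.
  move=> z; have [Dz|nDz] := pselect (Delta z); last by exists 0.
  have [|l l1 hl] := @ultra_lim R _ U UU (fun t => Ft t z) 1; last by exists l.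
  by apply: filterE => t; exact/ltW/Ft_disk.
have /choice[G hG] : forall z, exists l : R[i], D z ->
    cabs l <= 1 /\ Gt t z @[t --> U] --> l.
  move=> z; have [Dz|nDz] := pselect (D z); last by exists 0.
  have [|l l1 hl] := @ultra_lim R _ U UU (fun t => Gt t z) 1; last by exists l.
  by apply: filterS (Uge 0) => t t0; exact/ltW/Gt_disk.
(* Schwarz-Pick bounds the distance to the common value at 0, which keeps limits inside *)
have lim_self (f : R -> R[i] -> R[i]) c w l : D c -> D w -> cabs l <= 1 ->
    (\forall t \near U, [/\ holomorphic_on D (f t), forall z, D z -> D (f t z) & f t 0 = c]) ->
    f t w @[t --> U] --> l -> D l.
  move=> Dc Dw l1 hf fl.
  have [] // := @limit_in_disk R _ U _ (fun t => f t w) (fun=> c) l c (cabs w) fl (cvg_cst c) Dc l1 Dw.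
  apply: filterS hf => t [h1 h2 h3]; split; first exact: h2.
  split=> //; have := schwarz_pick h1 h2 Dw (disk0 R).
  by rewrite h3 mob0l.
have GD w : D w -> D (G w).
  move=> Dw; have [h1 h2] := hG w Dw.
  apply: (lim_self Gt z0 w) => //; first exact: petal_disk.
  apply: filterS (Uge 0) => t t0; split; [exact: Gt_hol|by move=> z; exact: Gt_disk|exact: Gt0].
have Ghol : holomorphic_on D G.
  move=> w Dw; have [r r0 hr] := disk_ball Dw.
  have [|u /hr Du|h _] := @limit_hol R _ U UU Gt G w r r0.
  - by apply: filterS (Uge 0) => t t0 u /hr Du; split; [exact: Gt_hol|exact: Gt_disk].
  - by have [] := hG u Du.
  - exact: cdiff_derivable h.
have GW w : D w -> W (G w).
  move=> Dw s /= s0.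
  (* [Gt t = phi s \o H t], and [H t] also sends 0 to a point that does not depend on [t] *)
  pose H t u := phi (t - s) (mob (- b t) u).
  have HP t : s <= t -> [/\ holomorphic_on D (H t), forall z, D z -> D (H t z) & H t 0 = backflow s z0].
    move=> st; have ts0 : 0 <= t - s by rewrite subr_ge0.
    split.
    - exact: hol_comp_mob (DNb t) (phi_hol ts0).
    - by move=> z Dz; apply: (phi_disk ts0); exact: mob_disk.
    - by rewrite /H mob0 opprK -backflow_phi.
  have [|l l1 hl] := @ultra_lim R _ U UU (fun t => H t w) 1.
    by apply: filterS (Uge s) => t /HP[_ h _]; exact/ltW/h.
  have Dl : D l.
    apply: (lim_self H (backflow s z0) w) => //; first exact: backflow_disk.
    by apply: filterS (Uge s) => t /HP.
  exists l => //.
  have c1 : phi s (H t w) @[t --> U] --> phi s l.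
    by apply: (cvg_comp _ _ hl); exact: derivable_cont (phi_hol s0 Dl).
  apply: (lim_eq _ c1 (hG w Dw).2).
  apply: filterS (Uge s) => t st; rewrite /H /Gt -(semigroup_add hsg) ?subr_ge0//.
    by rewrite subrKC.
  exact: mob_disk.
have Fstep z r w : open_disk z r `<=` Delta -> 0 < r -> cabs (w - z) < r / 2 -> D (F z) <-> D (F w).
  move=> zr r0 wz.
  have Dz : Delta z by apply: zr; rewrite /open_disk /= subrr cabs0.
  have zw : open_disk z r w by rewrite /open_disk /=; lra.
  have Dw : Delta w := zr w zw.
  have p12 t : cabs (mob (Ft t z) (Ft t w)) <= 1 / 2.
    rewrite Ft_pseudo//; apply: le_trans (schwarz_pick_ball r0 (backflow_hol_into_disk t zr) zw) _.
    by rewrite ler_pdivrMr//; lra.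
  have [z1 z2] := hF z Dz; have [w1 w2] := hF w Dw.
  have h12 : 1 / 2 < 1 :> R by lra.
  split=> h.
  - have [] // := @limit_in_disk R _ U _ (Ft^~ w) (Ft^~ z) _ _ (1 / 2) w2 z2 h w1 h12.
    by apply: filterE => t; split; [exact: Ft_disk|split; [exact: Ft_disk|exact: p12]].
  - have [] // := @limit_in_disk R _ U _ (Ft^~ z) (Ft^~ w) _ _ (1 / 2) z2 w2 h z1 h12.
    apply: filterE => t; split; [exact: Ft_disk|split; [exact: Ft_disk|]].
    by rewrite mob_sym; exact: p12.
have F0 : F z0 = 0.
  have [_ h] := hF z0 Dz0.
  apply: (lim_eq _ h (cvg_cst 0)); apply: filterE => t.
  by rewrite /Ft mobxx.
have FD z : Delta z -> D (F z).
  (* by [Fstep] the points with [F z] inside the disk, and the others, form open sets *)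
  pose B := [set z | Delta z /\ D (F z)].
  suff BE : B = Delta by rewrite -BE => -[].
  have cD : connected Delta.
    by have [z1 _ ->] := petal_component hpet; exact: component_connected.
  apply: cD.
  - by exists z0; split=> //; rewrite F0; exact: disk0.
  - exists B; last by apply/seteqP; split=> [w [? ?]|w [_ //]]; split.
    rewrite openE => w [Dw DFw]; have [r r0 hr] := petal_open Dw.
    apply/nbhs_cabsP; exists (r / 2); first by rewrite divr_gt0.
    move=> u uw; split; first by apply: hr; rewrite /open_disk /=; lra.
    by apply/(Fstep w r u hr r0 uw).
  - exists (~` [set w | Delta w /\ ~ D (F w)]).
      apply: open_closedC; rewrite openE => w [Dw DFw]; have [r r0 hr] := petal_open Dw.
      apply/nbhs_cabsP; exists (r / 2); first by rewrite divr_gt0.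
      move=> u uw; split; first by apply: hr; rewrite /open_disk /=; lra.
      by move/(Fstep w r u hr r0 uw).
    apply/seteqP; split=> w; first by move=> [Dw DFw]; split=> // -[].
    by move=> [Dw nw]; split=> //; apply: contrapT => h; apply: nw.
have Flim z : Delta z -> cdiff F z (derive1 F z) /\
    derive1 (Ft t) z @[t --> U] --> derive1 F z.
  move=> Dz; have [r r0 hr] := petal_open Dz.
  apply: (@limit_hol R _ U UU Ft F z r r0); first by apply: filterE => t; exact: Ft_hol_into_disk.
  by move=> u /hr Du; have [] := hF u Du.
have Fhol : holomorphic_on Delta F by move=> z /Flim[/cdiff_derivable].
have GF z : Delta z -> G (F z) = z.
  move=> Dz; have DF := FD z Dz; have [_ h2] := hF z Dz.
  have q0 : 0 < 1 - cabs (F z) by rewrite subr_gt0.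
  have c1 : Gt t (F z) @[t --> U] --> z.
    apply/cvg_cabsP => e e0.
    have e20 : 0 < e / 2 * (1 - cabs (F z)) by rewrite mulr_gt0// divr_gt0.
    have /cvg_cabsP/(_ _ e20) h3 := h2.
    apply: filterS (filterI (Uge 0) h3) => t [/= t0 ht].
    have DFt := Ft_disk t Dz.
    rewrite -{2}(GtFt t0 Dz).
    apply: le_lt_trans (mob_ge (Gt_disk t0 DFt) (Gt_disk t0 DF)) _.
    apply: (@le_lt_trans _ _ (2 * cabs (mob (F z) (Ft t z)))).
      rewrite ler_pM2l// [X in _ <= X]mob_sym.
      exact: schwarz_pick (Gt_hol t0) (fun u => Gt_disk t0) DF DFt.
    have := mob_le DF DFt.
    have : cabs (Ft t z - F z) / (1 - cabs (F z)) < e / 2 by rewrite ltr_pdivrMr.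
    lra.
  by apply: (lim_eq _ (hG _ DF).2 c1); exact: filterE.
have G0 : G 0 = z0 by rewrite -F0 GF.
have Gopen w : D w -> interior W (G w).
  move=> Dw.
  have [r r0 hr] := petal_open Dz0.
  have Dz1 : Delta (z0 + (r / 2)%:C).
    by apply: hr; rewrite /open_disk /= addrC addKr cabs_rC gtr0_norm ?divr_gt0//; lra.
  have z10 : z0 + (r / 2)%:C != z0.
    by rewrite -subr_eq0 addrC addKr -cabs_gt0 cabs_rC gtr0_norm divr_gt0.
  have [|d d0 hd] := open_at Ghol GD Dw.
    have [e|ne] := eqVneq (G w) z0.
      by exists (F (z0 + (r / 2)%:C)); [exact: FD|rewrite GF// e].
    by exists (F z0); [exact: FD|rewrite GF// eq_sym].
  by apply/nbhs_cabsP; exists d => // u /hd[v Dv <-]; exact: GW.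
have GDelta w : D w -> Delta (G w).
  move=> Dw; apply: (petal_path (g := fun t : R => G (t%:C * w)) Dz0).
  - by rewrite mul0r.
  - by rewrite mul1r.
  - move=> t /andP[t0 t1].
    have Dt : D (t%:C * w).
      rewrite /disk /= cabsM cabs_rC ger0_norm//.
      by have w1 : cabs w < 1 := Dw; have := cabs_ge0 w; nra.
    split; last exact: Gopen.
    apply: (contcomp (f := fun t : R => t%:C * w)).
      by apply: contM; [exact: cont_rC|exact: cont_cst].
    exact: derivable_cont (Ghol _ Dt).
have FG w : D w -> F (G w) = w.
  have dF := (Flim z0 Dz0).1.
  have dG : cdiff G (F z0) (derive1 G 0).
    by rewrite F0; exact/derivable_cdiff/Ghol/disk0.
  have dG0 : cdiff G 0 (derive1 G 0) by exact/derivable_cdiff/Ghol/disk0.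
  have dFG : cdiff F (G 0) (derive1 F z0) by rewrite G0.
  have [r r0 hr] := petal_open Dz0.
  have id1 : cdiff (fun z => z) z0 (derive1 G 0 * derive1 F z0).
    by apply: cdiff_near r0 _ (cdiff_comp dF dG) => u /hr/GF.
  have one := cdiff_uniq id1 (cdiff_id z0).
  have h1 : holomorphic_on D (fun u => F (G u)).
    move=> u Du; apply: cdiff_derivable.
    exact: cdiff_comp (derivable_cdiff (Ghol u Du)) (derivable_cdiff (Fhol _ (GDelta u Du))).
  have h2 u : D u -> D (F (G u)) by move=> /GDelta/FD.
  have h3 : F (G 0) = 0 by rewrite G0.
  have h4 : derive1 (fun u => F (G u)) 0 = 1.
    by rewrite (cdiff_derive1 (cdiff_comp dG0 dFG)) mulrC.
  exact: (schwarz_rigid h1 h2 h3 h4).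
exists F, G; split; [by split|exact: GF|exact: FG|exact: F0|split].
- move=> e e0; apply: (@monotone_ultra R U _ (flow_density^~ z0) _ Uge) e0.
    by move=> s t; exact: flow_density_mono.
  move=> e' e'0; have /cvg_cabsP/(_ e' e'0) h := (Flim z0 Dz0).2.
  apply: filterS h => t h; rewrite -Ft_derive.
  exact: le_lt_trans (cabs_subl _ _) h.
- move=> w Dw e e0.
  apply: (@monotone_ultra R U _ (fun t => cabs (mob (backflow t z0) (backflow t w))) _ Uge) e0.
    by move=> s t; exact: backflow_pseudo_mono.
  move=> e' e'0; have /cvg_cabsP/(_ e' e'0) h := (hF w Dw).2.
  apply: filterS h => t h; exact: le_lt_trans (cabs_subl _ _) h.
Qed.

End Uniformization.

End Petal.

(** * The hyperbolic density and the limits *)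

Section HyperbolicDensity.
Variable R : realType.
Local Notation D := (@disk R).

(** The chosen conformal map differs from [F] by a bijective self-map of the
    disk, which is an isometry by [disk_auto_isometry]. *)
Lemma hyp_density_eq (V : set R[i]) (F G : R[i] -> R[i]) z :
  holomorphic_on V F -> holomorphic_on D G -> set_fun V D F -> set_fun D V G ->
  (forall z, V z -> G (F z) = z) -> (forall w, D w -> F (G w) = w) -> V z ->
  hyp_density V z = lambda_disk (F z) * cabs (derive1 F z).
Proof.
move=> hF hG FD GV GF FG Vz; rewrite /hyp_density.
set f : R[i] -> R[i] := xget _ _.
have conf : conformal_onto V D f.
  rewrite /f; case: xgetP => [g -> //|/(_ F)]; case; split=> //; split=> //.
  - by move=> u v; rewrite !inE => Vu Vv e; rewrite -(GF u Vu) -(GF v Vv) e.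
  - by move=> w Dw; exists (G w); [exact: GV|exact: FG].
clearbody f; case: conf => hf [fD finj fsurj].
pose k w := f (G w).
have kau : disk_auto k.
  split.
  - move=> w Dw; apply: cdiff_derivable.
    exact: cdiff_comp (derivable_cdiff (hG w Dw)) (derivable_cdiff (hf _ (GV w Dw))).
  - by move=> w /GV/fD.
  - move=> u v; rewrite !inE => Du Dv /finj; rewrite !inE => /(_ (GV u Du) (GV v Dv)) e.
    by rewrite -(FG u Du) -(FG v Dv) e.
  - move=> w /fsurj[u Vu fu]; exists (F u); first exact: FD.
    by rewrite /k GF.
have DF := FD z Vz.
have dG := derivable_cdiff (hG _ DF).
have df : cdiff f (G (F z)) (derive1 f z) by rewrite (GF z Vz); exact: derivable_cdiff (hf z Vz).
have dF : cdiff F (G (F z)) (derive1 F z) by rewrite (GF z Vz); exact: derivable_cdiff (hF z Vz).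
have [r r0 hr] := disk_ball DF.
have id1 : cdiff (fun w => w) (F z) (derive1 F z * derive1 G (F z)).
  by apply: cdiff_near r0 _ (cdiff_comp dG dF) => w /hr/FG.
have one := cdiff_uniq id1 (cdiff_id (F z)).
have oneR : cabs (derive1 F z) * cabs (derive1 G (F z)) = 1 by rewrite -cabsM one cabs1.
have iso := disk_auto_isometry kau DF.
have kz : k (F z) = f z by rewrite /k GF.
have dk : derive1 k (F z) = derive1 f z * derive1 G (F z).
  exact: cdiff_derive1 (cdiff_comp dG df).
rewrite kz dk cabsM in iso.
have cancel (l x y u m : R) : l * (x * y) = m -> u * y = 1 -> l * x = m * u.
  by move=> <- uy; rewrite -!mulrA [y * u]mulrC uy mulr1.
exact: cancel iso oneR.
Qed.

End HyperbolicDensity.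

Section PetalLimit.
Variables (R : realType) (phi : R -> R[i] -> R[i]) (Delta : set R[i]).
Hypotheses (hsg : semigroup phi) (hpet : petal phi Delta).
Local Notation D := (@disk R).

Lemma flow_density_cvg z e : Delta z -> 0 < e -> exists2 s, 0 <= s &
  forall t, s <= t -> `|flow_density phi Delta t z - hyp_density Delta z| < e.
Proof.
move=> Dz e0.
have [F [G [[hF hG FD GD] GF FG F0 [lim1 _]]]] := petal_uniformization hsg hpet Dz.
have -> : hyp_density Delta z = cabs (derive1 F z).
  rewrite (hyp_density_eq hF hG FD GD GF FG Dz) F0 /lambda_disk cabs0.
  by rewrite expr0n subr0 invr1 mul1r.
exact: lim1.
Qed.

Lemma density_of_map_cont (f : R[i] -> R[i]) z : holomorphic_on Delta f ->
  set_fun Delta D f -> Delta z ->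
  {for z, continuous (fun w => lambda_disk (f w) * cabs (derive1 f w))}.
Proof.
move=> hf fD Dz; have [r r0 hr] := petal_open hpet Dz.
have hb : hol_into_disk f z r by move=> w /hr Dw; split; [exact: hf|exact: fD].
apply: (@cvgM _ _ _ (nbhs_filter z)).
  apply: (contcomp (derivable_cont (hf z Dz))); exact/lambda_disk_cont/fD.
by apply: (contcomp (derive_cont r0 hb)); exact: cont_cabs.
Qed.

Lemma hyp_density_cont z : Delta z -> {for z, continuous (hyp_density Delta)}.
Proof.
move=> Dz.
have [F [G [[hF hG FD GD] GF FG F0 _]]] := petal_uniformization hsg hpet Dz.
have c := density_of_map_cont hF FD Dz.
have [r r0 hr] := petal_open hpet Dz.
have eq w : open_disk z r w -> hyp_density Delta w = lambda_disk (F w) * cabs (derive1 F w).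
  by move=> /hr Dw; exact: (hyp_density_eq hF hG FD GD GF FG Dw).
have zz : open_disk z r z by rewrite /open_disk /= subrr cabs0.
apply/(@cvgrPdist_lt _ _ _ (nbhs z) (nbhs_filter z)) => e e0.
have /nbhs_cabsP[d d0 hd] := proj1 (@cvgrPdist_lt _ _ _ (nbhs z) (nbhs_filter z) _ _) c e e0.
apply/nbhs_cabsP; exists (Num.min r d); first by rewrite lt_min r0.
by move=> w; rewrite lt_min => /andP[w1 w2]; rewrite !eq//; exact: hd.
Qed.

(** Dini's argument: the densities increase to a continuous limit. *)
Lemma flow_density_unif (K : set R[i]) e : compact K -> K `<=` Delta -> 0 < e ->
  exists2 s, 0 <= s & forall t, s <= t -> forall z, K z ->
    `|hyp_density Delta z - flow_density phi Delta t z| < e.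
Proof.
move=> cK KD e0; have e40 : 0 < e / 4 by rewrite divr_gt0.
have upper t z : Delta z -> 0 <= t -> flow_density phi Delta t z <= hyp_density Delta z.
  move=> Dz t0; apply/ler_addgt0Pr => d d0.
  have [s s0 hs] := flow_density_cvg Dz d0.
  have := hs (Num.max s t); rewrite le_max lexx => /(_ isT).
  rewrite ltr_norml => /andP[_ h].
  have := flow_density_mono hsg hpet Dz t0 (_ : t <= Num.max s t).
  rewrite le_max lexx orbT => /(_ isT) h2; apply: le_trans h2 _.
  by rewrite -lerBlDl; exact: ltW.
have [|d d0 hd] := compact_small (P := fun a z => Delta z -> forall t, a^-1 <= t ->
    hyp_density Delta z - e < flow_density phi Delta t z) cK.
  move=> z /KD Dz; have [s s0 hs] := flow_density_cvg Dz e40.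
  have /nbhs_cabsP[d1 d10 hd1] := proj1 (@cvgrPdist_lt _ _ _ (nbhs z) (nbhs_filter z) _ _)
     (hyp_density_cont Dz) _ e40.
  have cf : {for z, continuous (flow_density phi Delta s)}.
    apply: density_of_map_cont => //; first exact: backflow_hol.
    by move=> w; exact: backflow_disk.
  have /nbhs_cabsP[d2 d20 hd2] := proj1 (@cvgrPdist_lt _ _ _ (nbhs z) (nbhs_filter z) _ _)
     cf _ e40.
  have s10 : 0 < s + 1 by lra.
  exists (Num.min (s + 1)^-1 (Num.min d1 d2)); first by rewrite !lt_min invr_gt0 s10 d10.
  move=> a w /andP[a0]; rewrite !lt_min => /andP[a1 _] /and3P[_ w1 w2] Dw t ta.
  have st : s <= t.
    apply: le_trans ta; apply: (@le_trans _ _ (s + 1)); first by lra.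
    by rewrite -[s + 1]invrK lef_pV2 ?posrE ?invr_gt0// ltW.
  have := flow_density_mono hsg hpet Dw s0 st.
  have := hs s (lexx s); have := hd1 w w1; have := hd2 w w2.
  move: (hyp_density Delta z) (hyp_density Delta w) (flow_density phi Delta s z)
    (flow_density phi Delta s w) (flow_density phi Delta t w) => Hz Hw fz fw ft.
  rewrite !ltr_norml => /andP[k1 k2] /andP[k3 k4] /andP[k5 k6]; lra.
have d20 : 0 < d / 2 by rewrite divr_gt0.
have d2d : 0 < d / 2 < d by apply/andP; split; lra.
exists (d / 2)^-1; first by rewrite invr_ge0 ltW.
move=> t ts z Kz; have Dz := KD z Kz.
have t0 : 0 <= t by apply: le_trans ts; rewrite invr_ge0 ltW.
have := hd _ d2d z Kz Dz t ts; have := upper t z Dz t0.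
move: (hyp_density Delta z) (flow_density phi Delta t z) => Hz ft.
by rewrite ltr_norml => h1 h2; apply/andP; split; lra.
Qed.

Lemma hyp_dist_petal_cvg z w e : Delta z -> Delta w -> 0 < e -> exists2 s, 0 <= s &
  forall t, s <= t -> `|hyp_dist_disk (backflow phi Delta t z) (backflow phi Delta t w) -
    hyp_dist Delta z w| < e.
Proof.
move=> Dz Dw e0.
have [F [G [[hF hG FD GD] GF FG F0 [_ lim2]]]] := petal_uniformization hsg hpet Dz.
have dens u : Delta u -> hyp_density Delta u = lambda_disk (F u) * cabs (derive1 F u).
  by move=> Du; exact: (hyp_density_eq hF hG FD GD GF FG Du).
have DFw := FD w Dw.
have -> : hyp_dist Delta z w = artanh (cabs (F w)).
  rewrite -(hyp_dist_disk0 DFw) -F0.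
  apply: (density_dist_transfer (h := G)).
  - move=> u Du; have [r r0 hr] := petal_open hpet Du.
    by exists r => // v /hr Dv; split; [exact: hF|exact: FD].
  - move=> u Du; apply: (self_map_hol_into_disk hG _ Du) => v Dv.
    by apply: (petal_disk hsg hpet); exact: GD.
  - exact: FD.
  - exact: GD.
  - exact: GF.
  - move=> u Du; rewrite (dens u Du); apply: mulr_ge0; last exact: cabs_ge0.
    exact: ltW (lambda_disk_gt0 (FD u Du)).
  - by move=> u Du; exact: ltW (lambda_disk_gt0 Du).
  - by move=> u; exact: hyp_density_cont.
  - by move=> u; exact: lambda_disk_cont.
  - by move=> u Du; rewrite (dens u Du).
  - move=> u Du; have DGu := GD u Du.
    rewrite (dens _ DGu) (FG u Du) -mulrA -cabsM.
    have dG := derivable_cdiff (hG u Du).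
    have dF := derivable_cdiff (hF _ DGu).
    have [r r0 hr] := disk_ball Du.
    have id1 : cdiff (fun w => w) u (derive1 F (G u) * derive1 G u).
      by apply: cdiff_near r0 _ (cdiff_comp dG dF) => v /hr/FG.
    by rewrite (cdiff_uniq id1 (cdiff_id u)) cabs1 mulr1.
  - exact: Dz.
  - exact: Dw.
have I01 : -1 < cabs (F w) < 1.
  by have := cabs_ge0 (F w); have h : cabs (F w) < 1 := DFw; move=> h0; apply/andP; split; lra.
have /nbhs_realP[d d0 hd] := proj1 (@cvgrPdist_lt _ _ _ (nbhs (cabs (F w))) (nbhs_filter _) _ _)
  (artanh_cont I01) e e0.
have [s s0 hs] := lim2 w Dw d d0.
exists s => // t st.
rewrite (hyp_dist_disk_mob (backflow_disk hsg hpet t Dz) (backflow_disk hsg hpet t Dw)).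
rewrite hyp_dist_disk0; last by apply: mob_disk; exact: backflow_disk.
by rewrite distrC; apply: hd; exact: hs.
Qed.

End PetalLimit.

Unset Implicit Arguments.
Set Strict Implicit.
Set Printing Implicit Defensive.

Theorem theorem1p3 (R : realType) (phi : R -> R[i] -> R[i])
    (Delta : set R[i]) (phi_nonelliptic : nonelliptic phi)
    (Delta_petal : petal phi Delta) :
  (forall K : set R[i], compact K -> K `<=` Delta ->
     {uniform K,
        (fun (t : R) (z : R[i]) =>
           lambda_disk (petal_flow phi Delta t z) *
           cabs (derive1 (petal_flow phi Delta t) z)) @ -oo
        --> hyp_density Delta}) /\
  (forall z w : R[i], Delta z -> Delta w ->
     hyp_dist_disk (petal_flow phi Delta t z) (petal_flow phi Delta t w)
       @[t --> -oo] --> hyp_dist Delta z w).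
Proof.
have hsg := phi_nonelliptic.1.
have backflowN t : backflow phi Delta (- t) = petal_flow phi Delta t by rewrite /backflow opprK.
split.
- move=> K cK KD P /uniform_nbhs[E [eE EP]].
  move: eE; rewrite -entourage_ballE => -[e /= e0 he].
  have [s s0 hs] := flow_density_unif hsg Delta_petal cK KD e0.
  exists (- s); split; first exact: num_real.
  move=> t ts; apply: EP => z Kz; apply: he => /=.
  rewrite -backflowN; apply: (hs (- t)) => //; lra.
- move=> z w Dz Dw; apply/cvgrPdist_lt => e e0.
  have [s s0 hs] := hyp_dist_petal_cvg hsg Delta_petal Dz Dw e0.
  exists (- s); split; first exact: num_real.
  move=> t ts; rewrite -backflowN distrC; apply: hs; lra.
Qed.
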